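(* For generic parameters $u=(u_1,u_2,u_3)$, $v=(v_1,v_2,v_3)$, the operator $\check{\mathbb{R}}(u;v)$ on $\mathbb{C}[x_1,y_1,z_1,x_2,y_2,z_2]$ solving $$\check{\mathbb{R}}(u;v)\,\mathrm{L}_{1}(u_1,u_2,u_3)\,\mathrm{L}_{2}(v_1,v_2,v_3)=\mathrm{L}_{1}(v_1,v_2,v_3)\,\mathrm{L}_{2}(u_1,u_2,u_3)\,\check{\mathbb{R}}(u;v)$$ can be factorized (up to scalar normalization) as $$\check{\mathbb{R}}(u;v)=\mathcal{R}_1(u_1|v_1,u_2,u_3)\,\mathcal{R}_2(u_1,u_2|v_2,u_3)\,\mathcal{R}_3(u_1,u_2,u_3|v_3);$$ that is, this product gives a solution $\check{\mathbb{R}}(u;v)$ of the displayed equation.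
   Context: For complex parameters $a_1,a_2,a_3$ and $k\in\{1,2\}$ the $s\ell(3)$ Lax operator is the $3\times3$ matrix of differential operators $$\mathrm{L}_k(a_1,a_2,a_3)=\begin{pmatrix}1&0&0\\ -x_k&1&0\\ -y_k&-z_k&1\end{pmatrix}\begin{pmatrix}a_1&\partial_{x_k}-z_k\partial_{y_k}&\partial_{y_k}\\ 0&a_2&\partial_{z_k}\\ 0&0&a_3\end{pmatrix}\begin{pmatrix}1&0&0\\ x_k&1&0\\ y_k+x_kz_k&z_k&1\end{pmatrix}$$ acting on $\mathbb{C}[x_1,y_1,z_1,x_2,y_2,z_2]$, where products are matrix products with (noncommuting) operator entries. An operator placed to the left or right of a matrix composes with each entry from that side. Parameters are complex and generic: no pairwise difference of $u_1,u_2,u_3,v_1,v_2,v_3$ is an integer. The operators $\mathcal{R}_1,\mathcal{R}_2,\mathcal{R}_3$ on $\mathbb{C}[x_1,y_1,z_1,x_2,y_2,z_2]$ are, up to scalar normalization: $$\mathcal{R}_1(u_1|v_1,v_2,v_3)= S_1^{-1}\cdot\frac{\Gamma(x\partial_x+u_1-v_2+1)}{\Gamma(x\partial_x+1)}\cdot e^{-\frac{y}{x}\partial_z}\cdot\frac{\Gamma(y\partial_y+u_1-v_3+1)}{\Gamma(y\partial_y+v_1-v_3+1)}\cdot e^{\frac{y}{x}\partial_z}\cdot\frac{\Gamma(x\partial_x+1)}{\Gamma(x\partial_x+v_1-v_2+1)}\cdot S_1,$$ $S_1=e^{(y_1-z_1x_2)\partial_{y_2}}e^{z_1\partial_{z_2}}e^{x_1\partial_{x_2}}$,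 $x=x_2$, $y=y_2+x_2z_2$, $z=z_2$, $\partial_x=\partial_{x_2}-z_2\partial_{y_2}$, $\partial_y=\partial_{y_2}$, $\partial_z=\partial_{z_2}-x_2\partial_{y_2}$; $$\mathcal{R}_2(u_1,u_2|v_2,v_3)= S_2^{-1}\cdot\frac{\Gamma(z_2\partial_{z_2}+u_2-v_3+1)}{\Gamma(z_2\partial_{z_2}+1)}\cdot e^{\frac{y_1}{z_2}\partial_{x_1}}\cdot\frac{\Gamma(x_1\partial_{x_1}+u_1-v_2+1)}{\Gamma(x_1\partial_{x_1}+u_1-u_2+1)}\cdot e^{-\frac{y_1}{z_2}\partial_{x_1}}\cdot\frac{\Gamma(z_2\partial_{z_2}+1)}{\Gamma(z_2\partial_{z_2}+v_2-v_3+1)}\cdot S_2,$$ $S_2=e^{(y_2-x_1z_1)\partial_{y_1}}e^{z_1\partial_{z_2}}e^{x_2\partial_{x_1}}$; $$\mathcal{R}_3(u_1,u_2,u_3|v_3)= S_3^{-1}\cdot\frac{\Gamma(z_1\partial_{z_1}+u_2-v_3+1)}{\Gamma(z_1\partial_{z_1}+1)}\cdot e^{\frac{y_1}{z_1}\partial_{x_1}}\cdot\frac{\Gamma(y_1\partial_{y_1}+u_1-v_3+1)}{\Gamma(y_1\partial_{y_1}+u_1-u_3+1)}\cdot e^{-\frac{y_1}{z_1}\partial_{x_1}}\cdot\frac{\Gamma(z_1\partial_{z_1}+1)}{\Gamma(z_1\partial_{z_1}+u_2-u_3+1)}\cdot S_3,$$ $S_3=e^{(y_2-x_1z_2)\partial_{y_1}}e^{z_2\partial_{z_1}}e^{x_2\partial_{x_1}}$.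 Arguments in the claim are substituted positionally into these formulas. Exponentials act by their locally finite power series; a function $f(t\partial_t)$ multiplies a monomial by $f$ of its exponent in $t$ (for $\mathcal{R}_1$, monomials in $x,y,z$ and the spectators $x_1,y_1,z_1$). Intermediate negative powers of $x$ (resp. $z_2$, $z_1$) are allowed, and $1/\Gamma$ is $0$ at the nonpositive integers, so the leftmost Gamma quotient annihilates them. These operators satisfy $\mathcal{R}_{1}\mathrm{L}_{1}(u_1,u_2,u_3)\mathrm{L}_{2}(v_1,v_2,v_3)=\mathrm{L}_{1}(v_1,u_2,u_3)\mathrm{L}_{2}(u_1,v_2,v_3)\mathcal{R}_{1}$, $\mathcal{R}_{2}\mathrm{L}_{1}(u_1,u_2,u_3)\mathrm{L}_{2}(v_1,v_2,v_3)=\mathrm{L}_{1}(u_1,v_2,u_3)\mathrm{L}_{2}(v_1,u_2,v_3)\mathcal{R}_{2}$, $\mathcal{R}_{3}\mathrm{L}_{1}(u_1,u_2,u_3)\mathrm{L}_{2}(v_1,v_2,v_3)=\mathrm{L}_{1}(u_1,u_2,v_3)\mathrm{L}_{2}(v_1,v_2,u_3)\mathcal{R}_{3}$, with $\mathcal{R}_1=\mathcal{R}_1(u_1|v_1,v_2,v_3)$, $\mathcal{R}_2=\mathcal{R}_2(u_1,u_2|v_2,v_3)$, $\mathcal{R}_3=\mathcal{R}_3(u_1,u_2,u_3|v_3)$. *)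

(* Defs.v *)
From HB Require Import structures.
From mathcomp Require Import all_boot all_order all_algebra.
From mathcomp Require Import complex classical_sets fsbigop reals topology sequences.
From mathcomp Require normedtype exp trigo.

Set Implicit Arguments.
Unset Strict Implicit.
Unset Printing Implicit Defensive.

Import Order.TTheory GRing.Theory Num.Theory.

Local Open Scope ring_scope.

(* A module, because the notations of [normedtype] and [exp] clash with those
   of [mpoly]. *)
Module ComplexGamma.

Import normedtype exp trigo numFieldNormedType.Exports.

Section Gamma.
Variable R : realType.
Local Notation C := R[i].

(* n ^ z = e ^ (z ln n) *)
Definition natpow (n : nat) (z : C) : C :=
  let l : R := ln n%:R in
  let r : R := expR (complex.Re z * l) in
  let t : R := complex.Im z * l in
  Complex (r * cos t) (r * sin t).

(* Gauss' product for the entire function 1/Gamma: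
   1/Gamma(z) = lim_n z (z + 1) ... (z + n) / (n! n^z). *)
Definition rGamma_seq (z : C) (n : nat) : C :=
  (\prod_(k < n.+1) (z + k%:R)) / (n`!%:R * natpow n z).

Definition rGamma (z : C) : C :=
  limn (rGamma_seq z : nat -> C^o).

(* At the poles 0, -1, -2, ... of Gamma this is the junk value 0. *)
Definition Gamma (z : C) : C := (rGamma z)^-1.

(* n |-> Gamma(n + a) / Gamma(n + b); the entire function 1/Gamma makes it
   vanish when n + b is a pole of Gamma. *)
Definition Gamma_quot (a b : C) (n : int) : C :=
  Gamma (n%:~R + a) * rGamma (n%:~R + b).

Lemma rGamma_nonpos (k : nat) : rGamma (- k%:R) = 0.
Proof.
apply: (@norm_lim_near_cst C C^o nat); exists k => // n /= kn; rewrite /rGamma_seq.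
by rewrite (bigD1 (Ordinal (kn : k < n.+1)%N)) //= addNr !mul0r.
Qed.

Lemma Gamma_quot_neg (a : C) (n : int) : n < 0 -> Gamma_quot a 1 n = 0.
Proof.
case: n => // n _; rewrite /Gamma_quot.
have -> : (Negz n)%:~R + 1 = - n%:R :> C.
  by rewrite NegzE mulrNz -[n.+1%:~R]/(n.+1%:R) -natr1 opprD addrNK.
by rewrite rGamma_nonpos mulr0.
Qed.

End Gamma.

End ComplexGamma.
Import ComplexGamma.

From mathcomp Require Import freeg mpoly.

(* e^D v as a finitely supported sum; meant for locally nilpotent D, where only
   finitely many terms are nonzero. *)
Definition opexp (K : fieldType) (V : lmodType K) (D : V -> V) (v : V) : V :=
  \sum_(k \in [set: nat]) (k`!%:R^-1 : K) *: iter k D v.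

(* The variables (x_1, y_1, z_1, x_2, y_2, z_2), in this order. *)
Definition x1 : 'I_6 := @Ordinal 6 0 isT.
Definition y1 : 'I_6 := @Ordinal 6 1 isT.
Definition z1 : 'I_6 := @Ordinal 6 2 isT.
Definition x2 : 'I_6 := @Ordinal 6 3 isT.
Definition y2 : 'I_6 := @Ordinal 6 4 isT.
Definition z2 : 'I_6 := @Ordinal 6 5 isT.

Section Operators.
Variable R : realType.
Local Notation C := R[i].
Local Notation P := {mpoly C[6]}.

(* e^{q d_i} on polynomials *)
Definition flow (q : P) (i : 'I_6) : P -> P := opexp (fun p => q * p^`M(i)).

(* Laurent polynomials: finite linear combinations of monomials with integer
   exponents. *)
Local Notation Lau := {freeg {ffun 'I_6 -> int} / C}.

Definition unit_exp (i : 'I_6) : {ffun 'I_6 -> int} := [ffun j => (i == j)%:Z].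

Definition to_laurent (p : P) : Lau :=
  fglift (fun m : 'X_{1..6} => << [ffun i => (m i)%:Z] >> : Lau) (mpoly_val p).

(* Left inverse of [to_laurent]: kills the monomials having a negative
   exponent. In the operators R_k below it is applied to polynomials only
   ([R1_laurentK], [R2_laurentK], [R3_laurentK]). *)
Definition of_laurent (f : Lau) : P :=
  fglift (fun m : {ffun 'I_6 -> int} =>
    if [forall i, 0 <= m i] then 'X_[[multinom `|m i|%N | i < 6]] else 0 : P) f.

(* phi (t d_t) for the variable t of index i *)
Definition euler_fun (i : 'I_6) (phi : int -> C) : Lau -> Lau :=
  fglift (fun m : {ffun 'I_6 -> int} => << phi (m i) *g m >>).

(* e^{c (s / t) d_w} *)
Definition lflow (c : C) (s t w : 'I_6) : Lau -> Lau :=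
  opexp (fglift (fun m : {ffun 'I_6 -> int} =>
    << c * (m w)%:~R *g m + unit_exp s - unit_exp t - unit_exp w >>)).

(* S_k^-1 is the product of the inverse exponentials in reverse order. *)
Definition S1 : P -> P :=
  flow ('X_y1 - 'X_z1 * 'X_x2) y2 \o flow 'X_z1 z2 \o flow 'X_x1 x2.
Definition S1inv : P -> P :=
  flow (- 'X_x1) x2 \o flow (- 'X_z1) z2 \o flow (- ('X_y1 - 'X_z1 * 'X_x2)) y2.

Definition S2 : P -> P :=
  flow ('X_y2 - 'X_x1 * 'X_z1) y1 \o flow 'X_z1 z2 \o flow 'X_x2 x1.
Definition S2inv : P -> P :=
  flow (- 'X_x2) x1 \o flow (- 'X_z1) z2 \o flow (- ('X_y2 - 'X_x1 * 'X_z1)) y1.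

Definition S3 : P -> P :=
  flow ('X_y2 - 'X_x1 * 'X_z2) y1 \o flow 'X_z2 z1 \o flow 'X_x2 x1.
Definition S3inv : P -> P :=
  flow (- 'X_x2) x1 \o flow (- 'X_z2) z1 \o flow (- ('X_y2 - 'X_x1 * 'X_z2)) y1.

(* The coordinates x = x_2, y = y_2 + x_2 z_2, z = z_2 (and x_1, y_1, z_1):
   [to_xyz] rewrites a polynomial in (x_2, y_2, z_2) as one in (x, y, z), and
   [of_xyz] substitutes back. Indices x2, y2, z2 stand for x, y, z in between,
   and d_{x_2} - z_2 d_{y_2}, d_{y_2}, d_{z_2} - x_2 d_{y_2} become the partial
   derivatives d_x, d_y, d_z. *)
Definition to_xyz (p : P) : P :=
  p \mPo [tuple 'X_x1; 'X_y1; 'X_z1; 'X_x2; 'X_y2 - 'X_x2 * 'X_z2; 'X_z2].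
Definition of_xyz (p : P) : P :=
  p \mPo [tuple 'X_x1; 'X_y1; 'X_z1; 'X_x2; 'X_y2 + 'X_x2 * 'X_z2; 'X_z2].

Definition R1_laurent (u1 v1 v2 v3 : C) : Lau -> Lau :=
  euler_fun x2 (Gamma_quot (u1 - v2 + 1) 1) \o
  lflow (- 1) y2 x2 z2 \o
  euler_fun y2 (Gamma_quot (u1 - v3 + 1) (v1 - v3 + 1)) \o
  lflow 1 y2 x2 z2 \o
  euler_fun x2 (Gamma_quot 1 (v1 - v2 + 1)).

(* R_1(u1 | v1, v2, v3) *)
Definition R1 (u1 v1 v2 v3 : C) : P -> P :=
  S1inv \o of_xyz \o of_laurent \o R1_laurent u1 v1 v2 v3 \o
  to_laurent \o to_xyz \o S1.

Definition R2_laurent (u1 u2 v2 v3 : C) : Lau -> Lau :=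
  euler_fun z2 (Gamma_quot (u2 - v3 + 1) 1) \o
  lflow 1 y1 z2 x1 \o
  euler_fun x1 (Gamma_quot (u1 - v2 + 1) (u1 - u2 + 1)) \o
  lflow (- 1) y1 z2 x1 \o
  euler_fun z2 (Gamma_quot 1 (v2 - v3 + 1)).

(* R_2(u1, u2 | v2, v3) *)
Definition R2 (u1 u2 v2 v3 : C) : P -> P :=
  S2inv \o of_laurent \o R2_laurent u1 u2 v2 v3 \o to_laurent \o S2.

Definition R3_laurent (u1 u2 u3 v3 : C) : Lau -> Lau :=
  euler_fun z1 (Gamma_quot (u2 - v3 + 1) 1) \o
  lflow 1 y1 z1 x1 \o
  euler_fun y1 (Gamma_quot (u1 - v3 + 1) (u1 - u3 + 1)) \o
  lflow (- 1) y1 z1 x1 \o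
  euler_fun z1 (Gamma_quot 1 (u2 - u3 + 1)).

(* R_3(u1, u2, u3 | v3) *)
Definition R3 (u1 u2 u3 v3 : C) : P -> P :=
  S3inv \o of_laurent \o R3_laurent u1 u2 u3 v3 \o to_laurent \o S3.

Definition opmx := 'M[P -> P]_3.

Definition opmx_mul (A B : opmx) : opmx :=
  \matrix_(i, j) (fun p => \sum_k A i k (B k j p)).

Definition op_opmx (T : P -> P) (A : opmx) : opmx := \matrix_(i, j) (T \o A i j).
Definition opmx_op (A : opmx) (T : P -> P) : opmx := \matrix_(i, j) (A i j \o T).

Definition opmx_of_rows (rows : seq (seq (P -> P))) : opmx :=
  \matrix_(i, j) nth (fun=> 0) (nth [::] rows i) j.

(* The Lax operator in the variables of indices x, y, z. *)
Definition Lax (x y z : 'I_6) (a1 a2 a3 : C) : opmx :=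
  let mul (q : P) : P -> P := fun p => q * p in
  opmx_mul
    (opmx_mul
      (opmx_of_rows [:: [:: mul 1;         mul 0;         mul 0];
                        [:: mul (- 'X_x);  mul 1;         mul 0];
                        [:: mul (- 'X_y);  mul (- 'X_z);  mul 1]])
      (opmx_of_rows [:: [:: mul a1%:MP; (fun p => p^`M(x) - 'X_z * p^`M(y)); mderiv y];
                        [:: mul 0;      mul a2%:MP;                          mderiv z];
                        [:: mul 0;      mul 0;                               mul a3%:MP]]))
    (opmx_of_rows [:: [:: mul 1;                      mul 0;      mul 0];
                      [:: mul 'X_x;                   mul 1;      mul 0];
                      [:: mul ('X_y + 'X_x * 'X_z);   mul 'X_z;   mul 1]]).

Definition Lax1 : C -> C -> C -> opmx := Lax x1 y1 z1.
Definition Lax2 : C -> C -> C -> opmx := Lax x2 y2 z2.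

Definition generic (u1 u2 u3 v1 v2 v3 : C) : Prop :=
  let s := [:: u1; u2; u3; v1; v2; v3] in
  forall i j : 'I_6, i != j -> forall n : int, s`_i - s`_j != n%:~R.

Lemma fgliftE (V : lmodType C) (K : choiceType) (F : K -> V) (f : {freeg K / C}) :
  fglift F f = \sum_(m <- dom f) coeff m f *: F m.
Proof.
have fB g h : fglift F (g - h) = fglift F g - fglift F h by exact: lift_is_additive.
have f0 : fglift F 0 = 0 by rewrite -(subrr 0) fB subrr.
have fD g h : fglift F (g + h) = fglift F g + fglift F h.
  by rewrite -{1}(opprK h) fB -(sub0r h) fB f0 sub0r opprK.
rewrite -{1}(freeg_sumE f) (big_morph _ fD f0).
by apply: eq_bigr => m _; rewrite liftU.
Qed.

Definition supported (S : pred {ffun 'I_6 -> int}) (f : Lau) : Prop :=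
  forall m, ~~ S m -> coeff m f = 0.

Lemma supportedD S f g : supported S f -> supported S g -> supported S (f + g).
Proof. by move=> Sf Sg m Sm; rewrite coeffD Sf ?Sg ?addr0. Qed.

Lemma supported_sum (I : Type) (r : seq I) (Q : pred I) S (F : I -> Lau) :
  (forall i, Q i -> supported S (F i)) -> supported S (\sum_(i <- r | Q i) F i).
Proof.
move=> SF; apply: big_ind => //; first by move=> m _; rewrite coeff0.
exact: supportedD.
Qed.

Lemma supportedZ S c f : supported S f -> supported S (c *: f).
Proof. by move=> Sf m Sm; rewrite coeffZ Sf ?mulr0. Qed.

Lemma supportedU (S : pred {ffun 'I_6 -> int}) (c : C) m :
  (c != 0 -> S m) -> supported S << c *g m >>.
Proof.
move=> cS n; case: (eqVneq c 0) => [->|/cS Sm Sn]; first by rewrite freegU0 coeff0.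
by rewrite coeffU; case: eqP Sn => [<-|]; rewrite ?Sm ?mulr0.
Qed.

Lemma supported_lift (K : choiceType) S (F : K -> Lau) (f : {freeg K / C}) :
  (forall m, m \in dom f -> supported S (F m)) -> supported S (fglift F f).
Proof.
move=> SF; rewrite fgliftE big_seq_cond; apply: supported_sum => m.
by rewrite andbT => /SF; apply: supportedZ.
Qed.

Lemma supported_dom S f m : supported S f -> m \in dom f -> S m.
Proof.
by move=> Sf; rewrite mem_dom; apply: contraR => /Sf ->; rewrite eqxx.
Qed.

(* All exponents are nonnegative, except possibly that of the variable i. *)
Definition nonneg_off (i : 'I_6) : pred {ffun 'I_6 -> int} :=
  fun m => [forall j, (j != i) ==> (0 <= m j)].

Lemma supported_euler_fun S i phi f : supported S f -> supported S (euler_fun i phi f).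
Proof.
move=> Sf; apply: supported_lift => m /(supported_dom Sf) Sm.
exact: supportedU.
Qed.

Lemma supported_lflow c s t w f : w != t ->
  supported (nonneg_off t) f -> supported (nonneg_off t) (lflow c s t w f).
Proof.
move=> wt Sf; apply: supported_sum => k _; apply: supportedZ.
elim: k => [|k IHk] //=; apply: supported_lift => m /(supported_dom IHk) Sm.
apply: supportedU => cm; apply/forallP => j; apply/implyP => jt.
have /forallP Sm' := Sm; have := Sm' j; rewrite jt /= => mj.
rewrite !ffunE (negbTE (_ : t != j)) 1?eq_sym // subr0.
have [jw|/negPf jw] := eqVneq w j; last by rewrite subr0 addr_ge0.
have m0 : m w != 0 by apply: contra cm => /eqP ->; rewrite mulr0.
have : 1 <= m j by rewrite -jw -gtz0_ge1 lt_def m0 jw.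
by move=> m1; rewrite -addrA addrCA addr_ge0 // subr_ge0.
Qed.

Lemma supported_to_laurent i p : supported (nonneg_off i) (to_laurent p).
Proof.
apply: supported_lift => m _; apply: supportedU => _.
by apply/forallP => j; rewrite ffunE implybT.
Qed.

Lemma supported_last i a f : supported (nonneg_off i) f ->
  supported (fun m => [forall j, 0 <= m j]) (euler_fun i (Gamma_quot a 1) f).
Proof.
move=> Sf; apply: supported_lift => m /(supported_dom Sf) /forallP Sm.
apply: supportedU => Gm; apply/forallP => j.
have [->|ji] := eqVneq j i; last by have := Sm j; rewrite ji.
by rewrite leNgt; apply: contra Gm => /Gamma_quot_neg ->.
Qed.

Lemma of_laurentK f :
  supported (fun m => [forall j, 0 <= m j]) f -> to_laurent (of_laurent f) = f.
Proof.
move=> Sf.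
have tB p q : to_laurent (p - q) = to_laurent p - to_laurent q.
  by rewrite /to_laurent -lift_is_additive.
have t0 : to_laurent 0 = 0 by rewrite -(subrr 0) tB subrr.
have tD p q : to_laurent (p + q) = to_laurent p + to_laurent q.
  by rewrite -{1}(opprK q) tB -(sub0r q) tB t0 sub0r opprK.
rewrite /of_laurent fgliftE (big_morph _ tD t0) -[RHS]freeg_sumE.
rewrite !big_seq; apply: eq_bigr => m /(supported_dom Sf) Sm; rewrite Sm.
set c := coeff m f; set m' := [multinom _ | _ < _].
have -> : c *: 'X_[m'] = [mpoly << c *g m' >>] :> P.
  by apply/mpolyP => n; rewrite mcoeffZ mcoeffX mcoeff_MPoly coeffU.
rewrite /to_laurent /= liftU.
have -> : [ffun i => (m' i)%:Z] = m.
  apply/ffunP => j; rewrite ffunE mnmE gez0_abs //.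
  exact: (forallP Sm).
by apply/eqP/freeg_eqP => n; rewrite coeffZ !coeffU mul1r.
Qed.

Lemma R1_laurentK u1 v1 v2 v3 p :
  to_laurent (of_laurent (R1_laurent u1 v1 v2 v3 (to_laurent p))) =
  R1_laurent u1 v1 v2 v3 (to_laurent p).
Proof.
by apply/of_laurentK/supported_last/supported_lflow/supported_euler_fun
  /supported_lflow/supported_euler_fun/supported_to_laurent.
Qed.

Lemma R2_laurentK u1 u2 v2 v3 p :
  to_laurent (of_laurent (R2_laurent u1 u2 v2 v3 (to_laurent p))) =
  R2_laurent u1 u2 v2 v3 (to_laurent p).
Proof.
by apply/of_laurentK/supported_last/supported_lflow/supported_euler_fun
  /supported_lflow/supported_euler_fun/supported_to_laurent.
Qed.

Lemma R3_laurentK u1 u2 u3 v3 p :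
  to_laurent (of_laurent (R3_laurent u1 u2 u3 v3 (to_laurent p))) =
  R3_laurent u1 u2 u3 v3 (to_laurent p).
Proof.
by apply/of_laurentK/supported_last/supported_lflow/supported_euler_fun
  /supported_lflow/supported_euler_fun/supported_to_laurent.
Qed.

End Operators.

(* Main.v *)
Require Import Defs.
From mathcomp Require Import all_boot all_order all_algebra.
From mathcomp Require Import complex reals.
From mathcomp Require Import classical_sets boolp fsbigop ring.
From mathcomp Require topology sequences normedtype exp trigo.

Set Implicit Arguments.
Unset Strict Implicit.
Unset Printing Implicit Defensive.

Import Order.TTheory GRing.Theory Num.Theory.

Local Open Scope ring_scope.

(** The product of Lax operators depends on the six parameters (u; v), and each
    of the three factors exchanges one pair: R_3 exchanges u_3 and v_3, then R_2
    exchanges u_2 and v_2, then R_1 exchanges u_1 and v_1. After the three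
    exchanges (u; v) has become (v; u), so the theorem is the composition of
    [R3_intertwines], [R2_intertwines] and [R1_intertwines], the middle and last
    ones taken at the parameters that the previous exchanges have produced.

    The three exchanges have a common proof. In suitable coordinates R_k is
    S^-1 r S, where S is a composition of translations ([shear]; for R_1 it is
    followed by the passage to the coordinates x, y, z) and r, called [core]
    below, is Phi1(N_t) e^(c (s/t) d_w) Phi2(N_j) e^(-c (s/t) d_w) Phi3(N_t) for
    three of the variables s, t, w, with N_i = x_i d_i, j = s or j = w, and
    quotients Phi_i of Gamma functions.

    Conjugation by S separates the two sets of variables. The unipotent factors
    of the two Lax matrices multiply as in a group, and the factors in the
    variables x', y', z' that r does not touch cancel in the middle of the
    product; only one is left at each end, where it commutes with r
    ([shear_lax3], [shear_lax2], [shear_lax1]). What is left between them has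
    entries that are noncommutative polynomials in a few operators: Euler
    operators, derivatives in x', y', z', one letter that commutes with r, and
    Q, M, F (for R_1 and R_3) or Q, G, T (for R_2), see [expanded3],
    [expanded2] and [expanded1]. The other complicated entries are commutators of
    these, or half of a commutator plus a quadratic polynomial in the Euler
    operators ([comFM], [comQF], [comQM] and their variants), so it is enough
    that r intertwines the generators. The exchange of parameters happens there:
    r Q(beta) = Q(alpha) r, r M(gamma) = M(delta) r, r G(delta) = G(gamma) r,
    while F and T commute with r.

    Each generator, written on Laurent monomials, is a sum of two terms: a shift
    of exponents by k and a shift by k + d, with coefficients depending on the
    exponents, where d is the shift of (s/t) d_w. The functional
    equation of Gamma moves such an operator through each Phi_i, and an
    exponential series that stops after two commutators moves it through
    e^(c (s/t) d_w); [core_intertwine] collects the conditions. There is one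
    obstruction: the recursion of Phi3 fails where an exponent of t crosses from
    0 to -1. The error consists of monomials with a negative power of t, a
    negative power stays negative under the exponentials and Phi2, and Phi1, being
    a multiple of 1 / Gamma(N_t + 1), annihilates it ([tail_negative]).

    The functional equation of 1 / Gamma comes from the partial Gauss products,
    whose successive ratios tend to 1 ([rGamma_rec]). *)

(** * The functional equation of the Gamma quotients *)

Module GammaRec.
Import topology sequences normedtype exp trigo numFieldNormedType.Exports ComplexGamma.

(** The sequences converge together, because their ratio tends to [z]; and if
    both diverge, both values of [limn] are the default 0. So the functional
    equation of a limit is obtained without knowing that the limit exists. *)
Lemma lim_ratio (K : numFieldType) (z : K) (s s' a : nat -> K^o) : z != 0 ->
    (a @ \oo --> (1 : K^o))%classic ->
    (forall n, (0 < n)%N -> z * s' n = s n * a n) ->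
  limn s = z * limn s'.
Proof.
move=> z0 ha sa.
have hav : ((fun n => (a n)^-1) @ \oo --> (1 : K^o))%classic.
  by rewrite -[X in (_ --> X)%classic](@invr1 K); apply: cvgV => //; apply: oner_neq0.
have a0 : \forall n \near \oo%classic, a n != 0.
  have /cvgrPdist_lt/(_ 1 ltr01) := ha.
  apply: filterS => n; apply: contraTneq => ->.
  by rewrite subr0 normr1 ltxx.
have fwd (l : K^o) : (s @ \oo --> l -> s' @ \oo --> (z^-1 * l : K^o))%classic.
  move=> sl.
  have : ((fun n => z^-1 * (s n * a n)) @ \oo --> (z^-1 * (l * 1) : K^o))%classic.
    by apply: cvgM; [exact: cvg_cst|apply: cvgM].
  rewrite mulr1; apply: cvg_trans; apply: near_eq_cvg.
  exists 1%N => // n /= n0.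
  by rewrite -sa // mulrA mulVf // mul1r.
have bwd (l : K^o) : (s' @ \oo --> l -> s @ \oo --> (z * l : K^o))%classic.
  move=> sl.
  have : ((fun n => z * s' n * (a n)^-1) @ \oo --> (z * l * 1 : K^o))%classic.
    by apply: cvgM => //; apply: cvgM => //; exact: cvg_cst.
  rewrite mulr1; apply: cvg_trans; apply: near_eq_cvg.
  near=> n; have n0 : (0 < n)%N by near: n; exists 1%N.
  by rewrite sa // mulfK //; near: n.
have [/cvg_ex [l sl]|ns] := pselect (cvg (s @ \oo)%classic).
  rewrite (cvg_lim _ sl) //.
  by rewrite (cvg_lim _ (fwd _ sl)) // mulrA mulfV // mul1r.
have ns' : ~ cvg (s' @ \oo)%classic.
  by move=> /cvg_ex [l sl]; apply: ns; apply/cvg_ex; exists (z * l); apply: bwd.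
by rewrite (dvgP ns) (dvgP ns') [z * _]mulr0.
Unshelve. all: by end_near.
Qed.

Lemma cvg_add1M (K : numFieldType) (z : K) (u : nat -> K^o) :
  (u @ \oo --> (0 : K^o) -> (fun n => 1 + z * u n) @ \oo --> (1 : K^o))%classic.
Proof.
move=> u0.
have : ((fun n => 1 + z * u n) @ \oo --> (1 + z * 0 : K^o))%classic.
  by apply: cvgD; [exact: cvg_cst|apply: cvgM => //; exact: cvg_cst].
by rewrite mulr0 addr0.
Qed.

Section GammaRec.
Variable R : realType.
Local Notation C := R[i].
Local Open Scope classical_set_scope.

Lemma natpow_succ (n : nat) (z : C) : (0 < n)%N -> natpow n (z + 1) = natpow n z * n%:R.
Proof.
case: z => a b n0; rewrite /natpow /=.
rewrite addr0 mulrDl mul1r expRD lnK ?posrE ?ltr0n //.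
rewrite -(rmorph_nat (real_complex R)) /=.
by apply/eqP; rewrite eq_complex /= !mulr0 subr0 add0r; apply/andP; split; apply/eqP; ring.
Qed.

Lemma natpow_neq0 (n : nat) (z : C) : natpow n z != 0.
Proof.
rewrite /natpow; move: (complex.Im z * _) => t; set r := expR _.
have r0 : r != 0 by rewrite gt_eqF ?expR_gt0.
rewrite eq_complex /= !mulf_eq0 (negPf r0) /=; apply/negP => /andP[/eqP c0 /eqP s0].
by have := cos2Dsin2 t; rewrite c0 s0 !expr0n addr0 => /eqP; rewrite eq_sym oner_eq0.
Qed.

(** Up to the factor [z], the products differ by the last factor z + n + 1 of the
    numerator and by n in the denominator; the quotient of these is
    1 + (z + 1) / n. *)
Lemma rGamma_seq_succ (z : C) (n : nat) : (0 < n)%N ->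
  z * rGamma_seq (z + 1) n = rGamma_seq z n * (1 + (z + 1) * n%:R^-1).
Proof.
move=> n0; rewrite /rGamma_seq natpow_succ // mulrA.
have -> : z * \prod_(k < n.+1) (z + 1 + k%:R) =
          (\prod_(k < n.+1) (z + k%:R)) * (z + n.+1%:R).
  rewrite -(@big_ord_recr _ 1 *%R n.+1 (fun k : 'I_n.+2 => z + (k : nat)%:R)).
  rewrite [RHS]big_ord_recl /= addr0.
  congr (_ * _); apply: eq_bigr => k _.
  by rewrite /bump /= add1n -addrA -natr1 [k%:R + 1]addrC.
have nn : n%:R != 0 :> C by rewrite pnatr_eq0 -lt0n.
have fn : n`!%:R != 0 :> C by rewrite pnatr_eq0 -lt0n fact_gt0.
have pn := natpow_neq0 n z.
by rewrite -natr1; field; rewrite pn nn fn.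
Qed.

Lemma cvg_ratio (z : C) :
  (fun n : nat => 1 + z * n%:R^-1 : C^o) @ \oo --> (1 : C^o).
Proof.
have inv0 : (fun n : nat => n%:R^-1 : C^o) @ \oo --> (0 : C^o).
  apply/cvgrPdist_lt => e; rewrite ltcE /= => /andP[/eqP ime ree].
  have /cvgrPdist_lt/(_ _ ree) [N _ NP] := @cvg_harmonic R.
  exists N.+1 => // -[//|n] /= nN.
  have := NP n nN; rewrite /= !sub0r !normrN => H.
  have -> : e = (complex.Re e)%:C%C by case: e ime {ree NP H} => a b /= ->.
  rewrite normfV normr_nat -(rmorph_nat (real_complex R)) -fmorphV /= ltcR.
  by move: H; rewrite /harmonic /= ger0_norm // invr_ge0.
exact: (@cvg_add1M C z (fun n => n%:R^-1) inv0).
Qed.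

Lemma rGamma_rec (z : C) : rGamma z = z * rGamma (z + 1).
Proof.
have [->|z0] := eqVneq z 0.
  by rewrite mul0r; have := rGamma_nonpos R 0; rewrite mulr0n oppr0.
exact: (lim_ratio z0 (@cvg_ratio (z + 1)) (@rGamma_seq_succ z)).
Qed.

(** The hypothesis keeps the numerator away from its poles; the equation for the
    denominator holds everywhere, as 1 / Gamma is entire. *)
Lemma Gamma_quot_rec (a b : C) (n : int) : n%:~R + a != 0 ->
  (n%:~R + b) * Gamma_quot a b (n + 1) = (n%:~R + a) * Gamma_quot a b n.
Proof.
move=> na; rewrite /Gamma_quot /Gamma intrD.
have E c : n%:~R + 1%:~R + c = n%:~R + c + 1 :> C by rewrite addrAC.
rewrite !E (rGamma_rec (n%:~R + a)) (rGamma_rec (n%:~R + b)) invfM.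
by rewrite [RHS]mulrA mulVKf // mulrCA.
Qed.
End GammaRec.
End GammaRec.

Import ComplexGamma GammaRec.

(** * Lax operators over an abstract Weyl algebra *)

Lemma distinct (T : eqType) (x y z x' y' z' : T) : uniq [:: x; y; z; x'; y'; z'] ->
  (x == y = false) * (x == z = false) * (x == x' = false) * (x == y' = false) *
  (x == z' = false) * (y == x = false) * (y == z = false) * (y == x' = false) *
  (y == y' = false) * (y == z' = false) * (z == x = false) * (z == y = false) *
  (z == x' = false) * (z == y' = false) * (z == z' = false) * (x' == x = false) *
  (x' == y = false) * (x' == z = false) * (x' == y' = false) * (x' == z' = false) *
  (y' == x = false) * (y' == y = false) * (y' == z = false) * (y' == x' = false) *
  (y' == z' = false) * (z' == x = false) * (z' == y = false) * (z' == z = false) *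
  (z' == x' = false) * (z' == y' = false).
Proof.
rewrite /= !inE !negb_or.
case/and5P => /and5P[a b c d e] /and4P[f g h i] /and3P[j k l] /andP[m n] /andP[o _].
by do !split; apply: negbTE; first [assumption | rewrite eq_sym; assumption].
Qed.

Lemma natb01 (A : nzSemiRingType) : (false%:R = 0 :> A) * (true%:R = 1 :> A). Proof. by []. Qed.

(** Derivations [d i] and multiplications by [X i] on an arbitrary commutative
    ring: all identities between differential operators that the proof needs
    hold at this level. *)
Section Algebra.
Variables (C A : comNzRingType) (k : {rmorphism C -> A}) (X : 'I_6 -> A) (d : 'I_6 -> A -> A).
Hypotheses (dD : forall i p q, d i (p + q) = d i p + d i q)
  (dM : forall i p q, d i (p * q) = d i p * q + p * d i q)
  (dk : forall i a, d i (k a) = 0)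
  (dXX : forall i j, d i (X j) = (i == j)%:R)
  (dC : forall i j p, d i (d j p) = d j (d i p)).

Lemma d0 i : d i 0 = 0. Proof. by have := dk i 0; rewrite rmorph0. Qed.
Lemma dkM i a p : d i (k a * p) = k a * d i p.
Proof. by rewrite dM dk mul0r add0r. Qed.
Lemma d1 i : d i 1 = 0. Proof. by have := dk i 1; rewrite rmorph1. Qed.
Lemma dN i p : d i (- p) = - d i p.
Proof. by apply/eqP; rewrite -addr_eq0 -dD addNr d0. Qed.

(** The generators of the entries of the sheared Lax product. The indices s, t,
    w and the scalar c are those of the exponential of c (s/t) d_w in the
    operator that intertwines them. *)
Definition aQ s t w c b p := X t * (X t * d t p) + k b * (X t * p) + k c * (X s * d w p).
Definition aM s t w c b p := k b * d s p + X s * d s (d s p) + k c * d w (d t p).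
Definition aF s t w c b p :=
  X w * (k b * p - X w * d w p - X s * d s p + X t * d t p) + k c * (X s * d t p).
Definition aG s t w c b p := X w * (k b * p + X w * d w p) + k c * (X s * d t p).
Definition aT s t w c b p :=
  k c * d w (d t p) - d s (k b * p + X s * d s p + X w * d w p + X t * d t p).
Definition aN i j p := X i * d i p + X j * d j p.

(** A 3 x 3 matrix of operators is represented by its action on column vectors,
    so that products of matrices are compositions of functions. *)
Definition vec : Type := (A * A * A)%type.
Definition map3 (f : A -> A) (v : vec) : vec := (f v.1.1, f v.1.2, f v.2).

Definition lax_right (x y z : 'I_6) (v : vec) : vec :=
  (v.1.1, X x * v.1.1 + v.1.2, (X y + X x * X z) * v.1.1 + X z * v.1.2 + v.2).
Definition lax_left (x y z : 'I_6) (v : vec) : vec :=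
  (v.1.1, - X x * v.1.1 + v.1.2, - X y * v.1.1 - X z * v.1.2 + v.2).
Definition lax_mid (x y z : 'I_6) (a1 a2 a3 : C) (v : vec) : vec :=
  (k a1 * v.1.1 + (d x v.1.2 - X z * d y v.1.2) + d y v.2, k a2 * v.1.2 + d z v.2, k a3 * v.2).
Definition lax x y z a1 a2 a3 v := lax_left x y z (lax_mid x y z a1 a2 a3 (lax_right x y z v)).

Lemma vec_eq (a b c a' b' c' : A) : a = a' -> b = b' -> c = c' -> (a, b, c) = (a', b', c') :> vec.
Proof. by move=> -> -> ->. Qed.

Variables x y z x' y' z' : 'I_6.
Hypothesis U : uniq [:: x; y; z; x'; y'; z'].

Let ne := distinct U.

Lemma sort_d : (forall p, d y (d x p) = d x (d y p)) * (forall p, d z (d x p) = d x (d z p)) *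
  (forall p, d x' (d x p) = d x (d x' p)) * (forall p, d y' (d x p) = d x (d y' p)) *
  (forall p, d z' (d x p) = d x (d z' p)) * (forall p, d z (d y p) = d y (d z p)) *
  (forall p, d x' (d y p) = d y (d x' p)) * (forall p, d y' (d y p) = d y (d y' p)) *
  (forall p, d z' (d y p) = d y (d z' p)) * (forall p, d x' (d z p) = d z (d x' p)) *
  (forall p, d y' (d z p) = d z (d y' p)) * (forall p, d z' (d z p) = d z (d z' p)) *
  (forall p, d y' (d x' p) = d x' (d y' p)) * (forall p, d z' (d x' p) = d x' (d z' p)) *
  (forall p, d z' (d y' p) = d y' (d z' p)).
Proof. by do !split => *; rewrite dC. Qed.

(** Pushes derivatives onto the arguments and sorts them: an identity between
   differential operators becomes a polynomial identity in the derivatives of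
   the argument. *)
Ltac weyl := rewrite ?(dD, dN, dkM, dM, dk, dXX, ne, eqxx, natb01, d0, d1, mul0r, mul1r, add0r, addr0) ?sort_d; ring.

Definition del p := d x' p - X z' * d y' p.

(** The rules for moving the shear S = e^((y' - x z') d_y) e^(z' d_z) e^(x' d_x)
    to the right of multiplications and derivations. *)
Section Shear.
Variables (S : A -> A).
Hypotheses (SD : forall p q, S (p + q) = S p + S q) (SN : forall p, S (- p) = - S p)
  (Sk : forall a p, S (k a * p) = k a * S p)
  (Sx : forall p, S (X x * p) = (X x + X x') * S p)
  (Sy : forall p, S (X y * p) = (X y + X y' - X x * X z') * S p)
  (Sz : forall p, S (X z * p) = (X z + X z') * S p)
  (Sx' : forall p, S (X x' * p) = X x' * S p)
  (Sy' : forall p, S (X y' * p) = X y' * S p)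
  (Sz' : forall p, S (X z' * p) = X z' * S p)
  (Sdx : forall p, S (d x p) = d x (S p) + X z' * d y (S p))
  (Sdy : forall p, S (d y p) = d y (S p))
  (Sdz : forall p, S (d z p) = d z (S p))
  (Sdx' : forall p, S (d x' p) = d x' (S p) - d x (S p) - X z' * d y (S p))
  (Sdy' : forall p, S (d y' p) = d y' (S p) - d y (S p))
  (Sdz' : forall p, S (d z' p) = d z' (S p) - d z (S p) + X x * d y (S p)).

(** The middle factor of the Lax operator in x', y', z' after the shear: its
    derivatives acquire derivatives in x, y, z. *)
Definition sheared_mid3 (a1 a2 a3 : C) (v : vec) : vec :=
  (k a1 * v.1.1 + (d x' v.1.2 - X z' * d y' v.1.2 - d x v.1.2) + (d y' v.2 - d y v.2),
   k a2 * v.1.2 + (d z' v.2 - d z v.2 + X x * d y v.2), k a3 * v.2).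

Ltac shears := apply: vec_eq; rewrite /= ?mulrDl ?mulNr -?mulrA
  ?(SD, SN, Sk, Sx, Sy, Sz, Sx', Sy', Sz', Sdx, Sdy, Sdz, Sdx', Sdy', Sdz') ?(dD, dN, dM, dXX, ne, eqxx, natb01); ring.

Lemma S_lax_left v : map3 S (lax_left x y z v) = lax_left x' y' z' (lax_left x y z (map3 S v)).
Proof. case: v => [[p q] r]; shears. Qed.
Lemma S_lax_mid a1 a2 a3 v : map3 S (lax_mid x y z a1 a2 a3 v) = lax_mid x y z a1 a2 a3 (map3 S v).
Proof. case: v => [[p q] r]; shears. Qed.
Lemma S_lax_right v : map3 S (lax_right x y z v) = lax_right x y z (lax_right x' y' z' (map3 S v)).
Proof. case: v => [[p q] r]; shears. Qed.
Lemma S_lax_left' v : map3 S (lax_left x' y' z' v) = lax_left x' y' z' (map3 S v).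
Proof. case: v => [[p q] r]; shears. Qed.
Lemma S_lax_mid' a1 a2 a3 v : map3 S (lax_mid x' y' z' a1 a2 a3 v) = sheared_mid3 a1 a2 a3 (map3 S v).
Proof. case: v => [[p q] r]; shears. Qed.
Lemma S_lax_right' v : map3 S (lax_right x' y' z' v) = lax_right x' y' z' (map3 S v).
Proof. case: v => [[p q] r]; shears. Qed.
Lemma lax_rightK i j l v : lax_right i j l (lax_left i j l v) = v.
Proof. case: v => [[p q] r]; apply: vec_eq; rewrite /=; ring. Qed.

(** The shear is addition in the unipotent group: it turns [lax_right x y z] into
    the product with [lax_right x' y' z'], which cancels against [lax_left] of
    the second Lax operator. The variables x', y', z' stay in the outermost
    factors and in the middle factor [sheared_mid3]. *)
Lemma shear_lax3 a1 a2 a3 b1 b2 b3 v :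
  map3 S (lax x y z a1 a2 a3 (lax x' y' z' b1 b2 b3 v)) =
  lax_left x' y' z' (lax x y z a1 a2 a3 (sheared_mid3 b1 b2 b3 (lax_right x' y' z' (map3 S v)))).
Proof. by rewrite /lax S_lax_left S_lax_mid S_lax_right S_lax_left' S_lax_mid' S_lax_right' lax_rightK. Qed.

(** For the exchange of the second parameters the shear mixes the variables
    x, y, z' of the first Lax operator with x', y', z of the second. [Amx],
    [Nmx], [Bmx], [Binv] are the parts of the unipotent factors that remain
    after splitting off those in x', y', z', and [sheared_mid2], [sheared_mid2'] are the
    sheared middle factors. *)
Definition Amx (v : vec) : vec := (v.1.1, - X x * v.1.1 + v.1.2, - X y * v.1.1 + v.2).
Definition Nmx (v : vec) : vec := (v.1.1, X x * v.1.1 + v.1.2, X y * v.1.1 + v.2).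
Definition Bmx (v : vec) : vec := (v.1.1, v.1.2, X z * v.1.2 + v.2).
Definition Binv (v : vec) : vec := (v.1.1, v.1.2, - X z * v.1.2 + v.2).
Definition sheared_mid2 (a1 a2 a3 : C) (v : vec) : vec :=
  (k a1 * v.1.1 + d x v.1.2 + d y v.2,
   k a2 * v.1.2 + (d z' v.2 - d z v.2 + X x * d y v.2), k a3 * v.2).
Definition sheared_mid2' (a1 a2 a3 : C) (v : vec) : vec :=
  (k a1 * v.1.1 + (d x' v.1.2 - d x v.1.2 - X z' * d y' v.1.2 - X z * d y' v.1.2 + X z * d y v.1.2)
     + (d y' v.2 - d y v.2),
   k a2 * v.1.2 + d z v.2, k a3 * v.2).
Definition sheared_lax2 a1 a2 a3 b1 b2 b3 v :=
  Amx (sheared_mid2 a1 a2 a3 (Nmx (Binv (sheared_mid2' b1 b2 b3 (Bmx v))))).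

Lemma S_lax_left2 v : map3 S (lax_left x y z' v) = lax_left x' y' z' (Amx (map3 S v)).
Proof. case: v => [[p q] r]; shears. Qed.
Lemma S_lax_mid2 a1 a2 a3 v : map3 S (lax_mid x y z' a1 a2 a3 v) = sheared_mid2 a1 a2 a3 (map3 S v).
Proof. case: v => [[p q] r]; shears. Qed.
Lemma S_lax_right2 v : map3 S (lax_right x y z' v) = Nmx (lax_right x' y' z' (map3 S v)).
Proof. case: v => [[p q] r]; shears. Qed.
Lemma S_lax_left2' v : map3 S (lax_left x' y' z v) = lax_left x' y' z' (Binv (map3 S v)).
Proof. case: v => [[p q] r]; shears. Qed.
Lemma S_lax_mid2' a1 a2 a3 v : map3 S (lax_mid x' y' z a1 a2 a3 v) = sheared_mid2' a1 a2 a3 (map3 S v).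
Proof. case: v => [[p q] r]; shears. Qed.
Lemma S_lax_right2' v : map3 S (lax_right x' y' z v) = Bmx (lax_right x' y' z' (map3 S v)).
Proof. case: v => [[p q] r]; shears. Qed.

(** The cancellation of [shear_lax3], with the roles of z and z' interchanged
    in the two Lax operators. *)
Lemma shear_lax2 a1 a2 a3 b1 b2 b3 v :
  map3 S (lax x y z' a1 a2 a3 (lax x' y' z b1 b2 b3 v)) =
  lax_left x' y' z' (sheared_lax2 a1 a2 a3 b1 b2 b3 (lax_right x' y' z' (map3 S v))).
Proof. by rewrite /lax S_lax_left2 S_lax_mid2 S_lax_right2 S_lax_left2' S_lax_mid2' S_lax_right2' lax_rightK. Qed.

(** After the shear, a second change of variables y -> y - x z, for which the
    derivatives become those of the coordinates x, y, z used by R_1. *)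
Section ShearXYZ.
Variable Y : A -> A.
Hypotheses (YD : forall p q, Y (p + q) = Y p + Y q) (YN : forall p, Y (- p) = - Y p)
  (Yk : forall a p, Y (k a * p) = k a * Y p)
  (Yx : forall p, Y (X x * p) = X x * Y p)
  (Yy : forall p, Y (X y * p) = (X y - X x * X z) * Y p)
  (Yz : forall p, Y (X z * p) = X z * Y p)
  (Yx' : forall p, Y (X x' * p) = X x' * Y p)
  (Yy' : forall p, Y (X y' * p) = X y' * Y p)
  (Yz' : forall p, Y (X z' * p) = X z' * Y p)
  (Ydx : forall p, Y (d x p) = d x (Y p) + X z * d y (Y p))
  (Ydy : forall p, Y (d y p) = d y (Y p))
  (Ydz : forall p, Y (d z p) = d z (Y p) + X x * d y (Y p))
  (Ydx' : forall p, Y (d x' p) = d x' (Y p))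
  (Ydy' : forall p, Y (d y' p) = d y' (Y p))
  (Ydz' : forall p, Y (d z' p) = d z' (Y p)).

(** The unipotent factors simplify in the new coordinates: the bottom left
    entry y + x z of [lax_right] becomes y. *)
Definition xyz_right (v : vec) : vec := (v.1.1, X x * v.1.1 + v.1.2, X y * v.1.1 + X z * v.1.2 + v.2).
Definition xyz_left (v : vec) : vec :=
  (v.1.1, - X x * v.1.1 + v.1.2, (X x * X z - X y) * v.1.1 - X z * v.1.2 + v.2).
Definition xyz_mid (a1 a2 a3 : C) (v : vec) : vec :=
  (k a1 * v.1.1 + d x v.1.2 + d y v.2, k a2 * v.1.2 + (d z v.2 + X x * d y v.2), k a3 * v.2).
Definition xyz_lax a1 a2 a3 v := xyz_left (xyz_mid a1 a2 a3 (xyz_right v)).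
Definition sheared_mid1 (a1 a2 a3 : C) (v : vec) : vec :=
  (k a1 * v.1.1 + (d x' v.1.2 - X z' * d y' v.1.2 - d x v.1.2 - X z * d y v.1.2)
     + (d y' v.2 - d y v.2),
   k a2 * v.1.2 + (d z' v.2 - d z v.2), k a3 * v.2).

Let T p := Y (S p).
Ltac shears1 := apply: vec_eq; rewrite /T /= ?mulrDl ?mulNr -?mulrA
  ?(SD, SN, Sk, Sx, Sy, Sz, Sx', Sy', Sz', Sdx, Sdy, Sdz, Sdx', Sdy', Sdz') ?mulrDl ?mulNr -?mulrA
  ?(YD, YN, Yk, Yx, Yy, Yz, Yx', Yy', Yz', Ydx, Ydy, Ydz, Ydx', Ydy', Ydz')
  ?(dD, dN, dM, dXX, ne, eqxx, natb01); ring.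

Lemma T_lax_left v : map3 T (lax_left x y z v) = lax_left x' y' z' (xyz_left (map3 T v)).
Proof. case: v => [[p q] r]; shears1. Qed.
Lemma T_lax_mid a1 a2 a3 v : map3 T (lax_mid x y z a1 a2 a3 v) = xyz_mid a1 a2 a3 (map3 T v).
Proof. case: v => [[p q] r]; shears1. Qed.
Lemma T_lax_right v : map3 T (lax_right x y z v) = xyz_right (lax_right x' y' z' (map3 T v)).
Proof. case: v => [[p q] r]; shears1. Qed.
Lemma T_lax_left' v : map3 T (lax_left x' y' z' v) = lax_left x' y' z' (map3 T v).
Proof. case: v => [[p q] r]; shears1. Qed.
Lemma T_lax_mid' a1 a2 a3 v : map3 T (lax_mid x' y' z' a1 a2 a3 v) = sheared_mid1 a1 a2 a3 (map3 T v).
Proof. case: v => [[p q] r]; shears1. Qed.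
Lemma T_lax_right' v : map3 T (lax_right x' y' z' v) = lax_right x' y' z' (map3 T v).
Proof. case: v => [[p q] r]; shears1. Qed.

(** The cancellation of [shear_lax3], with the two Lax operators multiplied in
    the opposite order. *)
Lemma shear_lax1 a1 a2 a3 b1 b2 b3 v :
  map3 T (lax x' y' z' a1 a2 a3 (lax x y z b1 b2 b3 v)) =
  lax_left x' y' z' (sheared_mid1 a1 a2 a3 (xyz_lax b1 b2 b3 (lax_right x' y' z' (map3 T v)))).
Proof. by rewrite /lax T_lax_left' T_lax_mid' T_lax_right' T_lax_left T_lax_mid T_lax_right lax_rightK. Qed.
End ShearXYZ.
End Shear.

(** Exchange of the third parameters: the entries between the outer factors of
    [shear_lax3], and their intertwining by any operator that intertwines the
    generators. *)
Section Core3.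
Variables (u1 u2 u3 v1 v2 v3 : C) (r : A -> A).
(* The entries [M33] are only known after multiplication by 2. *)
Hypothesis double_inj : forall p q : A, p + p = q + q -> p = q.
Local Notation Q := (aQ y z x 1).
Local Notation M := (aM y z x 1).
Local Notation F := (aF y z x 1 (u2 - u1 - 1)).
Local Notation Nyx := (aN y x).
Local Notation Nyz := (aN y z).

Definition L11 a1 p := Nyx p + k (a1 + 2%:R) * p.
Definition L22 a2 p := k (a2 + 1) * p + Nyz p - Nyx p.

Definition M23 g w := k (u2 - u1 + g) * d z w - X x * M g w + Nyz (d z w).
Definition L31 a3 p := k a3 * ((X y + X x * X z) * p) - X y * L11 u1 p
  - X z * (k (u2 + 1) * (X x * p) + (X y + X x * X z) * d z p).
Definition M33 a3 g w := k a3 * Nyz w - X y * M g w - X z * d z (Nyz w)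
  + k (u1 + 1 - g - u2) * (X z * d z w) - k (a3 * (u1 + 1 - g)) * w.

(** [M23] and [L31] are commutators of generators, so an operator intertwining
    the generators intertwines them. *)
Lemma comFM g w : M g (F w) - F (M g w) = M23 g w.
Proof. rewrite /M23 /aM /aF /aN; weyl. Qed.

Lemma comQF a3 w : Q (u2 - a3 + 1) (F w) - F (Q (u2 - a3 + 1) w) = L31 a3 w.
Proof. rewrite /L31 /L11 /aQ /aF /aN; weyl. Qed.

(** The Euler operators [Nyx] and [Nyz] commute with the intertwining operator, so
    it intertwines twice [M33] as soon as it does so for [Q] and [M23]: the
    scalars are symmetric in [a3] and [b3], the two parameters that are
    exchanged. *)
Lemma comQM a3 g w : let b3 := u1 + 1 - g in
  M33 a3 g w *+ 2 = Q (u2 - a3 + 1) (M23 g w) - M23 g (Q (u2 - a3 + 1) w)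
    + Nyz (Nyz w) - Nyz (Nyx w) *+ 2
    + k (a3 + b3 - u1 - u2 - 2%:R) * Nyx w + k (2%:R * u2 + 3%:R) * Nyz w
    - k (a3 * b3 + (u2 + 1) * (a3 + b3) - (u2 + 1) * (u2 + 1)) * w.
Proof. rewrite /= /M33 /M23 /aM /aQ /aN; weyl. Qed.

(** The sheared product multiplied out, in terms of the generators and their
    commutators. *)
Definition expanded3 a3 b1 b2 b3 (v : vec) : vec :=
  let: (p, q, w) := v in
  let e := del q - d x q + d y' w in let f := d z' w in
  let g := u1 - b3 + 1 in
  (k b1 * L11 u1 p + L11 u1 e + k b2 * d x q + d x f - M g w,
   k b1 * F p + F e + k b2 * L22 u2 q + L22 u2 f - M23 g w,
   k b1 * L31 a3 p + L31 a3 e - k b2 * Q (u2 - a3 + 1) q - Q (u2 - a3 + 1) f - M33 a3 g w).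

Lemma expanded3E a3 b1 b2 b3 v :
  lax x y z u1 u2 a3 (sheared_mid3 b1 b2 b3 v) = expanded3 a3 b1 b2 b3 v.
Proof.
case: v => [[p q] w].
rewrite /expanded3 /lax /sheared_mid3 /lax_left /lax_mid /lax_right /= /M33 /M23 /L31 /L11 /L22 /del /aN /aQ /aM /aF /=.
apply: vec_eq.
- weyl.
- weyl.
weyl.
Qed.

Hypotheses (rD : forall p q, r (p + q) = r p + r q) (rk : forall a p, r (k a * p) = k a * r p)
  (rQ : forall p, r (Q (u2 - u3 + 1) p) = Q (u2 - v3 + 1) (r p))
  (rM : forall p, r (M (u1 - v3 + 1) p) = M (u1 - u3 + 1) (r p))
  (rF : forall p, r (F p) = F (r p)) (rdx : forall p, r (d x p) = d x (r p))
  (rNyx : forall p, r (Nyx p) = Nyx (r p)) (rNyz : forall p, r (Nyz p) = Nyz (r p))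
  (rdx' : forall p, r (d x' p) = d x' (r p)) (rdy' : forall p, r (d y' p) = d y' (r p))
  (rdz' : forall p, r (d z' p) = d z' (r p)) (rz' : forall p, r (X z' * p) = X z' * r p).

Let rN p : r (- p) = - r p.
Proof. by rewrite -[- p]mulN1r -[RHS]mulN1r -(rmorph1 k) -rmorphN rk. Qed.

Let rL11 p : r (L11 u1 p) = L11 u1 (r p).
Proof. by rewrite /L11 rD rk rNyx. Qed.
Let rL22 p : r (L22 u2 p) = L22 u2 (r p).
Proof. by rewrite /L22 !(rNyx, rNyz, rk, rN, rD). Qed.
Let rdel p : r (del p) = del (r p).
Proof. by rewrite /del !(rdx', rz', rdy', rN, rD). Qed.
Let rM23 p : r (M23 (u1 - v3 + 1) p) = M23 (u1 - u3 + 1) (r p).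
Proof. by rewrite -!comFM !(rM, rF, rN, rD). Qed.
Let rL31 p : r (L31 u3 p) = L31 v3 (r p).
Proof. by rewrite -!comQF !(rQ, rF, rN, rD). Qed.
Let rM33 p : r (M33 u3 (u1 - v3 + 1) p) = M33 v3 (u1 - u3 + 1) (r p).
Proof.
have b a : u1 + 1 - (u1 - a + 1) = a by ring.
apply: double_inj; rewrite -rD -!mulr2n !comQM !b !mulr2n.
by rewrite !(rQ, rM23, rNyz, rNyx, rk, rN, rD); ring.
Qed.

Lemma intertwine_expanded3 v : map3 r (expanded3 u3 v1 v2 v3 v) = expanded3 v3 v1 v2 u3 (map3 r v).
Proof.
case: v => [[p q] w]; rewrite /expanded3 /map3 /=.
by apply: vec_eq;
  rewrite !(rL11, rL22, rL31, rM23, rM33, rdel, rQ, rM, rF, rdx, rdy', rdz', rk, rN, rD).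
Qed.
End Core3.

(** Exchange of the first parameters. Here the generators stand in the other
    Lax operator, whose last two rows are [row2_1] and [row3_1]. *)
Section Core1.
Variables (u1 v1 v2 v3 : C) (r : A -> A).
Hypothesis double_inj : forall p q : A, p + p = q + q -> p = q.
Local Notation Q := (aQ y x z (-1)).
Local Notation M := (aM y x z (-1)).
Local Notation F := (aF y x z (-1) (v3 - v2 - 1)).
Local Notation Nyx := (aN y x).
Local Notation Nyz := (aN y z).

Definition L22_1 p := k (v2 + 1) * p + Nyz p - Nyx p.
Definition L33_1 p := k v3 * p - Nyz p.
Definition L31_1 b1 p := X y * (k (v3 - b1 - 2%:R) * p - X z * d z p - Nyx p)
  + X x * (X z * (k (b1 - v2 + 1) * p + X x * d x p)).
Definition M12_1 a1 q := k (a1 - v2 + 1) * d x q + X z * M (a1 - v3 + 1) q + Nyx (d x q).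
Definition M11_1 a1 b1 p := X y * M (a1 - v3 + 1) p + X x * d x (Nyx p)
  + k (b1 + 3%:R) * (X y * d y p) + k (a1 + b1 - v2 + 3%:R) * (X x * d x p)
  + k (a1 * b1 + 2%:R * a1 + 2%:R * b1 - v2 - v3 + 3%:R) * p.

(** As for the third parameters, the entries [M12_1] and [L31_1] are
    commutators of generators. *)
Lemma comFM_1 a1 p : F (M (a1 - v3 + 1) p) - M (a1 - v3 + 1) (F p) = M12_1 a1 p.
Proof. rewrite /M12_1 /aM /aF /aN; weyl. Qed.

Lemma comQF_1 b1 p : F (Q (b1 - v2 + 1) p) - Q (b1 - v2 + 1) (F p) = L31_1 b1 p.
Proof. rewrite /L31_1 /aQ /aF /aN; weyl. Qed.

(** The scalars are symmetric in [a1] and [b1], the parameters that are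
    exchanged. *)
Lemma comQM_1 a1 b1 p :
  M11_1 a1 b1 p *+ 2 = M12_1 a1 (Q (b1 - v2 + 1) p) - Q (b1 - v2 + 1) (M12_1 a1 p)
    - Nyx (Nyx p) + Nyx (Nyz p) *+ 2
    + k (2%:R + a1 + b1 - v2 - v3) * Nyz p + k (3%:R + 2%:R * v2) * Nyx p
    + k (5%:R + 3%:R * a1 + 3%:R * b1 - 2%:R * v3 + a1 * b1 + a1 * v2 + b1 * v2 - v2 * v2) * p.
Proof. rewrite /M11_1 /M12_1 /aM /aQ /aN; weyl. Qed.

Definition row2_1 b1 p q w := L22_1 q + d z w - Q (b1 - v2 + 1) p.
Definition row3_1 b1 p q w := L31_1 b1 p + F q + L33_1 w.

Lemma Lmx1E b1 p q w : xyz_lax b1 v2 v3 (p, q, w) =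
  (k (b1 + 2%:R) * p + Nyx p + d x q + X z * d y q + d y w, row2_1 b1 p q w, row3_1 b1 p q w).
Proof.
rewrite /xyz_lax /xyz_left /xyz_mid /xyz_right /row2_1 /row3_1 /= /L31_1 /L22_1 /L33_1 /aN /aQ /aF.
apply: vec_eq; weyl.
Qed.

(** The first row of the product mixes derivatives of all three rows of the
    second factor; the terms not involving x', y', z' combine into generators
    and their commutators. *)
Lemma row1_1 a1 b1 p q w :
  k a1 * (k (b1 + 2%:R) * p + Nyx p + d x q + X z * d y q + d y w)
    - d x (row2_1 b1 p q w) - X z * d y (row2_1 b1 p q w) - d y (row3_1 b1 p q w) =
  M11_1 a1 b1 p + M12_1 a1 q + M (a1 - v3 + 1) w.
Proof.
rewrite /M11_1 /M12_1 /row2_1 /row3_1 /L31_1 /L22_1 /L33_1 /aN /aQ /aM /aF; weyl.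
Qed.

Definition expanded1 a1 a2 a3 b1 (v : vec) : vec :=
  let: (p, q, w) := v in
  let r2 := row2_1 b1 p q w in let r3 := row3_1 b1 p q w in
  (del r2 + d y' r3 + (M11_1 a1 b1 p + M12_1 a1 q + M (a1 - v3 + 1) w),
   k a2 * r2 + d z' r3 - d z r3, k a3 * r3).

Lemma expanded1E a1 a2 a3 b1 v :
  sheared_mid1 a1 a2 a3 (xyz_lax b1 v2 v3 v) = expanded1 a1 a2 a3 b1 v.
Proof.
case: v => [[p q] w]; rewrite Lmx1E /expanded1 -row1_1 /sheared_mid1 /del /=.
by move: (row2_1 _ _ _ _) (row3_1 _ _ _ _) => r2 r3; apply: vec_eq; ring.
Qed.

Hypotheses (rD : forall p q, r (p + q) = r p + r q) (rk : forall a p, r (k a * p) = k a * r p)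
  (rQ : forall p, r (Q (v1 - v2 + 1) p) = Q (u1 - v2 + 1) (r p))
  (rM : forall p, r (M (u1 - v3 + 1) p) = M (v1 - v3 + 1) (r p))
  (rF : forall p, r (F p) = F (r p)) (rdz : forall p, r (d z p) = d z (r p))
  (rNyx : forall p, r (Nyx p) = Nyx (r p)) (rNyz : forall p, r (Nyz p) = Nyz (r p))
  (rdx' : forall p, r (d x' p) = d x' (r p)) (rdy' : forall p, r (d y' p) = d y' (r p))
  (rdz' : forall p, r (d z' p) = d z' (r p)) (rz' : forall p, r (X z' * p) = X z' * r p).

Let rN p : r (- p) = - r p.
Proof. by rewrite -[- p]mulN1r -[RHS]mulN1r -(rmorph1 k) -rmorphN rk. Qed.
Let rL22 p : r (L22_1 p) = L22_1 (r p).
Proof. by rewrite /L22_1 !(rNyx, rNyz, rk, rN, rD). Qed.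
Let rL33 p : r (L33_1 p) = L33_1 (r p).
Proof. by rewrite /L33_1 !(rNyx, rNyz, rk, rN, rD). Qed.
Let rdel p : r (del p) = del (r p).
Proof. by rewrite /del !(rdx', rz', rdy', rN, rD). Qed.
Let rM12 p : r (M12_1 u1 p) = M12_1 v1 (r p).
Proof. by rewrite -!comFM_1 !(rM, rF, rN, rD). Qed.
Let rL31 p : r (L31_1 v1 p) = L31_1 u1 (r p).
Proof. by rewrite -!comQF_1 !(rQ, rF, rN, rD). Qed.
Let rM11 p : r (M11_1 u1 v1 p) = M11_1 v1 u1 (r p).
Proof.
apply: double_inj; rewrite -rD -!mulr2n !comQM_1 !mulr2n.
by rewrite !(rQ, rM12, rNyz, rNyx, rk, rN, rD); ring.
Qed.

Let rrow2 p q w : r (row2_1 v1 p q w) = row2_1 u1 (r p) (r q) (r w).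
Proof. by rewrite /row2_1 !(rL22, rQ, rdz, rN, rD). Qed.
Let rrow3 p q w : r (row3_1 v1 p q w) = row3_1 u1 (r p) (r q) (r w).
Proof. by rewrite /row3_1 !(rL31, rF, rL33, rN, rD). Qed.

Lemma intertwine_expanded1 a2 a3 v : map3 r (expanded1 u1 a2 a3 v1 v) = expanded1 v1 a2 a3 u1 (map3 r v).
Proof.
case: v => [[p q] w]; rewrite /expanded1 /map3 /=.
by apply: vec_eq;
  rewrite !(rrow2, rrow3, rM12, rM11, rdel, rM, rdz, rdy', rdz', rk, rN, rD).
Qed.
End Core1.

(** Exchange of the second parameters: the entries between the outer factors of
    [shear_lax2]. *)
Section Core2.
Variables (u1 u2 u3 v1 v2 v3 : C) (r : A -> A).
Hypothesis double_inj : forall p q : A, p + p = q + q -> p = q.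
Local Notation Q := (aQ y z x 1).
Local Notation G := (aG y z x 1).
Local Notation T := (aT y z x 1 (u1 + 1 - v3)).
Local Notation Nyx := (aN y x).
Local Notation Nyz := (aN y z).

Definition K11 p := k (u1 + 2%:R) * p + Nyx p.
Definition K31 p := X y * (k (u3 - u1 - 2%:R) * p - Nyx p).
Definition G12 b2 q := k (b2 - u1 - 1) * d x q + X z * d x (d z q) - Nyx (d x q)
  + X z * (k (v3 - b2 - 1) * d y q - X z * d y (d z q)).
Definition G23 a2 w := k (a2 - v3 + 1) * d z w + Nyz (d z w) - X x * d x (d z w)
  + X x * (k (u1 - a2 + 1) * d y w + X x * d x (d y w)).
Definition G22 a2 b2 q := X z * (X z * d z (d z q)) + k (a2 + b2 - v3 + 3%:R) * (X z * d z q)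
  + X x * (X x * d x (d x q)) + k (u1 - a2 - b2) * (X x * d x q)
  - X x * (X z * d x (d z q)) + X y * d x (d z q) + k ((a2 + 1) * (b2 + 1) - v3) * q.

(** The entries [G12] and [G23] are commutators of generators. *)
Lemma comQT b2 q : T (Q (b2 - v3 + 1) q) - Q (b2 - v3 + 1) (T q) = G12 b2 q.
Proof. rewrite /G12 /aT /aQ /aN; weyl. Qed.

Lemma comGT a2 q : G (u1 - a2 + 1) (T q) - T (G (u1 - a2 + 1) q) = G23 a2 q.
Proof. rewrite /G23 /aT /aG /aN; weyl. Qed.

(** The scalars are symmetric in [a2] and [b2], the parameters that are
    exchanged. *)
Lemma comQG a2 b2 q :
  G22 a2 b2 q *+ 2 = G23 a2 (Q (b2 - v3 + 1) q) - Q (b2 - v3 + 1) (G23 a2 q)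
   + Nyx (Nyx q) - Nyz (Nyz q) + k (u1 - 1 - a2 - b2 - v3) * Nyx q
   + k (1 + 2%:R * v3) * Nyz q
   + k (1 + a2 + b2 + a2 * b2 + a2 * v3 + b2 * v3 - v3 * v3) * q.
Proof. rewrite /G22 /G23 /aG /aQ /aN; weyl. Qed.

Definition expanded2 a2 b2 (v : vec) : vec :=
  let: (p, q, w) := v in
  let e := k v1 * p + del q + d y' w in
  (K11 e + G12 b2 q + T w,
   - G (u1 - a2 + 1) e + G22 a2 b2 q + G23 a2 w
     + d z' (X y * e - Q (b2 - v3 + 1) q + k v3 * w - Nyz w),
   K31 e - k u3 * Q (b2 - v3 + 1) q - X y * G12 b2 q - X y * T w
     - k u3 * Nyz w + k (u3 * v3) * w).

Lemma expanded2E a2 b2 v : sheared_lax2 u1 a2 u3 v1 b2 v3 v = expanded2 a2 b2 v.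
Proof.
case: v => [[p q] w].
rewrite /expanded2 /sheared_lax2 /Amx /sheared_mid2 /Nmx /Binv /sheared_mid2' /Bmx /= /G22 /G23 /G12 /K11 /K31 /del /aN /aQ /aG /aT /=.
apply: vec_eq.
- weyl.
- weyl.
weyl.
Qed.

Hypotheses (rD : forall p q, r (p + q) = r p + r q) (rk : forall a p, r (k a * p) = k a * r p)
  (rQ : forall p, r (Q (v2 - v3 + 1) p) = Q (u2 - v3 + 1) (r p))
  (rG : forall p, r (G (u1 - u2 + 1) p) = G (u1 - v2 + 1) (r p))
  (rT : forall p, r (T p) = T (r p)) (ry : forall p, r (X y * p) = X y * r p)
  (rNyx : forall p, r (Nyx p) = Nyx (r p)) (rNyz : forall p, r (Nyz p) = Nyz (r p))
  (rdx' : forall p, r (d x' p) = d x' (r p)) (rdy' : forall p, r (d y' p) = d y' (r p))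
  (rdz' : forall p, r (d z' p) = d z' (r p)) (rz' : forall p, r (X z' * p) = X z' * r p).

Let rN p : r (- p) = - r p.
Proof. by rewrite -[- p]mulN1r -[RHS]mulN1r -(rmorph1 k) -rmorphN rk. Qed.
Let rK11 p : r (K11 p) = K11 (r p).
Proof. by rewrite /K11 !(rNyx, rk, rD). Qed.
Let rK31 p : r (K31 p) = K31 (r p).
Proof. by rewrite /K31 !(ry, rNyx, rk, rN, rD). Qed.
Let rdel p : r (del p) = del (r p).
Proof. by rewrite /del !(rdx', rz', rdy', rN, rD). Qed.
Let rG12 p : r (G12 v2 p) = G12 u2 (r p).
Proof. by rewrite -!comQT !(rQ, rT, rN, rD). Qed.
Let rG23 p : r (G23 u2 p) = G23 v2 (r p).
Proof. by rewrite -!comGT !(rG, rT, rN, rD). Qed.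
Let rG22 p : r (G22 u2 v2 p) = G22 v2 u2 (r p).
Proof.
apply: double_inj; rewrite -rD -!mulr2n !comQG.
by rewrite !(rQ, rG23, rNyz, rNyx, rk, rN, rD); ring.
Qed.

Lemma intertwine_expanded2 v : map3 r (expanded2 u2 v2 v) = expanded2 v2 u2 (map3 r v).
Proof.
case: v => [[p q] w]; rewrite /expanded2 /map3 /=.
by apply: vec_eq;
  rewrite !(rK11, rK31, rG12, rG23, rG22, rdel, rQ, rG, rT, ry, rNyz, rdy', rdz', rk, rN, rD).
Qed.
End Core2.

(** If r intertwines the sheared matrices between outer factors h that commute
    with r, then its conjugate by the shear intertwines the original ones. *)
Section Similarity.
Variables (S Sinv r : A -> A) (M M' G G' h hinv : vec -> vec).
Hypotheses (SK : forall p, Sinv (S p) = p) (SinvK : forall p, S (Sinv p) = p)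
  (SM : forall v, map3 S (M v) = hinv (G (h (map3 S v))))
  (SM' : forall v, map3 S (M' v) = hinv (G' (h (map3 S v))))
  (rh : forall v, map3 r (h v) = h (map3 r v))
  (rhinv : forall v, map3 r (hinv v) = hinv (map3 r v))
  (rG : forall v, map3 r (G v) = G' (map3 r v)).

Lemma intertwine_similar v :
  map3 (fun p => Sinv (r (S p))) (M v) = M' (map3 (fun p => Sinv (r (S p))) v).
Proof.
have E u : map3 (fun p => Sinv (r (S p))) u = map3 Sinv (map3 r (map3 S u)) by [].
have K u : map3 Sinv (map3 S u) = u by case: u => [[p q] w]; rewrite /map3 /= !SK.
have K' u : map3 S (map3 Sinv u) = u by case: u => [[p q] w]; rewrite /map3 /= !SinvK.
by rewrite !E SM rhinv rG rh -{1}(K' (map3 r (map3 S v))) -SM' K.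
Qed.
End Similarity.

Section SpectatorFrame.
Variable r : A -> A.
Hypotheses (rD : forall p q, r (p + q) = r p + r q) (rN : forall p, r (- p) = - r p)
  (rx' : forall p, r (X x' * p) = X x' * r p) (ry' : forall p, r (X y' * p) = X y' * r p)
  (rz' : forall p, r (X z' * p) = X z' * r p).

Lemma map3_lax_right v : map3 r (lax_right x' y' z' v) = lax_right x' y' z' (map3 r v).
Proof.
case: v => [[p q] w]; apply: vec_eq => /=; rewrite ?mulrDl -?mulrA
  ?(rx', ry', rz', rD) //; congr (_ + _ + _); rewrite -mulrA ?(rx', ry', rz').
Qed.

Lemma map3_lax_left v : map3 r (lax_left x' y' z' v) = lax_left x' y' z' (map3 r v).
Proof.
by case: v => [[p q] w]; apply: vec_eq => /=; rewrite ?mulNr ?(rx', ry', rz', rN, rD).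
Qed.
End SpectatorFrame.
End Algebra.

From mathcomp Require Import freeg mpoly.

(** * Exponentials of locally nilpotent operators *)

(** A linear identity between three vectors follows from the identity between
    formal coordinates [C a b c], where it is checked coefficientwise. *)
Lemma coordinates_ind (K : comNzRingType) (V : lmodType K)
    (G : V -> V -> V -> Prop) (x y z : V) :
  (forall C : K -> K -> K -> V,
     (forall a b c a' b' c', C a b c + C a' b' c' = C (a + a') (b + b') (c + c')) ->
     (forall d a b c, d *: C a b c = C (d * a) (d * b) (d * c)) ->
     (forall a b c, - C a b c = C (- a) (- b) (- c)) -> 0 = C 0 0 0 ->
   G (C 1 0 0) (C 0 1 0) (C 0 0 1)) -> G x y z.
Proof.
move/(_ (fun a b c => a *: x + b *: y + c *: z)) => /=.
rewrite !scale1r !scale0r !addr0 !add0r; apply=> //.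
- by move=> *; rewrite !scalerDl [LHS]addrACA [X in X + _ = _]addrACA.
- by move=> *; rewrite !scalerDr !scalerA.
by move=> *; rewrite !scaleNr !opprD.
Qed.

Ltac lincomb x y z :=
  pattern x, y, z; apply: coordinates_ind;
  let C := fresh "C" in let CD := fresh in let CZ := fresh in
  let CN := fresh in let C0 := fresh in
  move=> C CD CZ CN C0; rewrite ?C0 ?(CZ, CN, CD) //; congr (C _ _ _); ring.

Section LinearMaps.
Variables (K : nzRingType) (U W : lmodType K).
Implicit Types (D : U -> W) (u v : U).

Lemma linB D u v : linear D -> D (u - v) = D u - D v.
Proof. by move=> Dl; rewrite addrC -scaleN1r Dl scaleN1r addrC. Qed.

Lemma lin0 D : linear D -> D 0 = 0.
Proof. by move=> Dl; have := linB 0 0 Dl; rewrite !subrr. Qed.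

Lemma linD D u v : linear D -> D (u + v) = D u + D v.
Proof. by move=> Dl; rewrite -{1}(scale1r u) Dl scale1r. Qed.

Lemma linZ D a u : linear D -> D (a *: u) = a *: D u.
Proof. by move=> Dl; rewrite -[a *: u]addr0 Dl (lin0 Dl) addr0. Qed.

Lemma lin_sum D I (r : seq I) (F : I -> U) : linear D ->
  D (\sum_(i <- r) F i) = \sum_(i <- r) D (F i).
Proof.
move=> Dl; elim: r => [|i r IH]; first by rewrite !big_nil lin0.
by rewrite !big_cons linD // IH.
Qed.

End LinearMaps.

Section Exponential.
Variables (K : numFieldType) (V : lmodType K).
Implicit Types (D X Y Z : V -> V) (u v : V).

Definition nilp_at D v := exists n, iter n D v = 0.

Lemma lin_iter D n : linear D -> linear (iter n D).
Proof. by move=> Dl a u v; elim: n => //= n ->; rewrite Dl. Qed.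

Lemma iter_nilp D n v k : linear D -> iter n D v = 0 -> (n <= k)%N -> iter k D v = 0.
Proof. by move=> Dl nv /subnK <-; rewrite iterD nv (lin0 (lin_iter _ Dl)). Qed.

Lemma opexpE D n v : linear D -> iter n D v = 0 ->
  opexp D v = \sum_(k < n) k`!%:R^-1 *: iter k D v.
Proof.
move=> Dl nv; rewrite /opexp.
rewrite (@fsbig_ord _ _ _ n (fun k => k`!%:R^-1 *: iter k D v)); apply/esym/fsbig_widen => // k /= [_ /negP].
by rewrite -leqNgt => nk; rewrite (iter_nilp Dl nv nk) scaler0.
Qed.

Lemma opexpD D u v : linear D -> nilp_at D u -> nilp_at D v ->
  opexp D (u + v) = opexp D u + opexp D v.
Proof.
move=> Dl [n nu] [m mv].
have nu' := iter_nilp Dl nu (leq_addr m n); have mv' := iter_nilp Dl mv (leq_addl n m).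
rewrite (opexpE Dl nu') (opexpE Dl mv') (@opexpE D (n + m)) //.
  by rewrite -big_split; apply: eq_bigr => k _; rewrite linD ?scalerDr //; apply: lin_iter.
by rewrite linD ?nu' ?mv' ?addr0 //; apply: lin_iter.
Qed.

Lemma opexpZ D a v : linear D -> nilp_at D v -> opexp D (a *: v) = a *: opexp D v.
Proof.
move=> Dl [n nv]; have il k := lin_iter k Dl.
rewrite (opexpE Dl nv) (@opexpE D n) ?linZ ?nv ?scaler0 //.
by rewrite scaler_sumr; apply: eq_bigr => k _; rewrite linZ // !scalerA mulrC.
Qed.

Lemma nilp_atD D u v : linear D -> nilp_at D u -> nilp_at D v -> nilp_at D (u + v).
Proof.
move=> Dl [n nu] [m mv]; exists (n + m)%N; rewrite linD; last exact: lin_iter.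
by rewrite (iter_nilp Dl nu (leq_addr m n)) (iter_nilp Dl mv (leq_addl n m)) addr0.
Qed.

Lemma nilp_atZ D a v : linear D -> nilp_at D v -> nilp_at D (a *: v).
Proof.
by move=> Dl [n nv]; exists n; rewrite linZ ?nv ?scaler0 //; apply: lin_iter.
Qed.

Lemma linear_scale D c : linear D -> linear (fun v => c *: D v).
Proof. by move=> Dl a u v; rewrite Dl scalerDr !scalerA mulrC. Qed.

Lemma nilp_at_scale D c v : linear D -> nilp_at D v -> nilp_at (fun u => c *: D u) v.
Proof.
move=> Dl [n nv]; exists n.
have -> : iter n (fun u => c *: D u) v = c ^+ n *: iter n D v.
  by elim: {nv} n => [|n IH] /=; rewrite ?scale1r // IH linZ // scalerA -exprS.
by rewrite nv scaler0.
Qed.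

(** Two commutators with D lead from X to an operator Z that commutes with D:
    the exponential series of ad D applied to X stops at the quadratic term. *)
Section Conjugation.
Variables D X Y Z : V -> V.
Hypotheses (Dl : linear D) (Xl : linear X) (Yl : linear Y) (Zl : linear Z).
Hypotheses (DX : forall v, D (X v) = X (D v) + Y v)
  (DY : forall v, D (Y v) = Y (D v) + 2%:R *: Z v)
  (DZ : forall v, D (Z v) = Z (D v)).

(** The Leibniz rule D^n X = X D^n + n Y D^(n-1) + n (n - 1) Z D^(n-2). For
    small n the predecessors are truncated, but the coefficients then vanish. *)
Lemma iter_conj n v : iter n D (X v) = X (iter n D v) +
  n%:R *: Y (iter n.-1 D v) + (n * n.-1)%:R *: Z (iter n.-2 D v).
Proof.
elim: n => [|n IH]; first by rewrite !scale0r !addr0.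
rewrite [LHS]iterS IH !(linD _ _ Dl) !(linZ _ _ Dl) DX DY DZ -!iterS.
case: n {IH} => [|[|n]] /=.
- by rewrite !(mul0n, mulr0n, scale0r, addr0, add0r, scale1r).
- rewrite muln0 muln1 scale0r addr0.
  move: (X _) (Y _) (Z _) => x y z; lincomb x y z.
rewrite !natrM -!natr1; move: (X _) (Y _) (Z _) => x y z; lincomb x y z.
Qed.

Lemma iter_conj0 n v : iter n D v = 0 -> iter n.+2 D (X v) = 0.
Proof.
move=> nv; rewrite iter_conj !(iter_nilp Dl nv) ?leqW //=.
by rewrite (lin0 Xl) (lin0 Yl) (lin0 Zl) !scaler0 !addr0.
Qed.

Lemma nilp_at_conj v : nilp_at D v -> nilp_at D (X v).
Proof.
by move=> [n nv]; exists n.+2; exact: iter_conj0.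
Qed.

(** Conjugation by e^D is e^(ad D), which sends X to X + Y + Z. *)
Lemma opexp_conj v : nilp_at D v ->
  opexp D (X v) = X (opexp D v) + Y (opexp D v) + Z (opexp D v).
Proof.
move=> [n nv].
rewrite (opexpE Dl (iter_conj0 nv)).
have n1 := iter_nilp Dl nv (leqnSn n); have n2 := iter_nilp Dl n1 (leqnSn _).
rewrite {1}(opexpE Dl n2) {1}(opexpE Dl n1) {1}(opexpE Dl nv).
rewrite (lin_sum _ _ Xl) (lin_sum _ _ Yl) (lin_sum _ _ Zl).
under eq_bigr => k _ do rewrite iter_conj !scalerDr.
rewrite !big_split /=; congr (_ + _ + _).
- by apply: eq_bigr => k _; rewrite (linZ _ _ Xl).
- rewrite big_ord_recl /= scale0r scaler0 add0r; apply: eq_bigr => k _.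
  rewrite (linZ _ _ Yl) scalerA; congr (_ *: _); rewrite /bump /= add1n factS natrM.
  by rewrite invfM mulrAC mulVf ?mul1r // pnatr_eq0.
rewrite !big_ord_recl /= !scale0r !scaler0 !add0r; apply: eq_bigr => k _.
rewrite (linZ _ _ Zl) scalerA; congr (_ *: _); rewrite /bump /= !add1n !factS !natrM.
by rewrite [X in X^-1]mulrA invfM mulrAC mulVf ?mul1r // mulf_neq0 ?pnatr_eq0.
Qed.
End Conjugation.

Lemma linear_add D D' : linear D -> linear D' -> linear (fun v => D v + D' v).
Proof. by move=> Dl Dl' a u v; rewrite Dl Dl' scalerDr addrACA. Qed.

Definition conj_by X Y Z (c : K) v := X v + c *: Y v + (c ^+ 2) *: Z v.

Lemma linear_conj_by X Y Z c :
  linear X -> linear Y -> linear Z -> linear (conj_by X Y Z c).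
Proof.
move=> Xl Yl Zl; apply: linear_add; last exact: linear_scale.
by apply: linear_add => //; exact: linear_scale.
Qed.

Section ScaledConjugation.
Variables (D X Y Z : V -> V) (c : K).
Hypotheses (Dl : linear D) (Xl : linear X) (Yl : linear Y) (Zl : linear Z).
Hypotheses (DX : forall v, D (X v) = X (D v) + Y v)
  (DY : forall v, D (Y v) = Y (D v) + 2%:R *: Z v)
  (DZ : forall v, D (Z v) = Z (D v)).

Lemma opexp_scale_conj v : nilp_at D v ->
  opexp (fun u => c *: D u) (X v) = conj_by X Y Z c (opexp (fun u => c *: D u) v).
Proof.
move=> nv; rewrite /conj_by (@opexp_conj _ X (fun u => c *: Y u) (fun u => c ^+ 2 *: Z u)) //.
- exact: linear_scale.
- exact: linear_scale.
- exact: linear_scale.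
- by move=> u; rewrite DX (linZ _ _ Xl) scalerDr.
- move=> u; rewrite (linZ _ _ Dl) DY (linZ _ _ Yl) !scalerDr !scalerA.
  by congr (_ + _ *: _); ring.
- by move=> u; rewrite (linZ _ _ Dl) DZ (linZ _ _ Zl) !scalerA mulrC.
exact: nilp_at_scale.
Qed.

End ScaledConjugation.

(** The inverse conjugation: it takes the operator that e^(c D) produces from X
    back to X. *)
Lemma opexp_scale_conjN D X Y Z c v : linear D -> linear X -> linear Y -> linear Z ->
  (forall v, D (X v) = X (D v) + Y v) ->
  (forall v, D (Y v) = Y (D v) + 2%:R *: Z v) ->
  (forall v, D (Z v) = Z (D v)) -> nilp_at D v ->
  opexp (fun u => - c *: D u) (conj_by X Y Z c v) = X (opexp (fun u => - c *: D u) v).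
Proof.
move=> Dl Xl Yl Zl DX DY DZ nv.
rewrite (@opexp_scale_conj D _ (fun u => Y u + (2%:R * c) *: Z u) Z) //.
- rewrite /conj_by; move: (opexp _ v) => w.
  by move: (X w) (Y w) (Z w) => x y z; lincomb x y z.
- exact: linear_conj_by.
- by apply: linear_add => //; exact: linear_scale.
- move=> u; rewrite /conj_by !(linD _ _ Dl) !(linZ _ _ Dl) DX DY DZ.
  move: (X _) (Y (D u)) (Y u) (Z u) (Z (D u)) => x y y' z z'.
  by rewrite scalerDr scalerA [c * _]mulrC [X in X + _ = _]addrACA [LHS]addrAC.
- move=> u; rewrite (linD _ _ Dl) (linZ _ _ Dl) DY DZ -!addrA; congr (_ + _).
  by rewrite addrC.
Qed.
End Exponential.

(** * Weighted shifts of Laurent monomials *)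

Section WeightedShifts.
Variable R : realType.
Local Notation C := R[i].
Local Notation P := {mpoly C[6]}.
Local Notation E := {ffun 'I_6 -> int}.
Local Notation Lau := {freeg E / C}.
Implicit Types (f g : Lau) (k m : E) (phi psi : E -> C).

(** Multiplication by the monomial of exponent k, after multiplication of each
    monomial by a function of its exponents. Multiplications by variables,
    derivatives and functions of Euler operators are all of this form, and so
    are their products. *)
Definition wop k phi : Lau -> Lau := fglift (fun m => << phi m *g m + k >>).

Lemma fglift_linear (I : choiceType) (V : lmodType C) (F : I -> V) :
  linear (fglift F : {freeg I / C} -> V).
Proof.
have fB x y : fglift F (x - y) = fglift F x - fglift F y by exact: lift_is_additive.
have f0 : fglift F 0 = 0 by rewrite -(subrr 0) fB subrr.
have fD x y : fglift F (x + y) = fglift F x + fglift F y.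
  by rewrite -{1}(opprK y) fB -(sub0r y) fB f0 sub0r opprK.
move=> a x y; rewrite fD; congr (_ + _).
rewrite -[x]freeg_sumE scaler_sumr !(big_morph _ fD f0) scaler_sumr.
apply: eq_bigr => i _.
have -> : a *: << coeff i x *g i >> = << a * coeff i x *g i >>.
  by apply/eqP/freeg_eqP => j; rewrite coeffZ !coeffU mulrA.
by rewrite !liftU scalerA.
Qed.

Lemma wop_linear k phi : linear (wop k phi).
Proof. exact: fglift_linear. Qed.

Lemma wopU k phi c m : wop k phi << c *g m >> = << c * phi m *g m + k >>.
Proof.
by rewrite /wop liftU; apply/eqP/freeg_eqP => n; rewrite coeffZ !coeffU mulrA.
Qed.

Lemma lau_ind (Q : Lau -> Prop) : Q 0 -> (forall f g, Q f -> Q g -> Q (f + g)) ->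
  (forall c m, Q << c *g m >>) -> forall f, Q f.
Proof.
move=> Q0 QD QU f; rewrite -[f]freeg_sumE.
by apply: big_ind => // m _; apply: QU.
Qed.

Lemma lau_ext (A B : Lau -> Lau) : linear A -> linear B ->
  (forall c m, A << c *g m >> = B << c *g m >>) -> forall f, A f = B f.
Proof.
move=> Al Bl AB; apply: lau_ind => [|f g Af Ag|//]; first by rewrite !lin0.
by rewrite (linD _ _ Al) (linD _ _ Bl) Af Ag.
Qed.

Lemma wop_comp k phi k' psi f :
  wop k phi (wop k' psi f) = wop (k' + k) (fun m => phi (m + k') * psi m) f.
Proof.
apply: (@lau_ext (fun f => wop k phi (wop k' psi f))) f => [a f g||c m] /=.
- by rewrite !wop_linear.
- exact: wop_linear.
by rewrite !wopU addrA -mulrA [psi m * _]mulrC.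
Qed.

Lemma wopDl k phi psi f : wop k phi f + wop k psi f = wop k (fun m => phi m + psi m) f.
Proof.
apply: (@lau_ext (fun f => wop k phi f + wop k psi f)) f => [||c m].
- by apply: linear_add; apply: wop_linear.
- exact: wop_linear.
by rewrite !wopU freegUD mulrDr.
Qed.

Lemma wopZl a k phi f : a *: wop k phi f = wop k (fun m => a * phi m) f.
Proof.
apply: (@lau_ext (fun f => a *: wop k phi f)) f => [||c m].
- by apply: linear_scale; apply: wop_linear.
- exact: wop_linear.
by rewrite !wopU; apply/eqP/freeg_eqP => n; rewrite coeffZ !coeffU; ring.
Qed.

Lemma eq_wop k k' phi psi f : k = k' -> phi =1 psi -> wop k phi f = wop k' psi f.
Proof.
move=> <- e; apply: lau_ext f => [||c m]; try exact: wop_linear.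
by rewrite !wopU e.
Qed.

Lemma wop1 f : wop 0 (fun=> 1) f = f.
Proof.
by apply: (@lau_ext _ id) f => [||c m] //; [exact: wop_linear|rewrite wopU addr0 mulr1].
Qed.

Lemma wop0 k phi f : (forall m, phi m = 0) -> wop k phi f = 0.
Proof.
move=> p0; apply: (@lau_ext _ (fun=> 0)) f => [|a f g|c m]; first exact: wop_linear.
  by rewrite scaler0 addr0.
by rewrite wopU p0 mulr0 freegU0.
Qed.

Lemma euler_funE i (phi : int -> C) f : euler_fun i phi f = wop 0 (fun m => phi (m i)) f.
Proof.
apply: lau_ext f => [||c m]; try exact: fglift_linear.
by rewrite wopU /euler_fun liftU addr0; apply/eqP/freeg_eqP => n; rewrite coeffZ !coeffU mulrA.
Qed.

Lemma supported_wop (S S' : pred E) k phi f : (forall m, S m -> phi m != 0 -> S' (m + k)) ->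
  supported S f -> supported S' (wop k phi f).
Proof.
move=> SS Sf; apply: supported_lift => m /(supported_dom Sf) Sm.
by apply: supportedU => /SS; apply.
Qed.

(** Identities between operators on polynomials are checked by letting both
    sides move past a multiplication by a variable. *)
Lemma mpoly_mulX_ind (Q : P -> Prop) : Q 1 -> (forall p q, Q p -> Q q -> Q (p + q)) ->
  (forall c p, Q p -> Q (c *: p)) -> (forall i p, Q p -> Q ('X_i * p)) -> forall p, Q p.
Proof.
move=> Q1 QD QZ QX; apply: mpolyind => [|c m p _ _ Qp].
  by rewrite -(scale0r 1); apply: QZ.
apply: QD => //; apply: QZ; rewrite mpolyXE_id.
apply: big_rec => // i x _ Qx; elim: (m i) => [|k IH]; first by rewrite expr0 mul1r.
by rewrite exprS -mulrA; apply: QX.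
Qed.

Lemma poly_ext (A B : P -> Lau) :
  (forall c p q, A (c *: p + q) = c *: A p + A q) ->
  (forall c p q, B (c *: p + q) = c *: B p + B q) ->
  (forall m : 'X_{1..6}, A 'X_[m] = B 'X_[m]) -> forall p, A p = B p.
Proof.
move=> Al Bl AB; apply: mpolyind => [|c m p _ _ Ap]; last by rewrite Al Bl AB Ap.
have A0 : A 0 = 0 by have := Al (-1) 0 0; rewrite !scaleN1r oppr0 add0r addNr.
have B0 : B 0 = 0 by have := Bl (-1) 0 0; rewrite !scaleN1r oppr0 add0r addNr.
by rewrite A0 B0.
Qed.

Lemma to_laurent_linear (c : C) (p q : P) :
  to_laurent (c *: p + q) = c *: to_laurent p + to_laurent q.
Proof.
by rewrite /to_laurent -fglift_linear.
Qed.

Lemma to_laurent0 : to_laurent 0 = 0 :> Lau.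
Proof. by have := to_laurent_linear (-1) 0 0; rewrite !scaleN1r oppr0 add0r addNr. Qed.

Lemma to_laurentZ (c : C) (p : P) : to_laurent (c *: p) = c *: to_laurent p.
Proof. by rewrite -[c *: p]addr0 to_laurent_linear to_laurent0 addr0. Qed.

Lemma to_laurentX (m : 'X_{1..6}) : to_laurent 'X_[m] = << [ffun i => (m i)%:Z] >> :> Lau.
Proof.
have -> : 'X_[m] = [mpoly << m >>] :> P.
  by apply/mpolyP => n; rewrite mcoeffX mcoeff_MPoly coeffU mul1r.
by rewrite /to_laurent liftU scale1r.
Qed.

Lemma to_laurentM i (p : P) :
  to_laurent ('X_i * p) = wop (unit_exp i) (fun=> 1) (to_laurent p).
Proof.
apply: (@poly_ext (fun p => to_laurent ('X_i * p))
  (fun p => wop (unit_exp i) (fun=> 1) (to_laurent p))) p => [c p q|c p q|m].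
- by rewrite mulrDr -scalerAr to_laurent_linear.
- by rewrite to_laurent_linear wop_linear.
rewrite -mpolyXD !to_laurentX wopU mulr1; congr << _ *g _ >>.
by apply/ffunP => j; rewrite !ffunE mnmDE mnm1E PoszD addrC.
Qed.

Lemma to_laurent_deriv i (p : P) :
  to_laurent p^`M(i) = wop (- unit_exp i) (fun m => (m i)%:~R) (to_laurent p).
Proof.
apply: (@poly_ext (fun p => to_laurent p^`M(i))
  (fun p => wop (- unit_exp i) (fun m => (m i)%:~R) (to_laurent p))) p => [c p q|c p q|m].
- by rewrite mderivD mderivZ to_laurent_linear.
- by rewrite to_laurent_linear wop_linear.
rewrite mderivX to_laurentX wopU mul1r to_laurentZ to_laurentX.
rewrite ffunE; have [->|mi] := posnP (m i); first by rewrite scale0r freegU0.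
apply/eqP/freeg_eqP => n; rewrite coeffZ !coeffU mul1r.
congr (_ * (_ == n)%:R); apply/ffunP => j; rewrite !ffunE mnmBE mnm1E.
by have [<-|_] := eqVneq i j; rewrite ?subn0 ?subr0 // subzn.
Qed.

Lemma of_laurent_linear (c : C) f g :
  of_laurent (c *: f + g) = c *: of_laurent f + of_laurent g.
Proof. exact: fglift_linear. Qed.

Lemma to_laurentK : cancel (@to_laurent R) (@of_laurent R).
Proof.
apply: mpolyind => [|c m p _ _ IH].
  by rewrite to_laurent0; apply: lin0; exact: fglift_linear.
rewrite to_laurent_linear of_laurent_linear IH; congr (_ *: _ + _).
rewrite to_laurentX /of_laurent liftU scale1r ifT.
  by congr 'X_[_]; apply/mnmP => j; rewrite mnmE ffunE.
by apply/forallP => j; rewrite ffunE.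
Qed.

Lemma lflowE c s t w f : lflow c s t w f =
  opexp (fun g => c *: wop (unit_exp s - unit_exp t - unit_exp w) (fun m => (m w)%:~R) g) f.
Proof.
rewrite /lflow; congr opexp; apply/funext => g.
set D := wop _ _.
apply: (@lau_ext _ (fun g => c *: D g)) g => [||a m].
- exact: fglift_linear.
- by apply: linear_scale; apply: wop_linear.
rewrite liftU /D wopU; apply/eqP/freeg_eqP => n.
by rewrite !coeffZ !coeffU !addrA; ring.
Qed.
End WeightedShifts.

(** * The core of the operators *)

Section Core.
Variable R : realType.
Local Notation C := R[i].
Local Notation P := {mpoly C[6]}.
Local Notation E := {ffun 'I_6 -> int}.
Local Notation Lau := {freeg E / C}.
Variables (s t w j : 'I_6).
Hypotheses (st : s != t) (sw : s != w) (tw : t != w).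
Variable (c : C).
Implicit Types (f g : Lau) (k m : E) (phi psi : E -> C).

(** The exponent of s^a t^b w^d. All shifts of the generators are of this form. *)
Definition sh (a b d : int) : E :=
  [ffun i => a * (s == i)%:Z + b * (t == i)%:Z + d * (w == i)%:Z].

Lemma shD a b d a' b' d' : sh a b d + sh a' b' d' = sh (a + a') (b + b') (d + d').
Proof. by apply/ffunP => i; rewrite !ffunE; ring. Qed.

Lemma shs m a b d : (m + sh a b d) s = m s + a.
Proof.
by rewrite !ffunE eqxx ![_ == s]eq_sym (negPf st) (negPf sw) mulr1 !mulr0 !addr0.
Qed.

Lemma sht m a b d : (m + sh a b d) t = m t + b.
Proof.
by rewrite !ffunE eqxx [w == t]eq_sym (negPf st) (negPf tw) mulr1 !mulr0 addr0 add0r.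
Qed.

Lemma shw m a b d : (m + sh a b d) w = m w + d.
Proof.
by rewrite !ffunE eqxx (negPf sw) (negPf tw) mulr1 !mulr0 !add0r.
Qed.

Lemma unit_s : unit_exp s = sh 1 0 0.
Proof. by apply/ffunP => i; rewrite !ffunE; ring. Qed.
Lemma unit_t : unit_exp t = sh 0 1 0.
Proof. by apply/ffunP => i; rewrite !ffunE; ring. Qed.
Lemma unit_w : unit_exp w = sh 0 0 1.
Proof. by apply/ffunP => i; rewrite !ffunE; ring. Qed.
Lemma shN a b d : - sh a b d = sh (- a) (- b) (- d).
Proof. by apply/ffunP => i; rewrite !ffunE; ring. Qed.
Lemma sh0 : sh 0 0 0 = 0.
Proof. by apply/ffunP => i; rewrite !ffunE; ring. Qed.

Definition ns m : C := (m s)%:~R.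
Definition nt m : C := (m t)%:~R.
Definition nw m : C := (m w)%:~R.

Lemma nsD m a b d : ns (m + sh a b d) = ns m + a%:~R. Proof. by rewrite /ns shs intrD. Qed.
Lemma ntD m a b d : nt (m + sh a b d) = nt m + b%:~R. Proof. by rewrite /nt sht intrD. Qed.
Lemma nwD m a b d : nw (m + sh a b d) = nw m + d%:~R. Proof. by rewrite /nw shw intrD. Qed.

Local Notation d := (sh 1 (-1) (-1)).
Definition ratio_deriv : Lau -> Lau := wop d nw.
Local Notation D := ratio_deriv.

Lemma lflow_ratio e f : lflow e s t w f = opexp (fun g => e *: D g) f.
Proof. by rewrite lflowE unit_s unit_t unit_w !shN !shD. Qed.

Lemma nilp_ratioU (n : nat) (a : C) m : m w = n -> iter n.+1 D << a *g m >> = 0.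
Proof.
elim: n a m => [|n IH] a m mw; rewrite iterSr /D wopU /nw mw.
  by rewrite mulr0 freegU0.
by apply: IH; rewrite shw mw -addn1 PoszD addrK.
Qed.

(** Each application of (s/t) d_w lowers the exponent of w, which is
    nonnegative at the start, by one, and multiplies by that exponent. *)
Lemma nilp_ratio f : supported (nonneg_off t) f -> nilp_at D f.
Proof.
have Dl : linear D by apply: wop_linear.
move=> Sf; rewrite -[f]freeg_sumE big_seq; apply: big_ind => [||m].
- by exists 0%N.
- by move=> u v; apply: nilp_atD.
move=> /(supported_dom Sf)/forallP/(_ w); rewrite eq_sym tw /=.
case E : (m w) => [n|//] _.
by exists n.+1; apply: nilp_ratioU.
Qed.

Lemma wop_comm_rel k phi psi f :
  (forall m, nw (m + k) * phi m = phi (m + d) * nw m + psi m) ->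
  D (wop k phi f) = wop k phi (D f) + wop (k + d) psi f.
Proof.
move=> H; rewrite /D !wop_comp [d + k]addrC wopDl.
by apply: eq_wop.
Qed.

(** An operator X with terms of shift k and k + d, where d is the shift of
    D = (s/t) d_w. The equations say that [D, X] = Y, [D, Y] = 2 Z and
    [D, Z] = 0. Then e^(c D) X e^(-c D) = A again has only the shifts k and
    k + d, because the terms of shift k + 2 d in c Y and c^2 Z cancel. *)
Section Conj.
Variables (k : E) (phi1 phi2 psi zeta : E -> C).
Hypotheses
  (H1 : forall m, nw (m + k) * phi1 m = phi1 (m + d) * nw m + psi m)
  (H2 : forall m, nw (m + k + d) * phi2 m = phi2 (m + d) * nw m - c * zeta m)
  (H3 : forall m, nw (m + k + d) * psi m = psi (m + d) * nw m + 2%:R * zeta m)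
  (H4 : forall m, nw (m + k + d + d) * zeta m = zeta (m + d) * nw m).

Let X f := wop k phi1 f + wop (k + d) phi2 f.
Let Y f := wop (k + d) psi f + wop (k + d + d) (fun m => - c * zeta m) f.
Let Z f := wop (k + d + d) zeta f.

Let A f := wop k phi1 f + wop (k + d) (fun m => phi2 m + c * psi m) f.

Let AE f : A f = conj_by X Y Z c f.
Proof.
rewrite /A /conj_by /X /Y /Z -wopDl -wopZl scalerDr -addrA -addrA -addrA.
congr (_ + (_ + _)); rewrite -[LHS]addr0 -addrA; congr (_ + _).
by rewrite !wopZl wopDl wop0 // => m; ring.
Qed.

Let XL : linear X. Proof. by apply: linear_add; apply: wop_linear. Qed.
Let YL : linear Y. Proof. by apply: linear_add; apply: wop_linear. Qed.
Let ZL : linear Z. Proof. exact: wop_linear. Qed.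
Let DL : linear D. Proof. exact: wop_linear. Qed.

Let DX v : D (X v) = X (D v) + Y v.
Proof.
rewrite /X (linD _ _ DL) (wop_comm_rel _ H1) (@wop_comm_rel (k + d) phi2 (fun m => - c * zeta m)).
  by rewrite addrACA.
by move=> m; rewrite addrA H2 mulNr.
Qed.

Let DZ v : D (Z v) = Z (D v).
Proof.
rewrite /Z (@wop_comm_rel _ _ (fun=> 0)) ?(@wop0 _ _ (fun=> 0)) ?addr0 // => m.
by rewrite addr0 !addrA H4.
Qed.

Let DY v : D (Y v) = Y (D v) + 2%:R *: Z v.
Proof.
rewrite /Y (linD _ _ DL) (@wop_comm_rel _ _ (fun m => 2%:R * zeta m)); last first.
  by move=> m; rewrite addrA H3.
rewrite -wopZl -!wopZl (linZ _ _ DL) -/(Z _) DZ -/(Z _).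
by rewrite addrAC.
Qed.

Lemma lflow_conj f : nilp_at D f -> lflow c s t w (X f) = A (lflow c s t w f).
Proof. by move=> nf; rewrite AE !lflow_ratio (opexp_scale_conj c DL XL YL ZL DX DY DZ nf). Qed.

Lemma lflow_conjN f : nilp_at D f -> lflow (- c) s t w (A f) = X (lflow (- c) s t w f).
Proof. by move=> nf; rewrite AE !lflow_ratio (opexp_scale_conjN c DL XL YL ZL DX DY DZ nf). Qed.

End Conj.

Section Tail.
Variables Phi1 Phi2 Phi3 : int -> C.
Hypothesis Phi1_neg : forall n : int, n < 0 -> Phi1 n = 0.

Definition tail f :=
  euler_fun t Phi1 (lflow c s t w (euler_fun j Phi2 (lflow (- c) s t w f))).
Definition core_laurent f := tail (euler_fun t Phi3 f).
(** R_3, R_2 and R_1 are conjugates of cores by changes of variables. The factors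
    after [Phi3] form [tail], because the errors of [Phi3] are only seen to
    vanish after all of them have been applied. *)
Definition core (p : P) : P := of_laurent (core_laurent (to_laurent p)).

Definition nonneg : pred E := fun m => [forall i, 0 <= m i].
(** The errors made by moving operators past [Phi3]: a negative exponent of t,
    and all other exponents nonnegative so that the exponentials still are
    finite on them. *)
Definition negative : pred E := fun m => (m t < 0) && nonneg_off t m.

Lemma supported_flow e f : supported (nonneg_off t) f -> supported (nonneg_off t) (lflow e s t w f).
Proof. by apply: supported_lflow; rewrite eq_sym. Qed.

Lemma supported_poly (p : P) : supported nonneg (to_laurent p).
Proof.
apply: supported_lift => m _; apply: supportedU => _.
by apply/forallP => i; rewrite ffunE.
Qed.

Lemma supported_sub (S S' : pred E) f : {subset S <= S'} -> supported S f -> supported S' f.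
Proof. by move=> SS Sf m Sm; apply: Sf; apply: contra Sm => /SS. Qed.

Lemma linear_tail_at f g : supported (nonneg_off t) f -> supported (nonneg_off t) g ->
  tail (f + g) = tail f + tail g.
Proof.
move=> Sf Sg; have el i (phi : int -> C) := @wop_linear R 0 (fun m => phi (m i)).
have DL (e : C) : linear (fun g => e *: D g) by apply: linear_scale; apply: wop_linear.
have add (e : C) (u v : Lau) : supported (nonneg_off t) u -> supported (nonneg_off t) v ->
    lflow e s t w (u + v) = lflow e s t w u + lflow e s t w v.
  move=> Su Sv; rewrite !lflow_ratio (opexpD (DL e)) //; apply: nilp_at_scale;
  by [apply: wop_linear|apply: nilp_ratio].
have addE (i : 'I_6) (phi : int -> C) (u v : Lau) :
    euler_fun i phi (u + v) = euler_fun i phi u + euler_fun i phi v.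
  by rewrite !euler_funE; apply: linD; apply: el.
have S1 u : supported (nonneg_off t) u ->
    supported (nonneg_off t) (euler_fun j Phi2 (lflow (- c) s t w u)).
  by move=> Su; apply: supported_euler_fun; apply: supported_flow.
rewrite /tail (add _ _ _ Sf Sg) addE (add _ _ _ (S1 _ Sf) (S1 _ Sg)).
exact: addE.
Qed.

(** Multiplication by s/t keeps a negative exponent of t negative, and d_w
    annihilates what has exponent 0 in w. *)
Lemma supported_negative_flow e f : supported negative f -> supported negative (lflow e s t w f).
Proof.
move=> Sf; have SD : forall g, supported negative g -> supported negative (D g).
  move=> g; apply: supported_wop => m /andP[mt /forallP mo] mw0.
  rewrite /negative sht; apply/andP; split.
    by rewrite (lt_trans _ mt) // gtrDl.
  apply/forallP => i; apply/implyP => it; have := mo i; rewrite it /= => mi.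
  have [iw|iw] := eqVneq i w.
    rewrite iw shw -ltzD1 subrK lt_def -iw mi andbT.
    by apply: contra mw0 => /eqP m0; rewrite /nw -iw m0.
  rewrite !ffunE ![_ == i]eq_sym (negPf it) (negPf iw) !mulr0 !addr0 mul1r.
  by rewrite addr_ge0.
rewrite lflow_ratio; apply: supported_sum => n _; apply: supportedZ.
elim: n => [//|n IH]; rewrite iterS; apply: supportedZ; exact: SD.
Qed.

(** The exponent of t is still negative when [Phi1] is reached. *)
Lemma tail_negative f : supported negative f -> tail f = 0.
Proof.
move=> Sf; rewrite /tail.
have S1 : supported negative (euler_fun j Phi2 (lflow (- c) s t w f)).
  by apply: supported_euler_fun; apply: supported_negative_flow.
have := supported_negative_flow c S1.
move: (lflow c _ _ _ _) => g Sg; apply/eqP/freeg_eqP => m.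
rewrite coeff0 euler_funE; have [/andP[mt _]|nm] := boolP (negative m).
  have S0 : supported (fun m : E => 0 <= m t) (wop 0 (fun m => Phi1 (m t)) g).
    apply: (@supported_wop _ (fun=> true)) => // m' _; rewrite addr0.
    by apply: contraNT; rewrite -ltNge => /Phi1_neg ->.
  by rewrite S0 -?ltNge.
have S0 : supported negative (wop 0 (fun m => Phi1 (m t)) g).
  by apply: supported_wop Sg => m' Sm _; rewrite addr0.
exact: S0 nm.
Qed.

Lemma to_laurent_core p : to_laurent (core p) = core_laurent (to_laurent p).
Proof.
apply: of_laurentK; rewrite /core_laurent /tail.
have S1 : supported (nonneg_off t) (euler_fun j Phi2 (lflow (- c) s t w
    (euler_fun t Phi3 (to_laurent p)))).
  by apply/supported_euler_fun/supported_flow/supported_euler_fun/supported_to_laurent.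
have := supported_flow c S1.
move: (lflow c _ _ _ _) => g Sg; rewrite euler_funE.
apply: supported_wop Sg => m /forallP Sm Pm; rewrite addr0; apply/forallP => i.
have [->|it] := eqVneq i t; last by have := Sm i; rewrite it.
by rewrite leNgt; apply: contra Pm => /Phi1_neg ->.
Qed.

(** Moves an operator with coefficients [a1], [a2] at the shifts k and k + d
    through the five factors of the core. The first two conditions are for
    [Phi3], up to monomials that the tail annihilates; [phi1], [phi2], [psi],
    [zeta] satisfy the equations for e^(-c (s/t) d_w), the next two conditions
    are for [Phi2], the primed functions satisfy the equations for
    e^(c (s/t) d_w), and the last two conditions are for [Phi1], which leaves
    the coefficients [b1], [b2]. For a given operator, [psi] and [zeta] are
    determined by [phi1], and [phi2] by the difference of [a2] and [c * psi]. *)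
(* The coefficient functions in the applications below are listed in the order
   a1, a2, b1, b2, then phi1, phi2, psi, zeta and their primed versions. *)
Lemma core_intertwine (p q r : P) (k : E) (a1 a2 b1 b2 phi1 phi2 psi zeta phi1' phi2' psi' zeta' : E -> C) :
  (forall m, nonneg m -> Phi3 ((m + k) t) * a1 m - phi1 m * Phi3 (m t) != 0 -> negative (m + k)) ->
  (forall m, nonneg m -> Phi3 ((m + k + d) t) * a2 m - (phi2 m + c * psi m) * Phi3 (m t) != 0 ->
     negative (m + k + d)) ->
  (forall m, nw (m + k) * phi1 m = phi1 (m + d) * nw m + psi m) ->
  (forall m, nw (m + k + d) * phi2 m = phi2 (m + d) * nw m - c * zeta m) ->
  (forall m, nw (m + k + d) * psi m = psi (m + d) * nw m + 2%:R * zeta m) ->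
  (forall m, nw (m + k + d + d) * zeta m = zeta (m + d) * nw m) ->
  (forall m, Phi2 ((m + k) j) * phi1 m = phi1' m * Phi2 (m j)) ->
  (forall m, Phi2 ((m + k + d) j) * phi2 m = phi2' m * Phi2 (m j)) ->
  (forall m, nw (m + k) * phi1' m = phi1' (m + d) * nw m + psi' m) ->
  (forall m, nw (m + k + d) * phi2' m = phi2' (m + d) * nw m - c * zeta' m) ->
  (forall m, nw (m + k + d) * psi' m = psi' (m + d) * nw m + 2%:R * zeta' m) ->
  (forall m, nw (m + k + d + d) * zeta' m = zeta' (m + d) * nw m) ->
  (forall m, Phi1 ((m + k) t) * phi1' m = b1 m * Phi1 (m t)) ->
  (forall m, Phi1 ((m + k + d) t) * (phi2' m + c * psi' m) = b2 m * Phi1 (m t)) ->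
  to_laurent q = wop k a1 (to_laurent p) + wop (k + d) a2 (to_laurent p) ->
  to_laurent r = wop k b1 (to_laurent (core p)) + wop (k + d) b2 (to_laurent (core p)) ->
  core q = r.
Proof.
move=> F1 F2 H1 H2 H3 H4 M1 M2 H1' H2' H3' H4' L1 L2 qE rE.
move: (to_laurent_core q) (to_laurent_core p) rE.
move: (core q) (core p) => cq cp Eq Ep rE.
apply: (can_inj (@to_laurentK R)); rewrite {}Eq {}rE {}Ep /core_laurent qE.
set f := to_laurent p; set g := euler_fun t Phi3 f.
have el i (phi : int -> C) := @wop_linear R 0 (fun m => phi (m i)).
have Sg : supported (nonneg_off t) g.
  exact/supported_euler_fun/supported_to_laurent.
(* what is left over after moving the operator past [Phi3] *)
set e := wop k (fun m => Phi3 ((m + k) t) * a1 m - phi1 m * Phi3 (m t)) f +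
  wop (k + d) (fun m => Phi3 ((m + k + d) t) * a2 m - (phi2 m + c * psi m) * Phi3 (m t)) f.
have Se : supported negative e.
  apply: supportedD; first exact: supported_wop F1 (supported_poly p).
  by apply: supported_wop (supported_poly p) => m; rewrite addrA; apply: F2.
have gE : euler_fun t Phi3 (wop k a1 f + wop (k + d) a2 f) =
    (wop k phi1 g + wop (k + d) (fun m => phi2 m + c * psi m) g) + e.
  rewrite /g /e euler_funE (linD _ _ (el _ _)) !euler_funE !wop_comp !addr0 !add0r addrACA !wopDl.
  by congr (_ + _); apply: eq_wop => // m; rewrite addr0 ?(addrA m) [RHS]addrC subrK.
rewrite gE linear_tail_at; last first.
- by apply: supported_sub Se => m /andP[].
- rewrite -[X in supported _ X](addrK e) -gE -scaleN1r.
  apply: supportedD; last by apply/supportedZ/(supported_sub _ Se) => m /andP[].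
  by rewrite -qE; apply/supported_euler_fun/supported_to_laurent.
rewrite (tail_negative Se) addr0 /tail.
rewrite (lflow_conjN H1 H2 H3 H4 (nilp_ratio Sg)).
set g1 := lflow (- c) s t w g.
have -> : euler_fun j Phi2 (wop k phi1 g1 + wop (k + d) phi2 g1) =
   wop k phi1' (euler_fun j Phi2 g1) + wop (k + d) phi2' (euler_fun j Phi2 g1).
  rewrite euler_funE (linD _ _ (el _ _)) !euler_funE !wop_comp !addr0 !add0r.
  by congr (_ + _); apply: eq_wop => // m; rewrite addr0 ?addrA ?M1 ?M2.
rewrite (lflow_conj H1' H2' H3' H4'); last first.
  by apply: nilp_ratio; apply: supported_euler_fun; apply: supported_flow.
rewrite euler_funE (linD _ _ (el _ _)) !euler_funE !wop_comp !addr0 !add0r.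
by congr (_ + _); apply: eq_wop => // m; rewrite addr0 ?addrA ?L1 ?L2.
Qed.
End Tail.
End Core.

(** * Operators intertwined by the core *)

Section Relations.
Variable R : realType.
Local Notation C := R[i].
Local Notation P := {mpoly C[6]}.
Local Notation E := {ffun 'I_6 -> int}.
Local Notation Lau := {freeg E / C}.
Variables (s t w : 'I_6).
Hypotheses (st : s != t) (sw : s != w) (tw : t != w).
Variables (c al be ga de : C).
Variables Phi1 Phi2 Phi3 : int -> C.
Hypothesis Phi1_neg : forall n : int, n < 0 -> Phi1 n = 0.
Hypothesis Phi1_rec : forall n : int, (n%:~R + 1) * Phi1 (n + 1) = (n%:~R + al) * Phi1 n.
Hypothesis Phi2_rec : forall n : int, (n%:~R + de) * Phi2 (n + 1) = (n%:~R + ga) * Phi2 n.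
Hypothesis Phi3_rec : forall n : int, 0 <= n -> (n%:~R + be) * Phi3 (n + 1) = (n%:~R + 1) * Phi3 n.
Implicit Types (p q : P) (f g : Lau) (m : E).

Local Notation d := (sh s t w 1 (-1) (-1)).
Local Notation sh := (sh s t w).
Local Notation toL := (@to_laurent R).
Local Notation ns := (ns R s).
Local Notation nt := (nt R t).
Local Notation nw := (nw R w).

Lemma Phi1_pred n : n%:~R * Phi1 n = (n%:~R - 1 + al) * Phi1 (n - 1).
Proof. by have := Phi1_rec (n - 1); rewrite subrK intrB subrK. Qed.

Lemma Phi2_pred n : (n%:~R - 1 + de) * Phi2 n = (n%:~R - 1 + ga) * Phi2 (n - 1).
Proof. by have := Phi2_rec (n - 1); rewrite subrK intrB. Qed.

Lemma Phi3_pred n : 0 < n -> (n%:~R - 1 + be) * Phi3 n = n%:~R * Phi3 (n - 1).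
Proof.
move=> n0; have := @Phi3_rec (n - 1); rewrite subrK intrB subrK; apply.
by rewrite subr_ge0.
Qed.

Lemma to_laurentD p q : toL (p + q) = toL p + toL q.
Proof. by apply: linD; apply: to_laurent_linear. Qed.

Lemma to_laurentN p : toL (- p) = - toL p.
Proof. by rewrite -scaleN1r to_laurentZ scaleN1r. Qed.

Lemma toXs p : toL ('X_s * p) = wop (sh 1 0 0) (fun=> 1) (toL p).
Proof. by rewrite to_laurentM (unit_s s t w). Qed.
Lemma toXt p : toL ('X_t * p) = wop (sh 0 1 0) (fun=> 1) (toL p).
Proof. by rewrite to_laurentM (unit_t s t w). Qed.
Lemma toXw p : toL ('X_w * p) = wop (sh 0 0 1) (fun=> 1) (toL p).
Proof. by rewrite to_laurentM (unit_w s t w). Qed.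
Lemma tods p : toL p^`M(s) = wop (sh (-1) 0 0) ns (toL p).
Proof. by rewrite to_laurent_deriv (unit_s s t w) shN !oppr0. Qed.
Lemma todt p : toL p^`M(t) = wop (sh 0 (-1) 0) nt (toL p).
Proof. by rewrite to_laurent_deriv (unit_t s t w) shN !oppr0. Qed.
Lemma todw p : toL p^`M(w) = wop (sh 0 0 (-1)) nw (toL p).
Proof. by rewrite to_laurent_deriv (unit_w s t w) shN !oppr0. Qed.

Definition toE := (to_laurentD, to_laurentN, @to_laurentZ R, toXs, toXt, toXw, tods, todt, todw).

Ltac weight := move=> m /=; rewrite ?(nsD, ntD, nwD) //; ring.

Definition opQ b p : P := 'X_t * ('X_t * p^`M(t)) + b *: ('X_t * p) + c *: ('X_s * p^`M(w)).

Lemma toQ b p : toL (opQ b p) =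
  wop (sh 0 1 0) (fun m => nt m + b) (toL p) +
  wop (sh 0 1 0 + d) (fun m => c * nw m) (toL p).
Proof.
rewrite /opQ !toE !wop_comp !wopZl !shD wopDl; congr (_ + _); apply: eq_wop => //; weight.
Qed.

Hypothesis balance : al + de = be + ga.

Lemma alE : al = be + ga - de. Proof. by rewrite -balance addrK. Qed.

(** A monomial without t becomes negative under a shift that divides by t and
    keeps the other exponents nonnegative. *)
Lemma negative_shift m a b : nonneg m -> m t = 0 ->
  0 <= m s + a -> 0 <= m w + b -> negative t (m + sh a (-1) b).
Proof.
move=> /forallP m0 mt ma mb; rewrite /negative sht // mt /=.
apply/forallP => i; apply/implyP => it.
have [->|is_] := eqVneq i s; first by rewrite shs.
have [->|iw] := eqVneq i w; first by rewrite shw.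
by rewrite !ffunE ![_ == i]eq_sym (negPf it) (negPf is_) (negPf iw) !mulr0 !addr0.
Qed.

(** Moving a derivative in t past [Phi3] is exact on monomials that contain t;
    on the others the derivative vanishes but the recursion of [Phi3] at the
    exponent -1, which would be needed, does not hold. *)
Lemma Phi3_error m (x : C) : nonneg m ->
  Phi3 (m t - 1) * (x * nt m) - x * (nt m - 1 + be) * Phi3 (m t) != 0 ->
  m t = 0 /\ x != 0.
Proof.
move=> /forallP/(_ t) mt H; split.
  apply/eqP; apply: contraNT H => nt0.
  by rewrite -[x * _ * _]mulrA Phi3_pred ?lt_def ?nt0 // mulrC mulrA subrr.
by apply: contraNneq H => ->; rewrite !mul0r mulr0 subrr.
Qed.

Ltac shift_simpl := rewrite ?shs ?sht ?shw ?addr0 ?addrK ?subrK ?add0r //.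

Section Any.
Variable j : 'I_6.
Hypothesis jsw : (j == s) || (j == w).
Local Notation core := (core s t w j c Phi1 Phi2 Phi3).

Lemma shj m b : (m + sh 0 b 0) j = m j.
Proof. by case/orP: jsw => /eqP ->; shift_simpl. Qed.

(** Between the exponentials Q becomes t (N_t + 1), which commutes with [Phi2]
    and no longer contains the parameter: [Phi3] has replaced N_t + be by
    N_t + 1, and [Phi1] replaces N_t + 1 by N_t + al. The term with s d_w is
    removed by the first exponential and restored by the second. *)
Lemma core_Q p : core (opQ be p) = opQ al (core p).
Proof.
apply: (@core_intertwine _ _ _ _ j st sw tw c _ _ _ Phi1_neg p _ _ (sh 0 1 0)
  (fun m => nt m + be) (fun m => c * nw m) (fun m => nt m + al) (fun m => c * nw m)
  (fun m => nt m + 1) (fun=> 0) nw (fun=> 0)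
  (fun m => nt m + 1) (fun=> 0) nw (fun=> 0)); try by [weight|apply: toQ].
- move=> m m0; rewrite sht // /nt mulrC Phi3_rec ?subrr ?eqxx //.
  exact: (forallP m0).
- by move=> m _; rewrite !sht // addrK add0r mulrC subrr eqxx.
- by move=> m; rewrite shj mulrC.
- by move=> m; rewrite sht // /nt mulrC Phi1_rec.
by move=> m; rewrite !sht // addrK add0r mulrC.
Qed.

(** Weighted shifts that leave the exponents of t, w and j alone, with a weight
    that is invariant under (s/t) d_w, commute with each factor of the core. *)
Lemma core_commute (k : E) (a : E -> C) p q r :
  (forall m, (m + k) t = m t) -> (forall m, (m + k) w = m w) -> (forall m, (m + k) j = m j) ->
  (forall m, a (m + d) = a m) ->
  toL q = wop k a (toL p) -> toL r = wop k a (toL (core p)) -> core q = r.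
Proof.
move=> kt kw kj ad qE rE.
apply: (@core_intertwine _ _ _ _ j st sw tw c _ _ _ Phi1_neg p _ _ k
  a (fun=> 0) a (fun=> 0) a (fun=> 0) (fun=> 0) (fun=> 0)
  a (fun=> 0) (fun=> 0) (fun=> 0)) => [m _|m _|m|m|m|m|m|m|m|m|m|m|m|m||];
  rewrite /= ?kt ?kj ?ad ?mulr0 ?mul0r ?addr0 ?subr0 ?mul0r ?eqxx //.
1: by rewrite mulrC subrr eqxx.
all: rewrite ?mulr0 //.
all: try by rewrite /nw ?kw mulrC.
- by rewrite subrr eqxx.
- by rewrite qE (@wop0 R _ (fun=> 0)) ?addr0.
by rewrite rE (@wop0 R _ (fun=> 0)) ?addr0.
Qed.

Lemma core_scale (a : C) p : core (a *: p) = a *: core p.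
Proof.
by apply: (@core_commute 0 (fun=> a) p) => [m|m|m|m||]; rewrite ?addr0 // to_laurentZ
  -[X in a *: X]wop1 wopZl; apply: eq_wop => // m; rewrite mulr1.
Qed.

Definition opN (i i' : 'I_6) p : P := 'X_i * p^`M(i) + 'X_i' * p^`M(i').

Lemma toNsw p : toL (opN s w p) = wop (sh 0 0 0) (fun m => ns m + nw m) (toL p).
Proof. by rewrite /opN !toE !wop_comp !shD wopDl; apply: eq_wop => //; weight. Qed.

Lemma toNst p : toL (opN s t p) = wop (sh 0 0 0) (fun m => ns m + nt m) (toL p).
Proof. by rewrite /opN !toE !wop_comp !shD wopDl; apply: eq_wop => //; weight. Qed.

Lemma core_Nsw p : core (opN s w p) = opN s w (core p).
Proof.
apply: (core_commute (p := p) (k := sh 0 0 0) (a := fun m => ns m + nw m)) => [m|m|m|||].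
- by rewrite sh0 addr0.
- by rewrite sh0 addr0.
- by rewrite sh0 addr0.
- weight.
- exact: toNsw.
exact: toNsw.
Qed.

Lemma core_Nst p : core (opN s t p) = opN s t (core p).
Proof.
apply: (core_commute (p := p) (k := sh 0 0 0) (a := fun m => ns m + nt m)) => [m|m|m|||].
- by rewrite sh0 addr0.
- by rewrite sh0 addr0.
- by rewrite sh0 addr0.
- weight.
- exact: toNst.
exact: toNst.
Qed.

Lemma coreD p q : core (p + q) = core p + core q.
Proof.
apply: (can_inj (@to_laurentK R)).
have E r : toL (core r) = core_laurent s t w j c Phi1 Phi2 Phi3 (toL r).
  exact: to_laurent_core.
move: (E (p + q)) (E p) (E q).
move: (core (p + q)) (core p) (core q) => x y z Ex Ey Ez.
rewrite Ex !to_laurentD Ey Ez /core_laurent !euler_funE (linD _ _ (@wop_linear _ _ _)).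
rewrite -!euler_funE; apply: linear_tail_at => //;
by apply/supported_euler_fun/supported_to_laurent.
Qed.

Lemma coreN p : core (- p) = - core p.
Proof. by rewrite -scaleN1r core_scale scaleN1r. Qed.

Lemma core_X i p : i != s -> i != t -> i != w -> core ('X_i * p) = 'X_i * core p.
Proof.
move=> is_ it iw.
apply: (@core_commute (unit_exp i) (fun=> 1) p) => // [m|m|m||]; try exact: to_laurentM.
all: rewrite !ffunE ?(negPf it) ?(negPf iw) ?addr0 //.
by case/orP: jsw => /eqP ->; rewrite ?(negPf is_) ?(negPf iw) addr0.
Qed.

Lemma core_deriv i p : i != s -> i != t -> i != w -> core p^`M(i) = (core p)^`M(i).
Proof.
move=> is_ it iw.
apply: (@core_commute (- unit_exp i) (fun m => (m i)%:~R) p) => // [m|m|m|m||];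
  try exact: to_laurent_deriv.
all: rewrite !ffunE ?(negPf it) ?(negPf iw) ?subr0 //.
- by case/orP: jsw => /eqP ->; rewrite ?(negPf is_) ?(negPf iw) subr0.
by rewrite ![_ == i]eq_sym (negPf is_) (negPf it) (negPf iw) !mulr0 !addr0.
Qed.
End Any.

Lemma nonneg_pred m : nonneg m -> nw m != 0 -> 0 <= m w - 1.
Proof.
move=> /forallP/(_ w) m0 mw; rewrite subr_ge0 -gtz0_ge1 lt_def m0 andbT.
by apply: contra mw => /eqP E; rewrite /nw E.
Qed.

(** The core with [Phi2] in the exponent of s, as in R_3 and R_1. *)
Section InnerS.
Local Notation core := (core s t w s c Phi1 Phi2 Phi3).

Definition opM (a : C) p : P := a *: p^`M(s) + 'X_s * p^`M(s)^`M(s) + c *: p^`M(t)^`M(w).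

Lemma toM a p : toL (opM a p) =
  wop (sh (-1) 0 0) (fun m => ns m * (ns m - 1 + a)) (toL p) +
  wop (sh (-1) 0 0 + d) (fun m => c * nw m * nt m) (toL p).
Proof.
rewrite /opM !toE !wop_comp !wopZl !shD wopDl.
by congr (_ + _); apply: eq_wop => //; weight.
Qed.

(** The parameter of M is replaced by the recursion of [Phi2]; the balance of the
    four parameters makes the remaining factors of [Phi3] and [Phi1] match. *)
Lemma core_M p : core (opM ga p) = opM de (core p).
Proof.
apply: (@core_intertwine _ _ _ _ s st sw tw c _ _ _ Phi1_neg p _ _ (sh (-1) 0 0)
  (fun m => ns m * (ns m - 1 + ga)) (fun m => c * nw m * nt m)
  (fun m => ns m * (ns m - 1 + de)) (fun m => c * nw m * nt m)
  (fun m => ns m * (ns m - 1 + ga))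
  (fun m => c * nw m * (2%:R * ns m + nt m + ga + be - 1))
  (fun m => - nw m * (2%:R * ns m + ga)) (fun m => nw m * (nw m - 1))
  (fun m => ns m * (ns m - 1 + de))
  (fun m => c * nw m * (2%:R * ns m + nt m + ga + be - 1))
  (fun m => - nw m * (2%:R * ns m + de)) (fun m => nw m * (nw m - 1)));
  try by [weight|apply: toM].
- by move=> m _; rewrite sht // addr0 mulrC subrr eqxx.
- move=> m m0; rewrite -addrA shD !sht // !add0r => H.
  have [mt cw] : m t = 0 /\ c * nw m != 0.
    apply: Phi3_error => //; apply: contraNN H => /eqP H; apply/eqP; rewrite -[RHS]H.
    by congr (_ - _ * _); ring.
  apply: negative_shift => //; first by rewrite addNr addr0; apply: (forallP m0).
  by apply: nonneg_pred => //; apply: contraNneq cw => ->; rewrite mulr0.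
- move=> m; shift_simpl; have := Phi2_pred (m s); rewrite -/(ns m) => E.
  by rewrite mulrCA [in LHS]mulrC -mulrA [Phi2 _ * _]mulrC -E; ring.
- by move=> m; shift_simpl; rewrite mulrC.
- by move=> m; shift_simpl; rewrite mulrC.
move=> m; shift_simpl; have := Phi1_pred (m t); rewrite -/(nt m) alE => E.
by rewrite -[RHS]mulrA E; ring.
Qed.

Definition opF (a : C) p : P :=
  'X_w * (a *: p - 'X_w * p^`M(w) - 'X_s * p^`M(s) + 'X_t * p^`M(t)) + c *: ('X_s * p^`M(t)).

Lemma toF a p : toL (opF a p) =
  wop (sh 0 0 1) (fun m => a - nw m - ns m + nt m) (toL p) +
  wop (sh 0 0 1 + d) (fun m => c * nt m) (toL p).
Proof.
rewrite /opF !toE !wop_comp -[X in a *: X]wop1 -(sh0 s t w).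
rewrite -![- wop _ _ _]scaleN1r !wopZl !shD !wopDl wop_comp !shD.
by congr (_ + _); apply: eq_wop => //; weight.
Qed.

(** For this value of the parameter the recursions of [Phi3], [Phi2] and [Phi1]
    compensate each other. *)
Lemma core_F a p : a = be - 1 - de -> core (opF a p) = opF a (core p).
Proof.
move=> aE.
apply: (@core_intertwine _ _ _ _ s st sw tw c _ _ _ Phi1_neg p _ _ (sh 0 0 1)
  (fun m => a - nw m - ns m + nt m) (fun m => c * nt m)
  (fun m => a - nw m - ns m + nt m) (fun m => c * nt m)
  (fun m => a - nw m - ns m + nt m) (fun m => c * (ns m + de))
  (fun m => a - ns m + nt m) nw
  (fun m => a - nw m - ns m + nt m) (fun m => c * (ns m + ga))
  (fun m => a - ns m + nt m) nw);
  try by [weight|apply: toF].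
- by move=> m _; rewrite sht // addr0 mulrC subrr eqxx.
- move=> m m0; rewrite -addrA shD !sht // !add0r => H.
  have [mt cw] : m t = 0 /\ c != 0.
    apply: Phi3_error => //; apply: contraNN H => /eqP H; apply/eqP; rewrite -[RHS]H.
    by congr (_ - _ * _); rewrite aE; ring.
  apply: negative_shift => //; last by rewrite addr0; apply: (forallP m0).
  by rewrite addr_ge0 //; apply: (forallP m0).
- by move=> m; shift_simpl; rewrite mulrC.
- move=> m; shift_simpl; have := Phi2_rec (m s); rewrite -/(ns m) => E.
  by rewrite mulrCA -mulrA -E [(_ + _) * _]mulrC.
- by move=> m; shift_simpl; rewrite mulrC.
move=> m; shift_simpl; have := Phi1_pred (m t); rewrite -/(nt m) alE => E.
by rewrite -[RHS]mulrA E aE; ring.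
Qed.

Lemma core_dw p : core p^`M(w) = (core p)^`M(w).
Proof.
have to1 q : toL q^`M(w) = wop (sh 0 0 (-1)) nw (toL q) +
    wop (sh 0 0 (-1) + d) (fun=> 0) (toL q).
  by rewrite (@wop0 R _ (fun=> 0)) // addr0 todw.
apply: (@core_intertwine _ _ _ _ s st sw tw c _ _ _ Phi1_neg p _ _ (sh 0 0 (-1))
  nw (fun=> 0) nw (fun=> 0) nw (fun=> 0) (fun=> 0) (fun=> 0) nw (fun=> 0) (fun=> 0) (fun=> 0));
  try by [weight|apply: to1].
- by move=> m _; shift_simpl; rewrite mulrC subrr eqxx.
- by move=> m _; rewrite !mulr0 addr0 mul0r subr0 eqxx.
- by move=> m; shift_simpl; rewrite mulrC.
by move=> m; shift_simpl; rewrite mulrC.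
Qed.
End InnerS.

(** The core with [Phi2] in the exponent of w, as in R_2. *)
Section InnerW.
Local Notation core := (core s t w w c Phi1 Phi2 Phi3).

Definition opG (a : C) p : P := 'X_w * (a *: p + 'X_w * p^`M(w)) + c *: ('X_s * p^`M(t)).

Lemma toG a p : toL (opG a p) =
  wop (sh 0 0 1) (fun m => nw m + a) (toL p) +
  wop (sh 0 0 1 + d) (fun m => c * nt m) (toL p).
Proof.
rewrite /opG !toE !wop_comp -[X in a *: X]wop1 -(sh0 s t w).
rewrite !wopZl !shD !wopDl wop_comp !shD.
by congr (_ + _); apply: eq_wop => //; weight.
Qed.

Lemma core_G p : core (opG de p) = opG ga (core p).
Proof.
apply: (@core_intertwine _ _ _ _ w st sw tw c _ _ _ Phi1_neg p _ _ (sh 0 0 1)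
  (fun m => nw m + de) (fun m => c * nt m)
  (fun m => nw m + ga) (fun m => c * nt m)
  (fun m => nw m + de) (fun m => c * (nt m - 2%:R * nw m + be - 1 - de))
  (fun m => 2%:R * nw m + de) nw
  (fun m => nw m + ga) (fun m => c * (nt m - 2%:R * nw m + be - 1 - de))
  (fun m => 2%:R * nw m + ga) nw);
  try by [weight|apply: toG].
- by move=> m _; rewrite sht // addr0 mulrC subrr eqxx.
- move=> m m0; rewrite -addrA shD !sht // !add0r => H.
  have [mt cw] : m t = 0 /\ c != 0.
    apply: Phi3_error => //; apply: contraNN H => /eqP H; apply/eqP; rewrite -[RHS]H.
    by congr (_ - _ * _); ring.
  apply: negative_shift => //; last by rewrite addr0; apply: (forallP m0).
  by rewrite addr_ge0 //; apply: (forallP m0).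
- move=> m; shift_simpl; have := Phi2_rec (m w); rewrite -/(nw m) => E.
  by rewrite mulrC E.
- by move=> m; shift_simpl; rewrite mulrC.
- by move=> m; shift_simpl; rewrite mulrC.
move=> m; shift_simpl; have := Phi1_pred (m t); rewrite -/(nt m) alE => E.
by rewrite -[RHS]mulrA E; ring.
Qed.

Definition opT (a : C) p : P := c *: p^`M(t)^`M(w) -
  (a *: p + 'X_s * p^`M(s) + 'X_w * p^`M(w) + 'X_t * p^`M(t))^`M(s).

Lemma toT a p : toL (opT a p) =
  wop (sh (-1) 0 0) (fun m => - ns m * (a + ns m + nw m + nt m)) (toL p) +
  wop (sh (-1) 0 0 + d) (fun m => c * nw m * nt m) (toL p).
Proof.
rewrite /opT !toE !wop_comp -[X in a *: X]wop1 -(sh0 s t w).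
rewrite !wopZl !shD !wopDl wop_comp -[- wop _ _ _]scaleN1r wopZl !shD [RHS]addrC.
by congr (_ + _); apply: eq_wop => //; weight.
Qed.

Lemma core_T a p : a = be + ga - 1 -> core (opT a p) = opT a (core p).
Proof.
move=> aE.
apply: (@core_intertwine _ _ _ _ w st sw tw c _ _ _ Phi1_neg p _ _ (sh (-1) 0 0)
  (fun m => - ns m * (a + ns m + nw m + nt m)) (fun m => c * nw m * nt m)
  (fun m => - ns m * (a + ns m + nw m + nt m)) (fun m => c * nw m * nt m)
  (fun m => - ns m * (a + ns m + nw m + nt m)) (fun m => - c * nw m * (nw m + ga - 1))
  (fun m => nw m * (a + nw m + nt m - 1)) (fun m => nw m * (nw m - 1))
  (fun m => - ns m * (a + ns m + nw m + nt m)) (fun m => - c * nw m * (nw m + de - 1))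
  (fun m => nw m * (a + nw m + nt m - 1)) (fun m => nw m * (nw m - 1)));
  try by [weight|apply: toT].
- by move=> m _; rewrite sht // addr0 mulrC subrr eqxx.
- move=> m m0; rewrite -addrA shD !sht // !add0r => H.
  have [mt cw] : m t = 0 /\ c * nw m != 0.
    apply: Phi3_error => //; apply: contraNN H => /eqP H; apply/eqP; rewrite -[RHS]H.
    by congr (_ - _ * _); rewrite aE; ring.
  apply: negative_shift => //; first by rewrite addNr addr0; apply: (forallP m0).
  by apply: nonneg_pred => //; apply: contraNneq cw => ->; rewrite mulr0.
- by move=> m; shift_simpl; rewrite mulrC.
- move=> m; shift_simpl; have := Phi2_pred (m w); rewrite -/(nw m) => E.
  have -> x : nw m + x - 1 = nw m - 1 + x by ring.
  by rewrite mulrC -!mulrA -E; ring.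
- by move=> m; shift_simpl; rewrite mulrC.
move=> m; shift_simpl; have := Phi1_pred (m t); rewrite -/(nt m) alE => E.
by rewrite -[RHS]mulrA E aE; ring.
Qed.

Lemma core_s p : core ('X_s * p) = 'X_s * core p.
Proof.
apply: (core_commute (p := p) (k := sh 1 0 0) (a := fun=> 1)) => // [m|m|m||];
  by rewrite ?sht ?shw ?addr0 ?toXs.
Qed.
End InnerW.
End Relations.

(** * Exponentials of vector fields and shears *)

Section Flows.
Variable R : realType.
Local Notation C := R[i].
Local Notation P := {mpoly C[6]}.
Implicit Types (p q r : P) (i j : 'I_6).

Lemma mderivXU i j : ('X_j : P)^`M(i) = (i == j)%:R.
Proof.
rewrite mderivX mnm1E eq_sym; have [->|_] := eqVneq i j; last by rewrite scale0r.
rewrite (_ : (U_(j) - U_(j))%MM = 0%MM) ?mpolyX0 ?scale1r //.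
by apply/mnmP => k; rewrite mnmBE subnn mnm0E.
Qed.

Section OneFlow.
Variables (q : P) (i : 'I_6).
Hypothesis qi : q^`M(i) = 0.
Let D p := q * p^`M(i).

Let DL : linear D.
Proof. by move=> a u v; rewrite /D mderivD mderivZ mulrDr scalerAr. Qed.

Let mulL r : linear (fun p => r * p).
Proof. by move=> a u v; rewrite mulrDr scalerAr. Qed.

Let zeroL : linear (fun _ : P => 0 : P).
Proof. by move=> a u v; rewrite scaler0 addr0. Qed.

Let DX r p : r^`M(i)^`M(i) = 0 -> D (r * p) = r * D p + q * r^`M(i) * p.
Proof. by move=> _; rewrite /D mderivM; ring. Qed.

Let DY r p : r^`M(i)^`M(i) = 0 -> D (q * r^`M(i) * p) = q * r^`M(i) * D p + 2%:R *: 0.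
Proof. by move=> ri; rewrite /D !mderivM qi ri scaler0; ring. Qed.

Lemma mderivXU2 j k l : ('X_j : P)^`M(k)^`M(l) = 0.
Proof. by rewrite mderivXU; case: eqP => _; rewrite ?mderiv0 // -mpolyC1 mderivC. Qed.

Lemma nilp_flow p : nilp_at D p.
Proof.
move: p; apply: (@mpoly_mulX_ind R (nilp_at D)) => [|p p' np np'|c p np|j p np].
- by exists 1%N; rewrite /= /D -mpolyC1 mderivC mulr0.
- exact: nilp_atD.
- exact: nilp_atZ.
have rj := mderivXU2 j i i.
apply: (@nilp_at_conj _ _ D (fun p => 'X_j * p) (fun p => q * ('X_j)^`M(i) * p) (fun _ => 0)) => //.
- by move=> v; apply: DX.
- by move=> v; apply: DY.
- by move=> v; apply: lin0.
Qed.

Lemma flowD p r : flow q i (p + r) = flow q i p + flow q i r.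
Proof. by apply: opexpD => //; apply: nilp_flow. Qed.

Lemma flowZ a p : flow q i (a *: p) = a *: flow q i p.
Proof. by apply: opexpZ => //; apply: nilp_flow. Qed.

Lemma flowN p : flow q i (- p) = - flow q i p.
Proof. by rewrite -scaleN1r flowZ scaleN1r. Qed.

Lemma flow1 : flow q i 1 = 1.
Proof.
rewrite /flow (@opexpE _ _ _ 1) //=.
  by rewrite big_ord_recl big_ord0 addr0 /= fact0 invr1 scale1r.
by rewrite -/(D 1) /D -mpolyC1 mderivC mulr0.
Qed.

Lemma flowM r p : r^`M(i)^`M(i) = 0 ->
  flow q i (r * p) = (r + q * r^`M(i)) * flow q i p.
Proof.
move=> ri; rewrite /flow (@opexp_conj _ _ D _ (fun p => q * r^`M(i) * p) (fun _ => 0)) //.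
- by rewrite addr0 mulrDl.
- by move=> v; apply: DX.
- by move=> v; apply: DY.
- by move=> v; apply: lin0.
exact: nilp_flow.
Qed.

Lemma flowX j p : flow q i ('X_j * p) = ('X_j + q * (i == j)%:R) * flow q i p.
Proof. by rewrite flowM ?mderivXU2 // mderivXU. Qed.

(** The chain rule for the substitution of x_i + q for x_i. *)
Lemma flow_deriv j p : flow q i p^`M(j) =
  (flow q i p)^`M(j) - q^`M(j) * (flow q i p)^`M(i).
Proof.
rewrite /flow (@opexp_conj _ _ D (mderiv j) (fun p => - (q^`M(j) * p^`M(i))) (fun _ => 0)) //.
- by rewrite addr0.
- by move=> a u v; rewrite mderivD mderivZ.
- by move=> a u v; rewrite mderivD mderivZ mulrDr -scalerAr opprD scalerN.
- by move=> v; rewrite /D mderivM [v^`M(j)^`M(i)]mderiv_comm; ring.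
- move=> v; rewrite /D scaler0 addr0 mderivN !mderivM qi.
  by rewrite [q^`M(j)^`M(i)]mderiv_comm qi mderiv0; ring.
- by move=> v; apply: lin0.
exact: nilp_flow.
Qed.
End OneFlow.

#[local] Opaque flow.

Lemma flowK q q' i p : q' = - q -> q^`M(i) = 0 -> flow q' i (flow q i p) = p.
Proof.
move=> qE qi; have qi' : q'^`M(i) = 0 by rewrite qE mderivN qi oppr0.
move: p; apply: (@mpoly_mulX_ind R (fun p => flow q' i (flow q i p) = p)) => [|p p' np np'|c p np|j p np].
- by rewrite !flow1.
- by rewrite (flowD qi) (flowD qi'); congr (_ + _).
- by rewrite (flowZ qi) (flowZ qi') np.
have cj : ((i == j)%:R : P)^`M(i) = 0 by rewrite -mderivXU mderivXU2.
have ri : ('X_j + q * (i == j)%:R : P)^`M(i) = (i == j)%:R.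
  by rewrite mderivD mderivM qi mul0r cj mulr0 !addr0 mderivXU.
by rewrite (flowX qi) (flowM qi') ri // np qE; ring.
Qed.

Lemma flow_comp_mpoly q i (l : 6.-tuple P) : q^`M(i) = 0 ->
  (forall j, tnth l j = 'X_j + q * (i == j)%:R) -> forall p, p \mPo l = flow q i p.
Proof.
move=> qi lE; apply: (@mpoly_mulX_ind R (fun p => p \mPo l = flow q i p)) => [|p p' np np'|c p np|j p np].
- by rewrite comp_mpoly1 flow1.
- by rewrite comp_mpolyD np np' (flowD qi).
- by rewrite comp_mpolyZ np (flowZ qi).
by rewrite rmorphM /= comp_mpolyXU -tnth_nth lE np (flowX qi).
Qed.

Lemma flowX_neq q i j p : q^`M(i) = 0 -> (i == j) = false ->
  flow q i ('X_j * p) = 'X_j * flow q i p.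
Proof. by move=> qi ij; rewrite (flowX qi) ij mulr0 addr0. Qed.

Lemma flowX_eq q i p : q^`M(i) = 0 ->
  flow q i ('X_i * p) = 'X_i * flow q i p + q * flow q i p.
Proof. by move=> qi; rewrite (flowX qi) eqxx mulr1 mulrDl. Qed.

Lemma flow_deriv0 q i j p : q^`M(i) = 0 -> q^`M(j) = 0 ->
  flow q i p^`M(j) = (flow q i p)^`M(j).
Proof. by move=> qi qj; rewrite (flow_deriv qi) qj mul0r subr0. Qed.

End Flows.

Section Shear.
Variable R : realType.
Local Notation C := R[i].
Local Notation P := {mpoly C[6]}.
Variables x y z x' y' z' : 'I_6.
Hypothesis U : uniq [:: x; y; z; x'; y'; z'].
Implicit Types p q : P.

(** S_3 is [shear x1 y1 z1 x2 y2 z2], S_1 is [shear x2 y2 z2 x1 y1 z1] and S_2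
    is [shear x1 y1 z2 x2 y2 z1]. The three exponentials translate x, y, z as
    in the product of two unipotent matrices. *)
Definition shear : P -> P :=
  flow ('X_y' - 'X_x * 'X_z') y \o flow 'X_z' z \o flow 'X_x' x.
Definition shear_inv : P -> P :=
  flow (- 'X_x') x \o flow (- 'X_z') z \o flow (- ('X_y' - 'X_x * 'X_z')) y.

Let ne := distinct U.

Definition dX := (mderivD, mderivB, mderivN, mderivM, @mderivXU R, ne, eqxx, natb01).

Definition Fx : P -> P := flow 'X_x' x.
Definition Fz : P -> P := flow 'X_z' z.
Definition Fy : P -> P := flow ('X_y' - 'X_x * 'X_z') y.

Let qx : ('X_x' : P)^`M(x) = 0. Proof. by rewrite !dX. Qed.
Let qz : ('X_z' : P)^`M(z) = 0. Proof. by rewrite !dX. Qed.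
Let qy : ('X_y' - 'X_x * 'X_z' : P)^`M(y) = 0. Proof. by rewrite !dX; ring. Qed.

Let FxD p q : Fx (p + q) = Fx p + Fx q. Proof. exact: flowD. Qed.
Let FzD p q : Fz (p + q) = Fz p + Fz q. Proof. exact: flowD. Qed.
Let FyD p q : Fy (p + q) = Fy p + Fy q. Proof. exact: flowD. Qed.
Let FxZ a p : Fx (a *: p) = a *: Fx p. Proof. exact: flowZ. Qed.
Let FzZ a p : Fz (a *: p) = a *: Fz p. Proof. exact: flowZ. Qed.
Let FyZ a p : Fy (a *: p) = a *: Fy p. Proof. exact: flowZ. Qed.
Let FxN p : Fx (- p) = - Fx p. Proof. exact: flowN. Qed.
Let FzN p : Fz (- p) = - Fz p. Proof. exact: flowN. Qed.
Let FyN p : Fy (- p) = - Fy p. Proof. exact: flowN. Qed.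
Let FxX j p : (x == j) = false -> Fx ('X_j * p) = 'X_j * Fx p. Proof. exact: flowX_neq. Qed.
Let FzX j p : (z == j) = false -> Fz ('X_j * p) = 'X_j * Fz p. Proof. exact: flowX_neq. Qed.
Let FyX j p : (y == j) = false -> Fy ('X_j * p) = 'X_j * Fy p. Proof. exact: flowX_neq. Qed.
Let Fx_x p : Fx ('X_x * p) = 'X_x * Fx p + 'X_x' * Fx p. Proof. exact: flowX_eq. Qed.
Let Fz_z p : Fz ('X_z * p) = 'X_z * Fz p + 'X_z' * Fz p. Proof. exact: flowX_eq. Qed.
Let Fy_y p : Fy ('X_y * p) = 'X_y * Fy p + ('X_y' - 'X_x * 'X_z') * Fy p.
Proof. exact: flowX_eq. Qed.
Let Fxd j p : (j == x') = false -> Fx p^`M(j) = (Fx p)^`M(j).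
Proof. by move=> jx; apply: flow_deriv0 => //; rewrite mderivXU jx. Qed.
Let Fzd j p : (j == z') = false -> Fz p^`M(j) = (Fz p)^`M(j).
Proof. by move=> jx; apply: flow_deriv0 => //; rewrite mderivXU jx. Qed.
Let Fyd j p : (j == x) = false -> (j == y') = false -> (j == z') = false ->
  Fy p^`M(j) = (Fy p)^`M(j).
Proof.
move=> jx jy jz; apply: flow_deriv0 => //.
by rewrite mderivB mderivM !mderivXU jx jy jz mul0r mulr0 addr0 subr0.
Qed.
Let Fx_dx' p : Fx p^`M(x') = (Fx p)^`M(x') - (Fx p)^`M(x).
Proof. by rewrite /Fx (flow_deriv qx) mderivXU eqxx mul1r. Qed.
Let Fz_dz' p : Fz p^`M(z') = (Fz p)^`M(z') - (Fz p)^`M(z).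
Proof. by rewrite /Fz (flow_deriv qz) mderivXU eqxx mul1r. Qed.
Let Fy_dx p : Fy p^`M(x) = (Fy p)^`M(x) + 'X_z' * (Fy p)^`M(y).
Proof. by rewrite /Fy (flow_deriv qy) !dX; ring. Qed.
Let Fy_dy' p : Fy p^`M(y') = (Fy p)^`M(y') - (Fy p)^`M(y).
Proof. by rewrite /Fy (flow_deriv qy) !dX; ring. Qed.
Let Fy_dz' p : Fy p^`M(z') = (Fy p)^`M(z') + 'X_x * (Fy p)^`M(y).
Proof. by rewrite /Fy (flow_deriv qy) !dX; ring. Qed.

Lemma shearE p : shear p = Fy (Fz (Fx p)). Proof. reflexivity. Qed.

#[local] Opaque Fx Fy Fz.

Lemma shearD p q : shear (p + q) = shear p + shear q.
Proof. by rewrite !shearE FxD FzD FyD. Qed.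
Lemma shearZ a p : shear (a *: p) = a *: shear p.
Proof. by rewrite !shearE FxZ FzZ FyZ. Qed.
Lemma shearN p : shear (- p) = - shear p.
Proof. by rewrite !shearE FxN FzN FyN. Qed.

Lemma shearK p : shear_inv (shear p) = p.
Proof. by rewrite /shear_inv /shear /= !flowK. Qed.

Lemma shear_invK p : shear (shear_inv p) = p.
Proof. by rewrite /shear_inv /shear /= !flowK ?opprK // mderivN (qx, qy, qz) oppr0. Qed.

Ltac side lem := rewrite lem; [|by rewrite ne].

Lemma shear_x p : shear ('X_x * p) = ('X_x + 'X_x') * shear p.
Proof. rewrite !shearE Fx_x FzD; do 2 side FzX; rewrite FyD; do 2 side FyX; rewrite mulrDl; reflexivity. Qed.
Lemma shear_y p : shear ('X_y * p) = ('X_y + 'X_y' - 'X_x * 'X_z') * shear p.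
Proof. rewrite !shearE; side FxX; side FzX; rewrite Fy_y -mulrDl addrA; reflexivity. Qed.
Lemma shear_z p : shear ('X_z * p) = ('X_z + 'X_z') * shear p.
Proof. rewrite !shearE; side FxX; rewrite Fz_z FyD; do 2 side FyX; rewrite mulrDl; reflexivity. Qed.
Lemma shear_x' p : shear ('X_x' * p) = 'X_x' * shear p.
Proof. rewrite !shearE; side FxX; side FzX; side FyX; reflexivity. Qed.
Lemma shear_y' p : shear ('X_y' * p) = 'X_y' * shear p.
Proof. rewrite !shearE; side FxX; side FzX; side FyX; reflexivity. Qed.
Lemma shear_z' p : shear ('X_z' * p) = 'X_z' * shear p.
Proof. rewrite !shearE; side FxX; side FzX; side FyX; reflexivity. Qed.
Lemma shear_dx p : shear p^`M(x) = (shear p)^`M(x) + 'X_z' * (shear p)^`M(y).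
Proof. rewrite !shearE; side Fxd; side Fzd; rewrite Fy_dx; reflexivity. Qed.
Lemma shear_dy p : shear p^`M(y) = (shear p)^`M(y).
Proof. rewrite !shearE; side Fxd; side Fzd; rewrite Fyd ?ne; reflexivity. Qed.
Lemma shear_dz p : shear p^`M(z) = (shear p)^`M(z).
Proof. rewrite !shearE; side Fxd; side Fzd; rewrite Fyd ?ne; reflexivity. Qed.
Lemma shear_dx' p : shear p^`M(x') =
  (shear p)^`M(x') - (shear p)^`M(x) - 'X_z' * (shear p)^`M(y).
Proof.
rewrite !shearE Fx_dx' FzD FzN; do 2 side Fzd; rewrite FyD FyN Fy_dx Fyd ?ne; try reflexivity.
rewrite opprD addrA; reflexivity.
Qed.
Lemma shear_dy' p : shear p^`M(y') = (shear p)^`M(y') - (shear p)^`M(y).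
Proof. rewrite !shearE; side Fxd; side Fzd; rewrite Fy_dy'; reflexivity. Qed.
Lemma shear_dz' p : shear p^`M(z') =
  (shear p)^`M(z') - (shear p)^`M(z) + 'X_x * (shear p)^`M(y).
Proof.
rewrite !shearE; side Fxd; rewrite Fz_dz' FyD FyN Fy_dz' Fyd ?ne; [|reflexivity..].
rewrite addrAC; reflexivity.
Qed.

End Shear.

(** * Operator matrices as functions of vectors *)

Section Bridge.
Variable R : realType.
Local Notation C := R[i].
Local Notation P := {mpoly C[6]}.
Local Notation vec := (vec P).
Local Notation X := (fun i : 'I_6 => 'X_i : P).
Local Notation D := (fun i : 'I_6 => mderiv i : P -> P).
Local Notation k := (@mpolyC 6 C).
Local Notation L := (lax k X D).

Definition entry (v : vec) (i : 'I_3) : P := nth 0 [:: v.1.1; v.1.2; v.2] i.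
Definition unit_vec (j : 'I_3) (p : P) : vec :=
  ((j == 0)%:R * p, (j == 1)%:R * p, (j == 2%:R)%:R * p).

(** The matrix is recovered from the function by evaluation at the vectors
    [unit_vec j p]. *)
Definition acts (M : opmx R) (F : vec -> vec) :=
  forall v i, entry (F v) i = \sum_j M i j (entry v j).

Definition additive_mx (M : opmx R) := forall i j p q, M i j (p + q) = M i j p + M i j q.

Lemma additive_mx0 M i j : additive_mx M -> M i j 0 = 0.
Proof.
move=> /(_ i j 0 0); rewrite addr0 => /(congr1 (fun q => q - M i j 0)).
by rewrite addrK subrr.
Qed.

Lemma additive_mx_sum M i j I (r : seq I) (F : I -> P) : additive_mx M ->
  M i j (\sum_(l <- r) F l) = \sum_(l <- r) M i j (F l).
Proof.
move=> Ml; elim: r => [|a r IH]; first by rewrite !big_nil additive_mx0.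
by rewrite !big_cons Ml IH.
Qed.

Lemma additive_mx_mul M N : additive_mx M -> additive_mx N -> additive_mx (opmx_mul M N).
Proof.
move=> Ml Nl i j p q; rewrite !mxE -big_split; apply: eq_bigr => l _.
by rewrite Nl Ml.
Qed.

Lemma acts_mul M N FM FN : additive_mx M -> acts M FM -> acts N FN ->
  acts (opmx_mul M N) (FM \o FN).
Proof.
move=> Ml aM aN v i; rewrite [LHS]aM.
under eq_bigr => l _ do rewrite [entry (FN v) l]aN (additive_mx_sum _ _ _ _ Ml).
rewrite exchange_big; apply: eq_bigr => j _.
by rewrite mxE.
Qed.

Lemma acts_rows (rows : seq (seq (P -> P))) (F : vec -> vec) :
  (forall v (i : 'I_3), entry (F v) i =
     let f j := nth (fun=> 0) (nth [::] rows i) j in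
     f 0%N v.1.1 + f 1%N v.1.2 + f 2%N v.2) ->
  acts (opmx_of_rows rows) F.
Proof.
move=> H v i; rewrite H !big_ord_recl big_ord0 !mxE /= addr0 addrA.
reflexivity.
Qed.

Lemma additive_rows (rows : seq (seq (P -> P))) :
  (forall i j p q, nth (fun=> 0) (nth [::] rows i) j (p + q) =
    nth (fun=> 0) (nth [::] rows i) j p + nth (fun=> 0) (nth [::] rows i) j q :> P) ->
  additive_mx (opmx_of_rows rows).
Proof. by move=> H i j p q; rewrite !mxE H. Qed.

Lemma Lax_acts x y z a1 a2 a3 : acts (Lax x y z a1 a2 a3) (L x y z a1 a2 a3) /\
  additive_mx (Lax x y z a1 a2 a3).
Proof.
have addM (q p p' : P) : q * (p + p') = q * p + q * p' by rewrite mulrDr.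
have ad0 (p p' : P) : (0 : P) = 0 + 0 by rewrite addr0.
rewrite /Lax.
set r1 := opmx_of_rows _; set r2 := opmx_of_rows _; set r3 := opmx_of_rows _.
have A1 : additive_mx r1.
  apply: additive_rows => [[|[|[|i]]] [|[|[|j]]] p q] /=; rewrite ?nth_nil; first [exact: addM|exact: ad0].
have A2 : additive_mx r2.
  apply: additive_rows => [[|[|[|i]]] [|[|[|j]]] p q] /=; rewrite ?nth_nil; try first [exact: addM|exact: ad0|exact: mderivD].
  by rewrite !mderivD; ring.
have A3 : additive_mx r3.
  apply: additive_rows => [[|[|[|i]]] [|[|[|j]]] p q] /=; rewrite ?nth_nil; first [exact: addM|exact: ad0].
split; last by do !apply: additive_mx_mul.
have -> : L x y z a1 a2 a3 = (lax_left X x y z \o lax_mid k X D x y z a1 a2 a3) \o lax_right X x y z by [].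
apply: acts_mul; first exact: additive_mx_mul; first apply: acts_mul => //.
- apply: acts_rows => v [[|[|[|//]]] ?]; rewrite /entry /=; ring.
- apply: acts_rows => v [[|[|[|//]]] ?]; rewrite /entry /=; ring.
apply: acts_rows => v [[|[|[|//]]] ?]; rewrite /entry /=; ring.
Qed.
End Bridge.

(** * The exchanges of single parameters *)

Section Concrete.
Variable R : realType.
Local Notation C := R[i].
Local Notation P := {mpoly C[6]}.
Local Notation vec := (vec P).
Local Notation X := (fun i : 'I_6 => 'X_i : P).
Local Notation D := (fun i : 'I_6 => mderiv i : P -> P).
Local Notation k := (@mpolyC 6 C).
Local Notation L := (lax k X D).

Let PD (i : 'I_6) (p q : P) : (p + q)^`M(i) = p^`M(i) + q^`M(i). Proof. exact: mderivD. Qed.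
Let PM (i : 'I_6) (p q : P) : (p * q)^`M(i) = p^`M(i) * q + p * q^`M(i). Proof. exact: mderivM. Qed.
Let Pk (i : 'I_6) (a : C) : (a%:MP : P)^`M(i) = 0. Proof. exact: mderivC. Qed.
Let PX (i j : 'I_6) : ('X_j : P)^`M(i) = (i == j)%:R. Proof. exact: mderivXU. Qed.
Let PC (i j : 'I_6) (p : P) : p^`M(j)^`M(i) = p^`M(i)^`M(j). Proof. exact: mderiv_comm. Qed.

Lemma mpoly_double_inj (p q : P) : p + p = q + q -> p = q.
Proof.
have half u : (2%:R^-1 : C) *: (u + u : P) = u.
  rewrite scalerDr -scalerDl -mulr2n -[_ *+ 2]mulr_natr mulVf; last by rewrite pnatr_eq0.
  exact: scale1r.
by move=> /(congr1 (fun r => (2%:R^-1 : C) *: r)); rewrite !half.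
Qed.

Section CoreOps.
Variables (s t w : 'I_6) (c : C).
Lemma aQE b p : aQ k X D s t w c b p = opQ s t w c b p.
Proof. rewrite /opQ -!mul_mpolyC; reflexivity. Qed.
Lemma aME b p : aM k X D s t w c b p = opM s t w c b p.
Proof. rewrite /opM -!mul_mpolyC; reflexivity. Qed.
Lemma aFE b p : aF k X D s t w c b p = opF s t w c b p.
Proof. rewrite /opF -!mul_mpolyC; reflexivity. Qed.
Lemma aGE b p : aG k X D s t w c b p = opG s t w c b p.
Proof. rewrite /opG -!mul_mpolyC; reflexivity. Qed.
Lemma aTE b p : aT k X D s t w c b p = opT s t w c b p.
Proof. rewrite /opT -!mul_mpolyC; reflexivity. Qed.
Lemma aNE i j p : aN X D i j p = opN i j p.
Proof. reflexivity. Qed.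
End CoreOps.

Section Generic.
Variables x y z x' y' z' : 'I_6.
Hypothesis U : uniq [:: x; y; z; x'; y'; z'].
Local Notation S := (@shear R x y z x' y' z').

Lemma shear_scale (a : C) p : S (a%:MP * p) = a%:MP * S p.
Proof. by rewrite !mul_mpolyC shearZ. Qed.

Lemma mpoly_shear_lax3 a1 a2 a3 b1 b2 b3 v :
  map3 S (L x y z a1 a2 a3 (L x' y' z' b1 b2 b3 v)) =
  lax_left X x' y' z' (L x y z a1 a2 a3 (sheared_mid3 k X D x y z x' y' z' b1 b2 b3 (lax_right X x' y' z' (map3 S v)))).
Proof.
exact: (shear_lax3 (shearD U) (shearN U) shear_scale (shear_x U) (shear_y U) (shear_z U)
  (shear_x' U) (shear_y' U) (shear_z' U) (shear_dx U) (shear_dy U) (shear_dz U)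
  (shear_dx' U) (shear_dy' U) (shear_dz' U)).
Qed.

Lemma mpoly_shear_lax2 a1 a2 a3 b1 b2 b3 v :
  map3 S (L x y z' a1 a2 a3 (L x' y' z b1 b2 b3 v)) =
  lax_left X x' y' z' (sheared_lax2 k X D x y z x' y' z' a1 a2 a3 b1 b2 b3 (lax_right X x' y' z' (map3 S v))).
Proof.
exact: (shear_lax2 (shearD U) (shearN U) shear_scale (shear_x U) (shear_y U) (shear_z U)
  (shear_x' U) (shear_y' U) (shear_z' U) (shear_dx U) (shear_dy U) (shear_dz U)
  (shear_dx' U) (shear_dy' U) (shear_dz' U)).
Qed.

Let ne := distinct U.
(** The change between y_2 and y = y_2 + x_2 z_2 as exponentials, for which the
    rules of [flow] apply. *)
Definition drop_xz : P -> P := flow (- ('X_x * 'X_z)) y.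
Definition add_xz : P -> P := flow ('X_x * 'X_z) y.
Local Notation Y := drop_xz.
Local Notation Yinv := add_xz.
Let qy : ('X_x * 'X_z : P)^`M(y) = 0.
Proof. by rewrite mderivM !mderivXU !ne mul0r mulr0 addr0. Qed.
Let qyN : (- ('X_x * 'X_z) : P)^`M(y) = 0. Proof. by rewrite mderivN qy oppr0. Qed.
Let qd (i : 'I_6) : (- ('X_x * 'X_z) : P)^`M(i) = - ((i == x)%:R * 'X_z + 'X_x * (i == z)%:R).
Proof. rewrite mderivN mderivM !mderivXU; reflexivity. Qed.
Let YK p : Yinv (Y p) = p.
Proof. by apply: flowK qyN; rewrite opprK. Qed.
Let YinvK p : Y (Yinv p) = p. Proof. exact: flowK qy. Qed.
Let YD p q : Y (p + q) = Y p + Y q. Proof. exact: flowD. Qed.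
Let YN p : Y (- p) = - Y p. Proof. exact: flowN. Qed.
Let Yk a p : Y (a%:MP * p) = a%:MP * Y p. Proof. rewrite !mul_mpolyC; exact: flowZ. Qed.
Let YX i p : (y == i) = false -> Y ('X_i * p) = 'X_i * Y p. Proof. exact: flowX_neq. Qed.
Let Yx p : Y ('X_x * p) = 'X_x * Y p. Proof. by rewrite YX ?ne. Qed.
Let Yz p : Y ('X_z * p) = 'X_z * Y p. Proof. by rewrite YX ?ne. Qed.
Let Yx' p : Y ('X_x' * p) = 'X_x' * Y p. Proof. by rewrite YX ?ne. Qed.
Let Yy' p : Y ('X_y' * p) = 'X_y' * Y p. Proof. by rewrite YX ?ne. Qed.
Let Yz' p : Y ('X_z' * p) = 'X_z' * Y p. Proof. by rewrite YX ?ne. Qed.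
Let Yy p : Y ('X_y * p) = ('X_y - 'X_x * 'X_z) * Y p.
Proof. rewrite /drop_xz (flowX_eq _ qyN) -mulrDl; reflexivity. Qed.
Let Yd i p : Y p^`M(i) = (Y p)^`M(i) + ((i == x)%:R * 'X_z + 'X_x * (i == z)%:R) * (Y p)^`M(y).
Proof. rewrite /drop_xz (flow_deriv qyN) qd mulNr opprK; reflexivity. Qed.
Let Yd0 i p : (i == x) = false -> (i == z) = false -> Y p^`M(i) = (Y p)^`M(i).
Proof. by move=> ix iz; rewrite Yd ix iz mul0r mulr0 add0r mul0r addr0. Qed.
Let Ydx p : Y p^`M(x) = (Y p)^`M(x) + 'X_z * (Y p)^`M(y).
Proof. rewrite Yd eqxx ne mul1r mulr0 addr0; reflexivity. Qed.
Let Ydz p : Y p^`M(z) = (Y p)^`M(z) + 'X_x * (Y p)^`M(y).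
Proof. rewrite Yd eqxx ne mulr1 mul0r add0r; reflexivity. Qed.
Let Ydy p : Y p^`M(y) = (Y p)^`M(y). Proof. by rewrite Yd0 ?ne. Qed.
Let Ydx' p : Y p^`M(x') = (Y p)^`M(x'). Proof. by rewrite Yd0 ?ne. Qed.
Let Ydy' p : Y p^`M(y') = (Y p)^`M(y'). Proof. by rewrite Yd0 ?ne. Qed.
Let Ydz' p : Y p^`M(z') = (Y p)^`M(z'). Proof. by rewrite Yd0 ?ne. Qed.

Lemma mpoly_shear_lax1 a1 a2 a3 b1 b2 b3 v :
  map3 (fun p => Y (S p)) (L x' y' z' a1 a2 a3 (L x y z b1 b2 b3 v)) =
  lax_left X x' y' z' (sheared_mid1 k X D x y z x' y' z' a1 a2 a3
    (xyz_lax k X D x y z b1 b2 b3 (lax_right X x' y' z' (map3 (fun p => Y (S p)) v)))).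
Proof.
exact (shear_lax1 (shearD U) (shearN U) shear_scale (shear_x U) (shear_y U) (shear_z U)
  (shear_x' U) (shear_y' U) (shear_z' U) (shear_dx U) (shear_dy U) (shear_dz U)
  (shear_dx' U) (shear_dy' U) (shear_dz' U)
  YD YN Yk Yx Yy Yz Yx' Yy' Yz' Ydx Ydy Ydz Ydx' Ydy' Ydz' a1 a2 a3 b1 b2 b3 v).
Qed.

(** The balance of the parameters holds in all three operators, because on both
    sides the differences of the u_i and v_j add up to the same value. *)
Section GammaFunctions.
Variables al be ga de : C.
Hypotheses (al_gen : forall n : int, n%:~R + al != 0) (ga_gen : forall n : int, n%:~R + ga != 0)
  (balance : al + de = be + ga).
Local Notation Phi1 := (Gamma_quot al 1).
Local Notation Phi2 := (Gamma_quot ga de).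
Local Notation Phi3 := (Gamma_quot 1 be).

Let Phi1_neg (n : int) : n < 0 -> Phi1 n = 0. Proof. exact: Gamma_quot_neg. Qed.
Let Phi1_rec (n : int) : (n%:~R + 1) * Phi1 (n + 1) = (n%:~R + al) * Phi1 n.
Proof. exact: Gamma_quot_rec. Qed.
Let Phi2_rec (n : int) : (n%:~R + de) * Phi2 (n + 1) = (n%:~R + ga) * Phi2 n.
Proof. exact: Gamma_quot_rec. Qed.
Let Phi3_rec (n : int) : 0 <= n -> (n%:~R + be) * Phi3 (n + 1) = (n%:~R + 1) * Phi3 n.
Proof.
move=> n0; apply: Gamma_quot_rec.
by rewrite -(intrD _ n 1) intr_eq0 gt_eqF // ltr_wpDl.
Qed.

Let yz : y != z. Proof. by rewrite ne. Qed.
Let yx : y != x. Proof. by rewrite ne. Qed.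
Let zx : z != x. Proof. by rewrite ne. Qed.
Let jy : (y == y) || (y == x). Proof. by rewrite eqxx. Qed.
Let xz : x != z. Proof. by rewrite ne. Qed.

Lemma swap3 (u1 u2 u3 v1 v2 v3 : C) :
  al = u2 - v3 + 1 -> be = u2 - u3 + 1 -> ga = u1 - v3 + 1 -> de = u1 - u3 + 1 ->
  let r := core y z x y 1 Phi1 Phi2 Phi3 in
  forall v, map3 (fun p => shear_inv x y z x' y' z' (r (S p)))
    (L x y z u1 u2 u3 (L x' y' z' v1 v2 v3 v)) =
  L x y z u1 u2 v3 (L x' y' z' v1 v2 u3
    (map3 (fun p => shear_inv x y z x' y' z' (r (S p))) v)).
Proof.
move=> alE beE gaE deE r.
have rD p q : r (p + q) = r p + r q := coreD yx zx 1 Phi2 Phi3 Phi1_neg y p q.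
have rZ a p : r (a *: p) = a *: r p := core_scale yz yx zx 1 Phi2 Phi3 Phi1_neg y a p.
have rN p : r (- p) = - r p := coreN yz yx zx 1 Phi2 Phi3 Phi1_neg y p.
have rk a p : r (a%:MP * p) = a%:MP * r p by rewrite !mul_mpolyC rZ.
have rQ p : r (aQ k X D y z x 1 (u2 - u3 + 1) p) = aQ k X D y z x 1 (u2 - v3 + 1) (r p).
  rewrite !aQE -alE -beE; exact (core_Q yz yx zx 1 Phi2 Phi1_neg Phi1_rec Phi3_rec jy p).
have rM p : r (aM k X D y z x 1 (u1 - v3 + 1) p) = aM k X D y z x 1 (u1 - u3 + 1) (r p).
  rewrite !aME -gaE -deE; exact (core_M yz yx zx 1 Phi1_neg Phi1_rec Phi2_rec Phi3_rec balance p).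
have rF p : r (aF k X D y z x 1 (u2 - u1 - 1) p) = aF k X D y z x 1 (u2 - u1 - 1) (r p).
  rewrite !aFE; apply: (core_F yz yx zx 1 Phi1_neg Phi1_rec Phi2_rec Phi3_rec balance).
  rewrite beE deE; ring.
have rd p : r p^`M(x) = (r p)^`M(x) := core_dw yz yx zx 1 Phi2 Phi3 Phi1_neg p.
have rNyx p : r (aN X D y x p) = aN X D y x (r p).
  rewrite !aNE; exact (core_Nsw yz yx zx 1 Phi2 Phi3 Phi1_neg y p).
have rNyz p : r (aN X D y z p) = aN X D y z (r p).
  rewrite !aNE; exact (core_Nst yz yx zx 1 Phi2 Phi3 Phi1_neg y p).
have [rx' ry' rz'] : [/\ forall p, r ('X_x' * p) = 'X_x' * r p,
    forall p, r ('X_y' * p) = 'X_y' * r p & forall p, r ('X_z' * p) = 'X_z' * r p].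
  by split=> p; apply: core_X => //; rewrite ne.
have [rdx' rdy' rdz'] : [/\ forall p, r p^`M(x') = (r p)^`M(x'),
    forall p, r p^`M(y') = (r p)^`M(y') & forall p, r p^`M(z') = (r p)^`M(z')].
  by split=> p; apply: core_deriv => //; rewrite ne.
pose G a b := fun v => L x y z u1 u2 a (sheared_mid3 k X D x y z x' y' z' v1 v2 b v).
have rG v : map3 r (G u3 v3 v) = G v3 u3 (map3 r v).
  rewrite /G !(expanded3E PD PM Pk PX PC U).
  exact (intertwine_expanded3 PD PM Pk PX PC U v1 v2 mpoly_double_inj rD rk rQ rM rF rd rNyx rNyz rdx' rdy' rdz' rz' v).
exact (@intertwine_similar _ S (shear_inv x y z x' y' z') r
  (fun v => L x y z u1 u2 u3 (L x' y' z' v1 v2 v3 v))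
  (fun v => L x y z u1 u2 v3 (L x' y' z' v1 v2 u3 v)) (G u3 v3) (G v3 u3)
  (lax_right X x' y' z') (lax_left X x' y' z') (shearK U) (shear_invK U) (mpoly_shear_lax3 _ _ _ _ _ _)
  (mpoly_shear_lax3 _ _ _ _ _ _) (map3_lax_right rD rx' ry' rz') (map3_lax_left rD rN rx' ry' rz') rG).
Qed.
Let jx : (x == y) || (x == x). Proof. by rewrite eqxx orbT. Qed.
Let xz_y : (y == y) || (y == z). Proof. by rewrite eqxx. Qed.

Lemma swap2 (u1 u2 u3 v1 v2 v3 : C) :
  al = u2 - v3 + 1 -> be = v2 - v3 + 1 -> ga = u1 - v2 + 1 -> de = u1 - u2 + 1 ->
  let r := core y z x x 1 Phi1 Phi2 Phi3 in
  forall v, map3 (fun p => shear_inv x y z x' y' z' (r (S p)))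
    (L x y z' u1 u2 u3 (L x' y' z v1 v2 v3 v)) =
  L x y z' u1 v2 u3 (L x' y' z v1 u2 v3
    (map3 (fun p => shear_inv x y z x' y' z' (r (S p))) v)).
Proof.
move=> alE beE gaE deE r.
have rD p q : r (p + q) = r p + r q := coreD yx zx 1 Phi2 Phi3 Phi1_neg x p q.
have rZ a p : r (a *: p) = a *: r p := core_scale yz yx zx 1 Phi2 Phi3 Phi1_neg x a p.
have rN p : r (- p) = - r p := coreN yz yx zx 1 Phi2 Phi3 Phi1_neg x p.
have rk a p : r (a%:MP * p) = a%:MP * r p by rewrite !mul_mpolyC rZ.
have rQ p : r (aQ k X D y z x 1 (v2 - v3 + 1) p) = aQ k X D y z x 1 (u2 - v3 + 1) (r p).
  rewrite !aQE -alE -beE; exact (core_Q yz yx zx 1 Phi2 Phi1_neg Phi1_rec Phi3_rec jx p).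
have rG p : r (aG k X D y z x 1 (u1 - u2 + 1) p) = aG k X D y z x 1 (u1 - v2 + 1) (r p).
  rewrite !aGE -gaE -deE; exact (core_G yz yx zx 1 Phi1_neg Phi1_rec Phi2_rec Phi3_rec balance p).
have rT p : r (aT k X D y z x 1 (u1 + 1 - v3) p) = aT k X D y z x 1 (u1 + 1 - v3) (r p).
  rewrite !aTE; apply: (core_T yz yx zx 1 Phi1_neg Phi1_rec Phi2_rec Phi3_rec balance).
  rewrite beE gaE; ring.
have ry p : r ('X_y * p) = 'X_y * r p := core_s yz yx zx 1 Phi2 Phi3 Phi1_neg p.
have rNyx p : r (aN X D y x p) = aN X D y x (r p).
  rewrite !aNE; exact (core_Nsw yz yx zx 1 Phi2 Phi3 Phi1_neg x p).
have rNyz p : r (aN X D y z p) = aN X D y z (r p).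
  rewrite !aNE; exact (core_Nst yz yx zx 1 Phi2 Phi3 Phi1_neg x p).
have [rx' ry' rz'] : [/\ forall p, r ('X_x' * p) = 'X_x' * r p,
    forall p, r ('X_y' * p) = 'X_y' * r p & forall p, r ('X_z' * p) = 'X_z' * r p].
  by split=> p; apply: core_X => //; rewrite ne.
have [rdx' rdy' rdz'] : [/\ forall p, r p^`M(x') = (r p)^`M(x'),
    forall p, r p^`M(y') = (r p)^`M(y') & forall p, r p^`M(z') = (r p)^`M(z')].
  by split=> p; apply: core_deriv => //; rewrite ne.
pose G a b := sheared_lax2 k X D x y z x' y' z' u1 a u3 v1 b v3.
have G_core v : map3 r (G u2 v2 v) = G v2 u2 (map3 r v).
  rewrite /G !(expanded2E PD PM Pk PX PC U).
  exact (intertwine_expanded2 PD PM Pk PX PC U u3 v1 mpoly_double_inj rD rk rQ rG rT ry rNyx rNyz rdx' rdy' rdz' rz' v).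
exact (@intertwine_similar _ S (shear_inv x y z x' y' z') r
  (fun v => L x y z' u1 u2 u3 (L x' y' z v1 v2 v3 v))
  (fun v => L x y z' u1 v2 u3 (L x' y' z v1 u2 v3 v)) (G u2 v2) (G v2 u2)
  (lax_right X x' y' z') (lax_left X x' y' z') (shearK U) (shear_invK U) (mpoly_shear_lax2 _ _ _ _ _ _)
  (mpoly_shear_lax2 _ _ _ _ _ _) (map3_lax_right rD rx' ry' rz') (map3_lax_left rD rN rx' ry' rz') G_core).
Qed.

Lemma swap1 (u1 a2 a3 v1 v2 v3 : C) :
  al = u1 - v2 + 1 -> be = v1 - v2 + 1 -> ga = u1 - v3 + 1 -> de = v1 - v3 + 1 ->
  let r := core y x z y (- 1) Phi1 Phi2 Phi3 in
  forall v, map3 (fun p => shear_inv x y z x' y' z' (Yinv (r (Y (S p)))))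
    (L x' y' z' u1 a2 a3 (L x y z v1 v2 v3 v)) =
  L x' y' z' v1 a2 a3 (L x y z u1 v2 v3
    (map3 (fun p => shear_inv x y z x' y' z' (Yinv (r (Y (S p))))) v)).
Proof.
move=> alE beE gaE deE r.
have rD p q : r (p + q) = r p + r q := coreD yz xz (-1) Phi2 Phi3 Phi1_neg y p q.
have rZ a p : r (a *: p) = a *: r p := core_scale yx yz xz (-1) Phi2 Phi3 Phi1_neg y a p.
have rN p : r (- p) = - r p := coreN yx yz xz (-1) Phi2 Phi3 Phi1_neg y p.
have rk a p : r (a%:MP * p) = a%:MP * r p by rewrite !mul_mpolyC rZ.
have rQ p : r (aQ k X D y x z (-1) (v1 - v2 + 1) p) = aQ k X D y x z (-1) (u1 - v2 + 1) (r p).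
  rewrite !aQE -alE -beE; exact (core_Q yx yz xz (-1) Phi2 Phi1_neg Phi1_rec Phi3_rec xz_y p).
have rM p : r (aM k X D y x z (-1) (u1 - v3 + 1) p) = aM k X D y x z (-1) (v1 - v3 + 1) (r p).
  rewrite !aME -gaE -deE; exact (core_M yx yz xz (-1) Phi1_neg Phi1_rec Phi2_rec Phi3_rec balance p).
have rF p : r (aF k X D y x z (-1) (v3 - v2 - 1) p) = aF k X D y x z (-1) (v3 - v2 - 1) (r p).
  rewrite !aFE; apply: (core_F yx yz xz (-1) Phi1_neg Phi1_rec Phi2_rec Phi3_rec balance).
  rewrite beE deE; ring.
have rd p : r p^`M(z) = (r p)^`M(z) := core_dw yx yz xz (-1) Phi2 Phi3 Phi1_neg p.
have rNyz p : r (aN X D y z p) = aN X D y z (r p).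
  rewrite !aNE; exact (core_Nsw yx yz xz (-1) Phi2 Phi3 Phi1_neg y p).
have rNyx p : r (aN X D y x p) = aN X D y x (r p).
  rewrite !aNE; exact (core_Nst yx yz xz (-1) Phi2 Phi3 Phi1_neg y p).
have [rx' ry' rz'] : [/\ forall p, r ('X_x' * p) = 'X_x' * r p,
    forall p, r ('X_y' * p) = 'X_y' * r p & forall p, r ('X_z' * p) = 'X_z' * r p].
  by split=> p; apply: core_X => //; rewrite ne.
have [rdx' rdy' rdz'] : [/\ forall p, r p^`M(x') = (r p)^`M(x'),
    forall p, r p^`M(y') = (r p)^`M(y') & forall p, r p^`M(z') = (r p)^`M(z')].
  by split=> p; apply: core_deriv => //; rewrite ne.
pose G a b := fun v => sheared_mid1 k X D x y z x' y' z' a a2 a3 (xyz_lax k X D x y z b v2 v3 v).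
have rG v : map3 r (G u1 v1 v) = G v1 u1 (map3 r v).
  rewrite /G !(expanded1E PD PM Pk PX PC U).
  exact (intertwine_expanded1 PD PM Pk PX PC U mpoly_double_inj rD rk rQ rM rF rd rNyx rNyz rdx' rdy' rdz' rz' a2 a3 v).
have TK p : shear_inv x y z x' y' z' (Yinv (Y (S p))) = p by rewrite YK (shearK U).
have TinvK p : Y (S (shear_inv x y z x' y' z' (Yinv p))) = p by rewrite (shear_invK U) YinvK.
exact (@intertwine_similar _ (fun p => Y (S p)) (fun p => shear_inv x y z x' y' z' (Yinv p)) r
  (fun v => L x' y' z' u1 a2 a3 (L x y z v1 v2 v3 v))
  (fun v => L x' y' z' v1 a2 a3 (L x y z u1 v2 v3 v)) (G u1 v1) (G v1 u1)
  (lax_right X x' y' z') (lax_left X x' y' z') TK TinvK (mpoly_shear_lax1 _ _ _ _ _ _)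
  (mpoly_shear_lax1 _ _ _ _ _ _) (map3_lax_right rD rx' ry' rz') (map3_lax_left rD rN rx' ry' rz') rG).
Qed.
End GammaFunctions.
End Generic.
End Concrete.

(** * Composition of the exchanges *)

Section Final.
Variable R : realType.
Local Notation C := R[i].
Local Notation P := {mpoly C[6]}.
Local Notation vec := (vec P).
Local Notation X := (fun i : 'I_6 => 'X_i : P).
Local Notation D := (fun i : 'I_6 => mderiv i : P -> P).
Local Notation k := (@mpolyC 6 C).
Local Notation L := (lax k X D).

Lemma entry_map3 (T : P -> P) v i : entry (map3 T v) i = T (entry v i).
Proof. case: i => [[|[|[|i]]]] //= _; reflexivity. Qed.

Lemma entry_unit_vec (j i : 'I_3) (p : P) : entry (unit_vec j p) i = (i == j)%:R * p.
Proof. by case: i => [[|[|[|//]]] ?]; rewrite /entry /unit_vec /= eq_sym. Qed.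

Lemma acts_entry (M : opmx R) F i j p : additive_mx M -> acts M F ->
  M i j p = entry (F (unit_vec j p)) i.
Proof.
move=> Ml MF; rewrite MF (bigD1 j) //= entry_unit_vec eqxx mul1r big1 ?addr0 // => l lj.
by rewrite entry_unit_vec (negPf lj) mul0r additive_mx0.
Qed.

Lemma map3_unit_vec (T : P -> P) j p : T 0 = 0 -> map3 T (unit_vec j p) = unit_vec j (T p).
Proof.
move=> T0; have TM (b : bool) : T (b%:R * p) = b%:R * T p.
  by case: b; [rewrite !mul1r | rewrite !mul0r].
rewrite /map3 /unit_vec /= !TM; reflexivity.
Qed.

Lemma intertwines_of_vec (T : P -> P) (M M' : opmx R) F F' : T 0 = 0 ->
  additive_mx M -> additive_mx M' -> acts M F -> acts M' F' ->
  (forall v, map3 T (F v) = F' (map3 T v)) -> op_opmx T M = opmx_op M' T.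
Proof.
move=> T0 Ml Ml' MF MF' FT; apply/matrixP => i j; rewrite !mxE; apply: funext => p /=.
rewrite (acts_entry _ _ _ Ml MF) (acts_entry _ _ _ Ml' MF').
by rewrite -entry_map3 FT map3_unit_vec.
Qed.

Lemma additive0 (T : P -> P) : (forall p q, T (p + q) = T p + T q) -> T 0 = 0.
Proof. by move=> /(_ 0 0); rewrite addr0 => /(congr1 (fun q => q - T 0)); rewrite addrK subrr. Qed.

Lemma Lax_mul_acts x y z a1 a2 a3 x' y' z' b1 b2 b3 :
  let M : opmx R := opmx_mul (Lax x y z a1 a2 a3) (Lax x' y' z' b1 b2 b3) in
  acts M (fun v => L x y z a1 a2 a3 (L x' y' z' b1 b2 b3 v)) /\ additive_mx M.
Proof.
have [aA lA] := Lax_acts x y z a1 a2 a3; have [aB lB] := Lax_acts x' y' z' b1 b2 b3.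
by split; [exact: acts_mul lA aA aB | exact: additive_mx_mul].
Qed.

Lemma Lax_intertwines T x y z a1 a2 a3 x' y' z' b1 b2 b3 c1 c2 c3 d1 d2 d3 : T 0 = 0 ->
  (forall v, map3 T (L x y z a1 a2 a3 (L x' y' z' b1 b2 b3 v)) =
    L x y z c1 c2 c3 (L x' y' z' d1 d2 d3 (map3 T v))) ->
  op_opmx T (opmx_mul (Lax x y z a1 a2 a3) (Lax x' y' z' b1 b2 b3)) =
  opmx_op (opmx_mul (Lax x y z c1 c2 c3) (Lax x' y' z' d1 d2 d3)) T.
Proof.
move=> T0 H.
have [aA lA] := Lax_mul_acts x y z a1 a2 a3 x' y' z' b1 b2 b3.
have [aB lB] := Lax_mul_acts x y z c1 c2 c3 x' y' z' d1 d2 d3.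
exact: intertwines_of_vec T0 lA lB aA aB H.
Qed.

Definition non_int (a : C) := forall n : int, a != n%:~R.

Lemma non_int_shift a : non_int a -> forall n : int, n%:~R + (a + 1) != 0.
Proof.
move=> an n; apply: contra (an (- (n + 1))) => /eqP H.
by rewrite mulrNz intrD -[X in X == _]subr0 -H; apply/eqP; ring.
Qed.

Lemma core_Gamma0 s t w j (c a b g e : C) : s != w -> t != w ->
  core s t w j c (Gamma_quot a 1) (Gamma_quot g e) (Gamma_quot 1 b) (0 : P) = 0.
Proof.
move=> sw tw; apply: additive0 => p q.
apply: (coreD sw tw) => n; exact: Gamma_quot_neg.
Qed.

Lemma shear_inv0 x y z x' y' z' : uniq [:: x; y; z; x'; y'; z'] ->
  @shear_inv R x y z x' y' z' 0 = 0.
Proof.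
move=> U; have s0 : shear x y z x' y' z' (0 : P) = 0 := additive0 (shearD U).
by rewrite -[in LHS]s0 (shearK U).
Qed.

Lemma R3_intertwines u1 u2 u3 v1 v2 v3 : non_int (u2 - v3) -> non_int (u1 - v3) ->
  op_opmx (R3 u1 u2 u3 v3) (opmx_mul (Lax1 u1 u2 u3) (Lax2 v1 v2 v3)) =
  opmx_op (opmx_mul (Lax1 u1 u2 v3) (Lax2 v1 v2 u3)) (R3 u1 u2 u3 v3).
Proof.
move=> /non_int_shift g1 /non_int_shift g2.
have U : uniq [:: x1; y1; z1; x2; y2; z2] by [].
have bal : (u2 - v3 + 1) + (u1 - u3 + 1) = (u2 - u3 + 1) + (u1 - v3 + 1) by ring.
apply: Lax_intertwines; last exact (swap3 U g1 g2 bal v1 v2 erefl erefl erefl erefl).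
change (shear_inv x1 y1 z1 x2 y2 z2
    (core y1 z1 x1 y1 1 (Gamma_quot (u2 - v3 + 1) 1) (Gamma_quot (u1 - v3 + 1) (u1 - u3 + 1))
      (Gamma_quot 1 (u2 - u3 + 1)) (shear x1 y1 z1 x2 y2 z2 0)) = 0).
by rewrite (additive0 (shearD U)) core_Gamma0 // shear_inv0.
Qed.

Lemma R2_intertwines u1 u2 u3 v1 v2 v3 : non_int (u2 - v3) -> non_int (u1 - v2) ->
  op_opmx (R2 u1 u2 v2 v3) (opmx_mul (Lax1 u1 u2 u3) (Lax2 v1 v2 v3)) =
  opmx_op (opmx_mul (Lax1 u1 v2 u3) (Lax2 v1 u2 v3)) (R2 u1 u2 v2 v3).
Proof.
move=> /non_int_shift g1 /non_int_shift g2.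
have U : uniq [:: x1; y1; z2; x2; y2; z1] by [].
have bal : (u2 - v3 + 1) + (u1 - u2 + 1) = (v2 - v3 + 1) + (u1 - v2 + 1) by ring.
apply: Lax_intertwines; last exact (swap2 U g1 g2 bal u3 v1 erefl erefl erefl erefl).
change (shear_inv x1 y1 z2 x2 y2 z1
    (core y1 z2 x1 x1 1 (Gamma_quot (u2 - v3 + 1) 1) (Gamma_quot (u1 - v2 + 1) (u1 - u2 + 1))
      (Gamma_quot 1 (v2 - v3 + 1)) (shear x1 y1 z2 x2 y2 z1 0)) = 0).
by rewrite (additive0 (shearD U)) core_Gamma0 // shear_inv0.
Qed.

Lemma to_xyzE : @to_xyz R = drop_xz x2 y2 z2.
Proof.
apply: funext => p; apply: flow_comp_mpoly.
  by rewrite mderivN mderivM !mderivXU mul0r mulr0 addr0 oppr0.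
by case; do 6?[case=> [?|]] => //; rewrite /tnth /= ?mulr0 ?addr0 ?mulr1; reflexivity.
Qed.

Lemma of_xyzE : @of_xyz R = add_xz x2 y2 z2.
Proof.
apply: funext => p; apply: flow_comp_mpoly.
  by rewrite mderivM !mderivXU mul0r mulr0 addr0.
by case; do 6?[case=> [?|]] => //; rewrite /tnth /= ?mulr0 ?addr0 ?mulr1; reflexivity.
Qed.

Lemma R1E (u1 v1 v2 v3 : C) : R1 u1 v1 v2 v3 = fun p => shear_inv x2 y2 z2 x1 y1 z1 (add_xz x2 y2 z2
    (core y2 x2 z2 y2 (-1) (Gamma_quot (u1 - v2 + 1) 1) (Gamma_quot (u1 - v3 + 1) (v1 - v3 + 1))
      (Gamma_quot 1 (v1 - v2 + 1)) (drop_xz x2 y2 z2 (shear x2 y2 z2 x1 y1 z1 p)))).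
Proof.
have q1 : 'X_z1 * 'X_x2 = 'X_x2 * 'X_z1 :> P := mulrC _ _.
apply: funext => p.
rewrite /R1 of_xyzE to_xyzE /S1 /S1inv q1 /R1_laurent /core /core_laurent /tail opprK.
reflexivity.
Qed.

Lemma R1_intertwines u1 u2 u3 v1 v2 v3 : non_int (u1 - v2) -> non_int (u1 - v3) ->
  op_opmx (R1 u1 v1 v2 v3) (opmx_mul (Lax1 u1 u2 u3) (Lax2 v1 v2 v3)) =
  opmx_op (opmx_mul (Lax1 v1 u2 u3) (Lax2 u1 v2 v3)) (R1 u1 v1 v2 v3).
Proof.
move=> /non_int_shift g1 /non_int_shift g2.
have U : uniq [:: x2; y2; z2; x1; y1; z1] by [].
have bal : (u1 - v2 + 1) + (v1 - v3 + 1) = (v1 - v2 + 1) + (u1 - v3 + 1) by ring.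
rewrite R1E.
apply: Lax_intertwines; last exact (swap1 U g1 g2 bal u2 u3 erefl erefl erefl erefl).
have q0 : ('X_x2 * 'X_z2 : P)^`M(y2) = 0 by rewrite mderivM !mderivXU mul0r mulr0 addr0.
have q0N : (- ('X_x2 * 'X_z2) : P)^`M(y2) = 0 by rewrite mderivN q0 oppr0.
have drop0 : drop_xz x2 y2 z2 (0 : P) = 0 := additive0 (flowD q0N).
have add0 : add_xz x2 y2 z2 (0 : P) = 0 := additive0 (flowD q0).
have shear0 : shear x2 y2 z2 x1 y1 z1 (0 : P) = 0 := additive0 (shearD U).
by cbv beta; rewrite shear0 drop0 core_Gamma0 ?add0 ?shear_inv0.
Qed.

Lemma intertwines_comp (S T : P -> P) M M' M'' :
  op_opmx T M = opmx_op M' T -> op_opmx S M' = opmx_op M'' S ->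
  op_opmx (S \o T) M = opmx_op M'' (S \o T).
Proof.
move=> TM SM; apply/matrixP => i j; rewrite !mxE; apply: funext => p /=.
move: TM SM => /matrixP/(_ i j) + /matrixP/(_ i j); rewrite !mxE.
move=> /(congr1 (fun f => f p)) /= TM /(congr1 (fun f => f (T p))) /= <-.
by rewrite TM.
Qed.

End Final.

Theorem proposition7 (R : realType) (u1 u2 u3 v1 v2 v3 : R[i])
    (hgen : generic u1 u2 u3 v1 v2 v3) :
  let Rcheck :=
    R1 u1 v1 u2 u3 \o R2 u1 u2 v2 u3 \o R3 u1 u2 u3 v3 in
  op_opmx Rcheck (opmx_mul (Lax1 u1 u2 u3) (Lax2 v1 v2 v3)) =
  opmx_op (opmx_mul (Lax1 v1 v2 v3) (Lax2 u1 u2 u3)) Rcheck.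
Proof.
pose s := [:: u1; u2; u3; v1; v2; v3].
have g (i j : nat) : (i < 6)%N -> (j < 6)%N -> i != j -> non_int (s`_i - s`_j).
  by move=> i6 j6 ij; exact: (hgen (Ordinal i6) (Ordinal j6) ij).
apply: intertwines_comp; first exact: R3_intertwines (g 1%N 5%N isT isT isT) (g 0%N 5%N isT isT isT).
apply: intertwines_comp; first exact: R2_intertwines (g 1%N 2%N isT isT isT) (g 0%N 4%N isT isT isT).
exact: R1_intertwines (g 0%N 1%N isT isT isT) (g 0%N 2%N isT isT isT).
Qed.
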